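(* Fix an integer $k\ge1$ and $\lambda\in(0,1)$. There exist constants $c=c(\lambda,k)>0$ and $\delta=\delta(\lambda,k)\in(0,1)$ such that for all sufficiently large $m$ the following holds. Let $R$ be an axis-parallel $m\times k$ rectangle contained in $[-n/2,n/2]\times[0,k]$, and $\xi$ a boundary condition for $\Lambda^0_{n,k}$ no edge of which intersects $R$. If $\sigma\sim\pi^\xi_{n,k}$, then $\pi^\xi_{n,k}\big(C_R(\sigma)\le\delta m\big)\le e^{-cm}$.
   Context: For integers $n,k\ge1$, $\Lambda^0_{n,k}$ is the set of integer points in $[-n/2,n/2]\times[0,k]$. Edges are open straight segments with endpoints in $\Lambda^0_{n,k}$; $|e|$ is the $\ell_1$ length. A triangulation of $\Lambda^0_{n,k}$ is a maximal set of pairwise disjoint edges containing no point of $\Lambda^0_{n,k}$; all triangulations share the same set $\Lambda_{n,k}$ of edge midpoints, and $\sigma_x$ is the edge of $\sigma$ with midpoint $x$. A boundary condition $\xi$ is a set of pairwise disjoint edges containing no point of $\Lambda^0_{n,k}$ and containing the unit boundary segments of the rectangle; $\Omega^\xi_{n,k}$ is the set of triangulations containing all edges of $\xi$, and for $\lambda>0$, $\pi^\xi_{n,k}(\sigma)\propto\lambda^{\sum_{x\in\Lambda_{n,k}}|\sigma_x|}$ on $\Omega^\xi_{n,k}$. A top-to-bottom crossing of unit verticals at horizontal coordinate $a\in\mathbb{Z}$ means that $\sigma$ contains all $k$ unit vertical edges $\{a\}\times(j,j+1)$, $j=0,\dots,k-1$. $C_R(\sigma)$ is the number of integers $a$ such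 that $\sigma$ has a top-to-bottom crossing of unit verticals at coordinate $a$ lying inside $R$. *)

(* Defs.v *)
From mathcomp Require Import all_boot.
From Stdlib Require Import Reals ClassicalEpsilon.

Set Implicit Arguments.
Unset Strict Implicit.
Unset Printing Implicit Defensive.

Definition asbool (P : Prop) : bool :=
  if excluded_middle_informative P then true else false.

(* Lattice points of Lambda^0_{n,k} = Z^2 /\ [-n/2,n/2] x [0,k].
   The integers in [-n/2,n/2] are exactly -h, ..., h with h = n./2 (floor).
   A point is encoded as (i, j) : 'I_(2h+1) * 'I_(k+1), standing for the
   lattice point (i - h, j).                                               *)
Definition pt (n k : nat) := ('I_(n./2).*2.+1 * 'I_k.+1)%type.

Definition X {n k : nat} (p : pt n k) : R := (INR p.1 - INR n./2)%R.
Definition Y {n k : nat} (p : pt n k) : R := INR p.2.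

(* An (oriented) pair of endpoints; an edge is the open straight segment
   between them.  Each geometric edge is listed with both orientations as
   pairs, so a set of edges is a set of pairs that we require to contain
   each segment in exactly one orientation (see [edge_set_ok]). *)
Definition edge (n k : nat) := (pt n k * pt n k)%type.

Definition on_open {n k} (e : edge n k) (P : R * R) : Prop :=
  exists t : R, (0 < t < 1)%R /\
    fst P = (X e.1 + t * (X e.2 - X e.1))%R /\
    snd P = (Y e.1 + t * (Y e.2 - Y e.1))%R.

Definition good_edge {n k} (e : edge n k) : Prop :=
  e.1 <> e.2 /\ forall p : pt n k, ~ on_open e (X p, Y p).

Definition natdist (a b : nat) : nat := (a - b) + (b - a).
Definition elen {n k} (e : edge n k) : nat :=
  natdist e.1.1 e.2.1 + natdist e.1.2 e.2.2.

Definition edge_set_ok {n k} (S : {set edge n k}) : Prop :=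
  (forall e, e \in S -> good_edge e /\ (e.2, e.1) \notin S) /\
  (forall e1 e2, e1 \in S -> e2 \in S -> e1 <> e2 ->
     forall P : R * R, ~ (on_open e1 P /\ on_open e2 P)).

Definition triangulation {n k} (T : {set edge n k}) : Prop :=
  edge_set_ok T /\
  forall S : {set edge n k}, edge_set_ok S -> T \subset S -> S = T.

Definition has_edge {n k} (S : {set edge n k}) (a b : pt n k) : Prop :=
  (a, b) \in S \/ (b, a) \in S.

(* Unit segments on the boundary of the rectangle (boundary of the convex
   hull [-h,h] x [0,k] of Lambda^0_{n,k}). *)
Definition unit_boundary {n k} (e : edge n k) : Prop :=
  elen e = 1%N /\
  ( (nat_of_ord e.1.2 = 0%N /\ nat_of_ord e.2.2 = 0%N)
  \/ (nat_of_ord e.1.2 = k /\ nat_of_ord e.2.2 = k)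
  \/ (nat_of_ord e.1.1 = 0%N /\ nat_of_ord e.2.1 = 0%N)
  \/ (nat_of_ord e.1.1 = (n./2).*2 /\ nat_of_ord e.2.1 = (n./2).*2) ).

Definition boundary_condition {n k} (xi : {set edge n k}) : Prop :=
  edge_set_ok xi /\
  forall e : edge n k, unit_boundary e -> has_edge xi e.1 e.2.

Definition Omega {n k} (xi : {set edge n k}) (s : {set edge n k}) : bool :=
  asbool (triangulation s /\ xi \subset s).

Definition weight {n k} (lam : R) (s : {set edge n k}) : R :=
  pow lam (\sum_(e in s) elen e).

Definition prob {n k} (lam : R) (xi : {set edge n k})
    (E : {set edge n k} -> Prop) : R :=
  Rdiv (\big[Rplus/0%R]_(s : {set edge n k} | Omega xi s && asbool (E s))
          weight lam s)
       (\big[Rplus/0%R]_(s : {set edge n k} | Omega xi s) weight lam s).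

Definition in_rect (k : nat) (x0 : R) (m : nat) (P : R * R) : Prop :=
  (x0 <= fst P <= x0 + INR m)%R /\ (0 <= snd P <= INR k)%R.

Definition meets_rect {n k} (e : edge n k) (x0 : R) (m : nat) : Prop :=
  exists P : R * R, on_open e P /\ in_rect k x0 m P.

Definition crossing {n k} (s : {set edge n k}) (i : 'I_(n./2).*2.+1) : Prop :=
  forall j : 'I_k,
    has_edge s (i, (inord j : 'I_k.+1)) (i, (inord j.+1 : 'I_k.+1)).

Definition C_R {n k} (s : {set edge n k}) (x0 : R) (m : nat) : nat :=
  #|[set i : 'I_(n./2).*2.+1 |
       asbool (crossing s i /\
               in_rect k x0 m ((INR i - INR n./2)%R, 0%R))]|.

(* Main.v *)
From Stdlib Require Import ZArith Lia Lra Psatz Classical ClassicalEpsilon.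
From HB Require Import structures.
Require Import Defs.
From mathcomp Require Import all_boot zify.
From Stdlib Require Import Reals.

(** Fix a column [a] of the window. An edge spans [a] if it crosses the line
    [x = a] without being vertical; if no edge does, maximality forces the
    crossing at [a]. In a triangulation a longest edge spanning [a] is the longest
    side of both its triangles, which are unimodular, so it is a diagonal of a
    lattice parallelogram and can be flipped to a shorter one. Repeating this
    sends [s] to a triangulation [s'] with a crossing at [a], and
    [w s <= lam ^ Gamma * w s'], where [Gamma] adds up the guaranteed gains of the
    edges of [s] spanning [a].

    The fibers of [s |-> s'] have bounded weight. An edge of vector (w, q) with
    [|q| > 1] gains at least w / k, so these edges are summable. An edge with
    [|q| = 1] gains twice the distance from the column to its nearest end. The
    edges with [|q| = 1] and an end near the column form fans, and each fan is an
    interval of widths, hence is given by its two extremities. Moreover an edge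
    with [|q| = 1] centred at distance t from the column forces about 2t edges to
    span the column. So the number of fan configurations is polynomial in the
    number of spanning edges, while [Gamma] is at least twice that number.

    Since a flip sequence creates at most [2 (k + 1) Gamma] new crossings, the
    same bound holds with an extra factor [z ^ (C_R s' - C_R s)] for some [z > 1].
    Summing over [a], the function [F = sum w s * z ^ (- C_R s)] satisfies
    [m * F <= K * sum w s * C_R s * z ^ (- C_R s)]. Hence the tilted measure has
    many crossings, which bounds [F] and thus the lower tail of [C_R]. *)

Set Implicit Arguments.
Unset Strict Implicit.
Unset Printing Implicit Defensive.

(* [ZArith] rebinds [%N] to binary naturals. *)
Delimit Scope nat_scope with N.

(** * Lattice segments and unimodular triangles *)

(** A plain Peierls sum fails because of the edges of height 1: one with an end near the column can
    be arbitrarily wide at bounded gain, so the sum of [lam ^ gain] over all possible spanning edges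
    is not bounded uniformly in [n]. The cut-off depth [A] resolves this. Edges of height 1 that
    reach less deep are coded through their fans; the others contribute a sum of at most [T + 1]
    times a quantity that decays geometrically in [A], where [T] is the number of spanning edges,
    and for a fixed large [A] this is absorbed by the gain, which is at least [2 * T]. Only
    finiteness of the fiber bound [K] matters, not its size: the comparison yields a density of
    crossings of order 1/K, which is why every [lam] below 1 is covered. The energy [- ln lam] is
    spent in two halves, one on the fiber sum and one on the tilt by the number of crossings. The
    boundary condition survives the descent because none of its edges spans a column of the window
    and only spanning edges are ever flipped. *)

Definition side (p q r : Z * Z) : Z :=
  ((q.1 - p.1) * (r.2 - p.2) - (q.2 - p.2) * (r.1 - p.1))%Z.

(** The signs are strict, so segments that share an end or lie on one line do not cross in this
    sense. For primitive segments the only other way to meet in the open interiors is to coincide,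
    see [common_Xing]. *)
Definition Xing (p q r s : Z * Z) : Prop :=
  (side p q r * side p q s < 0)%Z /\ (side r s p * side r s q < 0)%Z.

(** By Cramer's rule the crossing point divides each segment in the ratio of the [side] values of
    its ends. These integers serve as weights, so the rational crossing point never has to be
    formed. *)
Lemma Xing_weights p q r s : Xing p q r s -> exists a b c d : Z,
  (0 < a /\ 0 < b /\ 0 < c /\ 0 < d /\ a + b = c + d /\
  a * p.1 + b * q.1 = c * r.1 + d * s.1 /\
  a * p.2 + b * q.2 = c * r.2 + d * s.2)%Z.
Proof.
case=> h1 h2.
have e0 : (side r s p - side r s q = side p q s - side p q r)%Z.
  by rewrite /side; ring.
have e1 : (- side r s q * p.1 + side r s p * q.1
  = side p q s * r.1 - side p q r * s.1)%Z by rewrite /side; ring.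
have e2 : (- side r s q * p.2 + side r s p * q.2
  = side p q s * r.2 - side p q r * s.2)%Z by rewrite /side; ring.
move: h1 h2 e0 e1 e2.
move: (side r s p) (side r s q) (side p q r) (side p q s) => A B C D.
move=> /Z.lt_mul_0 h1 /Z.lt_mul_0 h2 e0 e1 e2.
case: h2 => h2.
  by exists B, (- A)%Z, (- D)%Z, C; lia.
by exists (- B)%Z, A, D, (- C)%Z; lia.
Qed.

Lemma Xing_symlr p q r s : Xing p q r s -> Xing r s p q.
Proof. by case. Qed.

Lemma sideC p q r : side q p r = (- side p q r)%Z.
Proof. by rewrite /side; ring. Qed.

Lemma Xing_swapl p q r s : Xing p q r s -> Xing q p r s.
Proof.
rewrite /Xing !(sideC p q); case=> h1 h2; split; first nia.
by rewrite Z.mul_comm.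
Qed.

Lemma Xing_swapr p q r s : Xing p q r s -> Xing p q s r.
Proof. by move/Xing_symlr/Xing_swapl/Xing_symlr. Qed.

(** Coprimality in Bezout form: the coefficients are transported explicitly by unimodular maps, and
    they complete the vector to a lattice basis. *)
Definition prim (p q : Z * Z) : Prop :=
  exists x y : Z, (x * (q.1 - p.1) + y * (q.2 - p.2) = 1)%Z.

Lemma prim_sym p q : prim p q -> prim q p.
Proof. by case=> x [y h]; exists (- x)%Z, (- y)%Z; lia. Qed.

(* The geometry of a triangulation, stripped of orientations: [G p q] says that
   the segment [p, q] is an edge, and [B] is the set of available points. *)
Record triang (B : Z * Z -> Prop) (G : Z * Z -> Z * Z -> Prop) : Prop := Triang {
  triang_sym : forall p q, G p q -> G q p;
  triang_inl : forall p q, G p q -> B p;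
  triang_prim : forall p q, G p q -> prim p q;
  triang_nX : forall p q r s, G p q -> G r s -> ~ Xing p q r s;
  triang_max : forall p q, B p -> B q -> prim p q ->
    (forall r s, G r s -> ~ Xing p q r s) -> G p q;
  triang_convex : forall (a b c : Z) p q r s, (0 <= a)%Z -> (0 <= b)%Z -> (0 <= c)%Z ->
    (0 < a + b + c)%Z -> B p -> B q -> B r ->
    ((a + b + c) * s.1 = a * p.1 + b * q.1 + c * r.1)%Z ->
    ((a + b + c) * s.2 = a * p.2 + b * q.2 + c * r.2)%Z -> B s;
  triang_fin : exists N : Z, forall p, B p -> (Z.abs p.1 <= N /\ Z.abs p.2 <= N)%Z }.

Lemma triang_inr B G p q : triang B G -> G p q -> B q.
Proof. by move=> T /(triang_sym T) /(triang_inl T). Qed.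

Definition frame (o u v P : Z * Z) : Z * Z :=
  ((o.1 + P.1 * u.1 + P.2 * v.1)%Z, (o.2 + P.1 * u.2 + P.2 * v.2)%Z).

Definition det (u v : Z * Z) : Z := (u.1 * v.2 - u.2 * v.1)%Z.

Lemma side_frame o u v p q r :
  side (frame o u v p) (frame o u v q) (frame o u v r) = (det u v * side p q r)%Z.
Proof. by rewrite /side /frame /det /=; ring. Qed.

Lemma Xing_frame o u v p q r s : (det u v * det u v = 1)%Z ->
  Xing (frame o u v p) (frame o u v q) (frame o u v r) (frame o u v s) <->
  Xing p q r s.
Proof.
move=> d; rewrite /Xing !side_frame.
have e x y : (det u v * x * (det u v * y) = (det u v * det u v) * (x * y))%Z by ring.
by rewrite !e d !Z.mul_1_l.
Qed.

Lemma frame_inv o u v Q : (det u v * det u v = 1)%Z -> exists P, Q = frame o u v P.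
Proof.
move=> d.
exists ((det u v * det ((Q.1 - o.1)%Z, (Q.2 - o.2)%Z) v)%Z,
        (det u v * det u ((Q.1 - o.1)%Z, (Q.2 - o.2)%Z))%Z).
rewrite /frame /= [LHS]surjective_pairing; congr pair.
  transitivity (o.1 + det u v * det u v * (Q.1 - o.1))%Z; first by rewrite d; ring.
  by rewrite /det /=; ring.
transitivity (o.2 + det u v * det u v * (Q.2 - o.2))%Z; first by rewrite d; ring.
by rewrite /det /=; ring.
Qed.

Lemma prim_frame o u v p q : (det u v * det u v = 1)%Z ->
  prim (frame o u v p) (frame o u v q) <-> prim p q.
Proof.
move=> d; split=> -[x [y h]].
  exists (x * u.1 + y * u.2)%Z, (x * v.1 + y * v.2)%Z.
  by rewrite -h /frame /=; ring.
exists (det u v * (x * v.2 - y * u.2))%Z, (det u v * (y * u.1 - x * v.1))%Z.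
transitivity (det u v * det u v * (x * (q.1 - p.1) + y * (q.2 - p.2)))%Z.
  by rewrite /frame /det /=; ring.
by rewrite h d.
Qed.

Lemma abs_det_le (x y m n a b : Z) : (Z.abs x <= m)%Z -> (Z.abs y <= n)%Z ->
  (Z.abs (x * a - y * b) <= (m + n) * (Z.abs a + Z.abs b))%Z.
Proof.
move=> hx hy; have := Z.abs_triangle (x * a) (- (y * b)).
rewrite Z.abs_opp !Z.abs_mul Z.add_opp_r.
have := Z.abs_nonneg x; have := Z.abs_nonneg y.
have := Z.abs_nonneg a; have := Z.abs_nonneg b; move: hx hy.
by move: (Z.abs x) (Z.abs y) (Z.abs a) (Z.abs b) (Z.abs _) => x' y' a' b' c'; nia.
Qed.

(** This permits the choice of convenient coordinates. A lattice automorphism turns the box into a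
    parallelogram, hence [triang] asks of [B] only convexity and boundedness, which are
    preserved. *)
Lemma triang_frame B G o u v : (det u v * det u v = 1)%Z -> triang B G ->
  triang (fun p => B (frame o u v p)) (fun p q => G (frame o u v p) (frame o u v q)).
Proof.
move=> d [sy il pr nX mx cv [N fi]]; split=> //.
- by move=> p q /sy.
- by move=> p q /il.
- by move=> p q /pr /(prim_frame _ _ _ d).
- by move=> p q r s h1 h2 /(Xing_frame o _ _ _ _ d); apply: nX.
- move=> p q hp hq /(prim_frame o _ _ d) hpq h; apply: mx => // r s.
  have [r' ->] := frame_inv o r d; have [s' ->] := frame_inv o s d.
  by move=> /h hh /(Xing_frame _ _ _ _ _ d).
- move=> a b c p q r s ha hb hc h0 hp hq hr h1 h2.
  apply: (cv a b c _ _ _ _ ha hb hc h0 hp hq hr); rewrite /frame /=.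
    transitivity ((a + b + c) * o.1 + ((a+b+c) * s.1) * u.1 + ((a+b+c) * s.2) * v.1)%Z.
      by ring.
    by rewrite h1 h2; ring.
  transitivity ((a + b + c) * o.2 + ((a+b+c) * s.1) * u.2 + ((a+b+c) * s.2) * v.2)%Z.
    by ring.
  by rewrite h1 h2; ring.
- pose K := (Z.abs u.1 + Z.abs u.2 + Z.abs v.1 + Z.abs v.2)%Z.
  exists ((N + Z.abs o.1 + (N + Z.abs o.2)) * K)%Z => p /fi [].
  rewrite /frame /= => h1 h2.
  set X := (p.1 * u.1 + p.2 * v.1)%Z; set Y := (p.1 * u.2 + p.2 * v.2)%Z.
  have hX : (Z.abs X <= N + Z.abs o.1)%Z by rewrite /X; clear -h1; lia.
  have hY : (Z.abs Y <= N + Z.abs o.2)%Z by rewrite /Y; clear -h2; lia.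
  have e1 : (p.1 = det u v * (X * v.2 - Y * v.1))%Z.
    transitivity (det u v * det u v * p.1)%Z; first by rewrite d; ring.
    by rewrite /X /Y /det; ring.
  have e2 : (p.2 = det u v * (Y * u.1 - X * u.2))%Z.
    transitivity (det u v * det u v * p.2)%Z; first by rewrite d; ring.
    by rewrite /X /Y /det; ring.
  have ad : (Z.abs (det u v) = 1)%Z by clear -d; nia.
  rewrite e1 e2 !Z.abs_mul ad !Z.mul_1_l /K.
  have M0 : (0 <= N + Z.abs o.1 + (N + Z.abs o.2))%Z.
    by have := Z.abs_nonneg X; have := Z.abs_nonneg Y; move: hX hY; clear; lia.
  clearbody X Y; split.
    apply: Z.le_trans; first exact: abs_det_le hX hY.
    by apply: Z.mul_le_mono_nonneg_l => //; clear; lia.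
  rewrite -Z.abs_opp Z.opp_sub_distr Z.add_comm.
  apply: Z.le_trans; first exact: abs_det_le hX hY.
  by apply: Z.mul_le_mono_nonneg_l => //; clear; lia.
Qed.

Lemma Zmax_ex (P : Z -> Prop) : (exists i, P i) ->
  (exists N, forall i, P i -> (i <= N)%Z) ->
  exists i, P i /\ forall j, P j -> (j <= i)%Z.
Proof.
move=> [i0 hi0] [N hN].
suff H n i : P i -> (Z.to_nat (N - i) <= n)%coq_nat ->
    exists i, P i /\ forall j, P j -> (j <= i)%Z by exact: (H _ i0 hi0 (le_n _)).
elim: n i => [|n IH] i hi hn.
  by exists i; split=> // j /hN hj; have := hN _ hi; move: hn hj; clear; lia.
case: (classic (exists j, P j /\ (i < j)%Z)) => [[j [hj ij]]|h].
  by apply: (IH j hj); have := hN _ hj; move: hn ij; clear; lia.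
exists i; split=> // j hj; apply: Znot_gt_le => ij; apply: h.
by exists j; split=> //; apply: Z.gt_lt.
Qed.

Lemma Zmin_ex (P : Z -> Prop) : (exists i, P i) ->
  (exists N, forall i, P i -> (N <= i)%Z) ->
  exists i, P i /\ forall j, P j -> (i <= j)%Z.
Proof.
move=> [i0 hi0] [N hN].
have [||i [hi h]] := @Zmax_ex (fun i => P (- i)%Z).
- by exists (- i0)%Z; rewrite Z.opp_involutive.
- by exists (- N)%Z => i /hN; clear; lia.
exists (- i)%Z; split=> // j hj.
by have := h (- j)%Z; rewrite Z.opp_involutive => /(_ hj); clear; lia.
Qed.

(** * The unimodular triangle on a given side of an edge *)

Section Apex.
Local Open Scope Z_scope.

(** The triangle with base (0,0)-(1,0) and apex (s, h) meets row 1 in the interval from s/h to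
    (s+h-1)/h. It contains an integer, since one of h consecutive integers is divisible by h. *)
Lemma section_point (s h : Z) : 1 <= h ->
  exists i a, h * i = s + a /\ 0 <= a <= h - 1.
Proof.
move=> h1; exists ((s + h - 1) / h); exists (h * ((s + h - 1) / h) - s).
have := Z.div_mod (s + h - 1) h; have := Z.mod_pos_bound (s + h - 1) h.
by nia.
Qed.

(* Two disjoint segments [f] and [g] that meet the base line on opposite sides
   of the unit segment (0,0)-(1,0) cannot change order below the lower of their
   upper ends. *)
Lemma order_lower_top (s1 a1 s2 a2 t1 b1 t2 b2 : Z) :
  a1 <= 0 -> b1 <= 0 -> 1 <= a2 -> a2 <= b2 ->
  side (s1, a1) (s2, a2) (0, 0) <= 0 -> 0 <= side (t1, b1) (t2, b2) (1, 0) ->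
  ~ Xing (s1, a1) (s2, a2) (t1, b1) (t2, b2) ->
  0 <= side (t1, b1) (t2, b2) (s2, a2).
Proof.
move=> ha1 hb1 ha2 hab hf hg nX; apply: Znot_gt_le => /Z.gt_lt hc; apply: nX.
set Cg1 := side (t1, b1) (t2, b2) (s1, a1).
set Cg2 := side (t1, b1) (t2, b2) (s2, a2) in hc *.
set U := side (s1, a1) (s2, a2) (t1, b1).
set V := side (s1, a1) (s2, a2) (t2, b2).
set F := side (s1, a1) (s2, a2) (0, 0) in hf.
set H := side (t1, b1) (t2, b2) (1, 0) in hg.
have e1 : a2 * Cg1 - a1 * Cg2 = (a2 - a1) * (H + (b2 - b1)) - (b2 - b1) * F.
  by rewrite /Cg1 /Cg2 /H /F /side; cbn [fst snd]; ring.
have e2 : (b2 - a2) * U + (a2 - b1) * V = - (a2 - a1) * Cg2.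
  by rewrite /U /V /Cg2 /side; cbn [fst snd]; ring.
have e3 : b2 * U - b1 * V = (b2 - b1) * F - (a2 - a1) * (H + (b2 - b1)).
  by rewrite /U /V /F /H /side; cbn [fst snd]; ring.
rewrite /Xing -/U -/V -/Cg1 -/Cg2.
clearbody Cg1 Cg2 U V F H.
have p1 : 0 < a2 * Cg1 by nia.
have Cg1p : 0 < Cg1 by nia.
have p2 : 0 < (b2 - a2) * U + (a2 - b1) * V by rewrite e2; nia.
have p3 : b2 * U - b1 * V < 0 by rewrite e3; nia.
clear e1 e2 e3 hf hg p1.
have Vp : 0 < V.
  apply: Znot_ge_lt => /Z.ge_le V0.
  have U0 : 0 < U by nia.
  have q1 : b2 * ((a2 - b1) * (- V)) < b2 * ((b2 - a2) * U) by nia.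
  have q2 : (b2 - a2) * (b2 * U) <= (b2 - a2) * (b1 * V) by nia.
  by nia.
have Un : U < 0 by nia.
by split; nia.
Qed.

(** A crossing point would lie strictly between the rows 0 and 1, so only edges that traverse this
    whole strip can block the segment from [q] to [z]. *)
Lemma triang_nspan B G q z r s : triang B G -> G r s ->
  q.2 = 0 -> z.2 = 1 -> 
  (forall f1 f2, G f1 f2 -> f1.2 <= 0 -> 1 <= f2.2 ->
     0 <= side f1 f2 q * side f1 f2 z) -> ~ Xing q z r s.
Proof.
move=> T hrs q2 z2 h hX.
have [a [b [c [d [a0 [b0 [c0 [d0 [e0 [_ e2]]]]]]]]]] := Xing_weights hX.
case: (Z_lt_le_dec 0 r.2) => hr; case: (Z_lt_le_dec 0 s.2) => hs.
- by move: e2; rewrite q2 z2; move: a0 b0 c0 d0 e0 hr hs; clear; nia.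
- have := h _ _ (triang_sym T hrs) hs ltac:(lia).
  rewrite (sideC r s q) (sideC r s z).
  by case: hX => _; move: (side r s q) (side r s z); clear; nia.
- have := h _ _ hrs hr ltac:(lia).
  by case: hX => _; move: (side r s q) (side r s z); clear; nia.
- by move: e2; rewrite q2 z2; move: a0 b0 c0 d0 e0 hr hs; clear; nia.
Qed.

(** An edge traversing the strip between rows 0 and 1 cannot cut the base, so it passes on its left
    or on its right ([dich]). A point of row 1 between the two families is visible from both ends of
    the base, and maximality then supplies both edges. *)
Lemma triang_apex_normal B G P : triang B G -> G (0, 0) (1, 0) -> B P -> 1 <= P.2 ->
  exists i, G (0, 0) (i, 1) /\ G (i, 1) (1, 0).
Proof.
move=> T he hP P1.
pose span f1 f2 := [/\ G f1 f2, f1.2 <= 0 & 1 <= f2.2].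
have hB0 := triang_inl T he; have hB1 := triang_inr T he.
have dich f1 f2 : span f1 f2 -> side f1 f2 (0, 0) <= 0 \/ 0 <= side f1 f2 (1, 0).
  case: f1 f2 => [s1 a1] [s2 a2] [hf /= ha1 ha2].
  apply: NNPP => /not_or_and [/Znot_le_gt/Z.gt_lt h1 /Znot_le_gt/Z.gt_lt h2].
  apply: (triang_nX T he hf); move: h1 h2; rewrite /Xing /side; cbn [fst snd]; clear -ha1 ha2.
  move=> h1 h2; split; last nia.
  have : a1 < 0.
    apply: Znot_ge_lt => /Z.ge_le a0; have a10 : a1 = 0 by lia.
    subst a1; have k1 : 0 < a2 * s1 by lia.
    have k2 : a2 * (s1 - 1) < 0 by lia.
    by have k3 : 0 < s1; nia.
  by nia.
have diff f1 f2 i j : side f1 f2 (i, 1) - side f1 f2 (j, 1) = (f2.2 - f1.2) * (j - i).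
  by rewrite /side; cbn [fst snd]; ring.
have diff0 f1 f2 : side f1 f2 (1, 0) = side f1 f2 (0, 0) - (f2.2 - f1.2).
  by rewrite /side; cbn [fst snd]; ring.
pose Lft i := forall f1 f2, span f1 f2 -> side f1 f2 (0, 0) <= 0 -> side f1 f2 (i, 1) <= 0.
pose Rgt i := forall f1 f2, span f1 f2 -> 0 <= side f1 f2 (1, 0) -> 0 <= side f1 f2 (i, 1).
suff [i [hBi [hL hR]]] : exists i, B (i, 1) /\ Lft i /\ Rgt i.
  exists i; split.
    apply: (triang_max T) => //; first by exists 0, 1; rewrite /=; ring.
    move=> r s hrs; apply: (triang_nspan T hrs) => // f1 f2 hf h1 h2.
    case: (dich f1 f2) => // hd.
      by have := hL f1 f2 (And3 hf h1 h2) hd; move: hd; clear; nia.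
    have := hR f1 f2 (And3 hf h1 h2) hd; move: hd; rewrite diff0.
    by move: h1 h2; clear; nia.
  apply: (triang_sym T); apply: (triang_max T) => //.
    by exists 0, 1; rewrite /=; ring.
  move=> r s hrs; apply: (triang_nspan T hrs) => // f1 f2 hf h1 h2.
  case: (dich f1 f2) => // hd.
    have := hL f1 f2 (And3 hf h1 h2) hd; move: hd; rewrite diff0.
    by move: h1 h2; clear; nia.
  by have := hR f1 f2 (And3 hf h1 h2) hd; move: hd; clear; nia.
(* [(i, 1)] is chosen in the triangle with base (0,0)-(1,0) and apex [Q]. *)
have sec Q : B Q -> 1 <= Q.2 -> exists i, B (i, 1) /\ forall f1 f2,
    (side f1 f2 (0, 0) <= 0 -> side f1 f2 (1, 0) <= 0 -> side f1 f2 Q <= 0 ->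
     side f1 f2 (i, 1) <= 0) /\
    (0 <= side f1 f2 (0, 0) -> 0 <= side f1 f2 (1, 0) -> 0 <= side f1 f2 Q ->
     0 <= side f1 f2 (i, 1)).
  move=> hQ Q1; have [i [a [hi ha]]] := section_point Q.1 Q1.
  exists i; split.
    apply: (triang_convex T (a := 1) (b := a) (c := Q.2 - 1 - a) (p := Q) (q := (1, 0))
       (r := (0, 0))) => //; cbn [fst snd]; try (move: ha Q1; clear; lia).
    by transitivity (Q.2 * i); [ring | rewrite hi; ring].
  move=> f1 f2.
  have e : Q.2 * side f1 f2 (i, 1) = side f1 f2 Q + a * side f1 f2 (1, 0)
             + (Q.2 - 1 - a) * side f1 f2 (0, 0).
    transitivity ((f2.1 - f1.1) * (Q.2 - Q.2 * f1.2) - (f2.2 - f1.2) * (Q.2 * i - Q.2 * f1.1)).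
      by rewrite /side; cbn [fst snd]; ring.
    by rewrite hi /side; cbn [fst snd]; ring.
  by split=> h1 h2 h3; move: e ha Q1 h1 h2 h3; clear; nia.
have [i0 [hi0 max0]] : exists i, B (i, 1) /\ forall j, B (j, 1) -> j <= i.
  apply: (@Zmax_ex (fun i => B (i, 1))).
    by have [i [hi _]] := sec P hP P1; exists i.
  have [N hN] := triang_fin T; exists N => i /hN /= [hi _]; move: hi; clear; lia.
have topL f1 f2 : span f1 f2 -> side f1 f2 (0, 0) <= 0 ->
    exists i, B (i, 1) /\ side f1 f2 (i, 1) <= 0.
  move=> [hf h1 h2] h3; have [i [hi /(_ f1 f2) [hs _]]] := sec f2 (triang_inr T hf) h2.
  exists i; split=> //; apply: hs => //; first by rewrite diff0; move: h1 h2 h3; clear; lia.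
  by rewrite /side; clear; nia.
have topR f1 f2 : span f1 f2 -> 0 <= side f1 f2 (1, 0) ->
    exists i, B (i, 1) /\ 0 <= side f1 f2 (i, 1).
  move=> [hf h1 h2] h3; have [i [hi /(_ f1 f2) [_ hs]]] := sec f2 (triang_inr T hf) h2.
  exists i; split=> //; apply: hs => //; first by move: h3; rewrite diff0; move: h1 h2; clear; lia.
  by rewrite /side; clear; nia.
have L0 : Lft i0.
  move=> f1 f2 hf hl; have [i [hi his]] := topL _ _ hf hl.
  have := max0 _ hi; have := diff f1 f2 i i0; case: hf => _ h1 h2.
  by move: his h1 h2; clear; nia.
(* [j] is the leftmost point of row 1 that no left edge cuts off. If a right edge [g] cut it off,
   minimality would give a left edge [f] cutting off [j - 1], and no lattice point of row 1 could
   lie between [f] and [g]. But the lower of their upper ends lies between them, and so does a point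
   of row 1 below it. *)
have [j [[hBj hLj] minj]] : exists i, (B (i, 1) /\ Lft i) /\
    forall j, B (j, 1) /\ Lft j -> i <= j.
  apply: (@Zmin_ex (fun i => B (i, 1) /\ Lft i)); first by exists i0.
  have [N hN] := triang_fin T; exists (- N) => i [/hN /= [hi _] _]; move: hi; clear; lia.
exists j; do 2!split=> //; move=> g1 g2 hg hr; apply: Znot_gt_le => /Z.gt_lt hneg.
have [ig [hig higs]] := topR _ _ hg hr.
have igj : ig < j.
  have := diff g1 g2 ig j; case: hg => _ h1 h2; move: h1 h2 hneg higs; clear; nia.
have hBj1 : B (j - 1, 1).
  apply: (triang_convex T (a := j - 1 - ig) (b := 1) (c := 0) (p := (j, 1)) (q := (ig, 1))
    (r := (j, 1))) => //; cbn [fst snd]; try (move: igj; clear; lia); ring.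
have [f1 [f2 [hf [hl hpos]]]] : exists f1 f2, span f1 f2 /\ side f1 f2 (0, 0) <= 0 /\
    0 < side f1 f2 (j - 1, 1).
  apply: NNPP => hn; have := minj (j - 1); suff hL : Lft (j - 1).
    by move/(_ (conj hBj1 hL)); clear; lia.
  move=> f1 f2 hf hl; apply: Znot_gt_le => /Z.gt_lt hp; apply: hn.
  by exists f1, f2.
have nX : ~ Xing f1 f2 g1 g2 by apply: (triang_nX T); [case: hf | case: hg].
have [i [hBi [hi1 hi2]]] : exists i, B (i, 1) /\ side f1 f2 (i, 1) <= 0 /\
    0 <= side g1 g2 (i, 1).
  case: (hf) => Gf f1n f2p; case: (hg) => Gg g1n g2p.
  case: (Z_le_gt_dec f2.2 g2.2) => hfg.
    have ho : 0 <= side g1 g2 f2.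
      move: f1n f2p g1n hfg hl hr nX; clear; case: f1 f2 g1 g2 => [s1 a1] [s2 a2] [t1 b1] [t2 b2] /=.
      by move=> k1 k2 k3 k4 k5 k6 k7; apply: (order_lower_top k1 k3 k2 k4 k5 k6 k7).
    have [i [hi hs]] := sec f2 (triang_inr T Gf) f2p.
    exists i; split=> //; split.
      apply: (proj1 (hs f1 f2)) => //; first by rewrite diff0; move: hl f1n f2p; clear; lia.
      by rewrite /side; clear; nia.
    apply: (proj2 (hs g1 g2)) => //.
    by move: hr; rewrite diff0; move: g1n g2p; clear; lia.
  have ho : side f1 f2 g2 <= 0.
    (* The reflection x -> 1 - x exchanges the ends of the base and the roles of [f] and [g]. *)
    have flip : 0 <= side (- f1.1 + 1, f1.2) (- f2.1 + 1, f2.2) (- g2.1 + 1, g2.2).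
      move: f1n g1n g2p hfg hl hr nX; clear.
      case: f1 f2 g1 g2 => [s1 a1] [s2 a2] [t1 b1] [t2 b2] /= h1 h2 h3 h4 h5 h6 nX.
      apply: (@order_lower_top (- t1 + 1) b1 (- t2 + 1) b2) => //; try lia.
      - by move: h6; rewrite /side; cbn [fst snd]; lia.
      - by move: h5; rewrite /side; cbn [fst snd]; lia.
      - move=> hX; apply: nX; apply: Xing_symlr; move: hX.
        rewrite /Xing /side; cbn [fst snd]; case=> x1 x2; split; [move: x1 | move: x2].
          by match goal with |- (?a < 0 -> ?b < 0) => replace b with a by ring end.
        by match goal with |- (?a < 0 -> ?b < 0) => replace b with a by ring end.
    by move: flip; rewrite /side; cbn [fst snd]; lia.
  have [i [hi hs]] := sec g2 (triang_inr T Gg) g2p.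
  exists i; split=> //; split.
    apply: (proj1 (hs f1 f2)) => //; rewrite diff0; move: hl f1n f2p; clear; lia.
  apply: (proj2 (hs g1 g2)) => //; first by move: hr; rewrite diff0; move: g1n g2p; clear; lia.
  by rewrite /side; clear; nia.
have := diff f1 f2 i (j - 1); have := diff g1 g2 i j.
case: hf => _ f1n f2p; case: hg => _ g1n g2p.
have : 0 < (f2.2 - f1.2) * (j - (j - 1)) by move: f1n f2p; clear; lia.
move: hi1 hi2 hneg hpos f1n f2p g1n g2p; clear.
move: (side f1 f2 (i, 1)) (side g1 g2 (i, 1)) (side g1 g2 (j, 1)) (side f1 f2 (j - 1, 1)).
move=> A B' C D *.
have : j <= i by nia.
have : i < j by nia.
lia.
Qed.
End Apex.

(** * Apexes in general position and diagonals of unimodular parallelograms *)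

Section Square.
Local Open Scope Z_scope.

Lemma triang_apex B G p r P : triang B G -> G p r -> B P -> 0 < side p r P ->
  exists z, side p r z = 1 /\ G p z /\ G z r.
Proof.
move=> T hpr hP hs; have [x [y hxy]] := triang_prim T hpr.
(* The Bezout coefficients complete [u] to a basis of determinant 1; in this frame the edge becomes
   (0,0)-(1,0) and [side p r] is the second coordinate. *)
pose u := (r.1 - p.1, r.2 - p.2); pose v := (- y, x).
have d1 : det u v = 1 by rewrite -hxy /det /u /v; cbn [fst snd]; ring.
have dd : det u v * det u v = 1 by rewrite d1.
have ep : p = frame p u v (0, 0).
  by rewrite [LHS]surjective_pairing /frame; cbn [fst snd]; congr pair; ring.
have er : r = frame p u v (1, 0).
  by rewrite [LHS]surjective_pairing /frame /u; cbn [fst snd]; congr pair; ring.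
have [P' eP] := frame_inv p P dd.
have sid Q : side p r (frame p u v Q) = Q.2.
  by rewrite {1}ep {1}er side_frame d1 /side; cbn [fst snd]; ring.
have [|||i [h1 h2]] := triang_apex_normal (P := P') (triang_frame p dd T).
- by rewrite -ep -er.
- by rewrite -eP.
- by move: hs; rewrite eP sid; clear; lia.
exists (frame p u v (i, 1)); rewrite sid; split=> //.
by rewrite -ep in h1; rewrite -er in h2.
Qed.

(** If the origin were off the line of [r] and [s], that line would separate it from (1,0) or from
    (0,1). The bounds on the coordinate sums make the segment long enough to cross that side of the
    square itself. *)
Lemma square_normal_half r s : r.1 + r.2 <= 0 -> 2 <= s.1 + s.2 ->
  side r s (1, 0) < 0 -> 0 < side r s (0, 1) ->
  ~ Xing r s (0, 0) (1, 0) -> ~ Xing r s (0, 0) (0, 1) -> side r s (0, 0) = 0.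
Proof.
case: r s => [s1 t1] [s2 t2] /= h1 h2 h3 h4 n1 n2.
case: (Ztrichotomy (side (s1, t1) (s2, t2) (0, 0)) 0) => [h|[//|/Z.gt_lt h]]; exfalso.
  apply: n2; move: h h3 h4; rewrite /Xing /side; cbn [fst snd] => h h3 h4.
  have a1 : s1 < 0 by apply: Znot_ge_lt => /Z.ge_le ?; nia.
  have a2 : 0 < s2 by apply: Znot_ge_lt => /Z.ge_le ?; nia.
  by split; nia.
apply: n1; move: h h3 h4; rewrite /Xing /side; cbn [fst snd] => h h3 h4.
have a1 : t1 < 0 by apply: Znot_ge_lt => /Z.ge_le ?; nia.
have a2 : 0 < t2 by apply: Znot_ge_lt => /Z.ge_le ?; nia.
by split; nia.
Qed.

Lemma square_normal_dir r s : prim r s -> r.1 + r.2 <= 0 -> 2 <= s.1 + s.2 ->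
  Xing (1, 0) (0, 1) r s ->
  ~ Xing r s (0, 0) (1, 0) -> ~ Xing r s (0, 0) (0, 1) ->
  ~ Xing r s (1, 1) (1, 0) -> ~ Xing r s (1, 1) (0, 1) -> r = (0, 0) /\ s = (1, 1).
Proof.
move=> hp h1 h2 [_ hX] n1 n2 n3 n4.
have e : side r s (0, 1) - side r s (1, 0) = (s.1 + s.2) - (r.1 + r.2).
  by rewrite /side; cbn [fst snd]; ring.
have c1 : side r s (1, 0) < 0 by move: hX e h1 h2; clear; nia.
have c2 : 0 < side r s (0, 1) by move: hX e h1 h2; clear; nia.
have c0 := square_normal_half h1 h2 c1 c2 n1 n2.
(* The half turn of the unit square, with [r] and [s] exchanged, carries the statement about (0,0)
   to (1,1). *)
have c3 : side r s (1, 1) = 0.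
  have := @square_normal_half (1 - s.1, 1 - s.2) (1 - r.1, 1 - r.2).
  have E a b : side (1 - s.1, 1 - s.2) (1 - r.1, 1 - r.2) (a, b) =
      - side r s (1 - a, 1 - b) by rewrite /side; cbn [fst snd]; ring.
  rewrite !E => H; suff : - side r s (1, 1) = 0 by clear; lia.
  apply: H; cbn [fst snd]; try (move: h1 h2; clear; lia).
  - by change (- side r s (0, 1) < 0); move: c2; clear; lia.
  - by change (0 < - side r s (1, 0)); move: c1; clear; lia.
  - move=> hX'; apply: n4; move: hX'; rewrite /Xing !E.
    by move=> [x1 x2]; split; [move: x1 | move: x2]; rewrite /side; cbn [fst snd]; clear; lia.
  - move=> hX'; apply: n3; move: hX'; rewrite /Xing !E.
    by move=> [x1 x2]; split; [move: x1 | move: x2]; rewrite /side; cbn [fst snd]; clear; lia.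
move: hp c0 c3 h1 h2; case: r s {hX n1 n2 n3 n4 e c1 c2} => [s1 t1] [s2 t2].
rewrite /side; cbn [fst snd] => -[x [y hxy]] c0 c3 h1 h2; cbn [fst snd] in hxy.
have d : s2 - s1 = t2 - t1 by move: c0 c3; clear; lia.
have d0 : 1 <= s2 - s1 by move: d h1 h2; clear; lia.
have d1 : s2 - s1 = 1.
  have : (x + y) * (s2 - s1) = 1 by rewrite -hxy -d; ring.
  move: d0; clear; move: (s2 - s1) (x + y) => a b a1 hb.
  have b1 : 0 < b by nia.
  by nia.
rewrite -d d1 in c0.
by split; congr pair; move: c0 d d1 h1 h2; clear; lia.
Qed.

Lemma square_normal r s : prim r s -> Xing (1, 0) (0, 1) r s ->
  ~ Xing r s (0, 0) (1, 0) -> ~ Xing r s (0, 0) (0, 1) ->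
  ~ Xing r s (1, 1) (1, 0) -> ~ Xing r s (1, 1) (0, 1) ->
  r = (0, 0) /\ s = (1, 1) \/ r = (1, 1) /\ s = (0, 0).
Proof.
move=> hp hX n1 n2 n3 n4.
have E Q : side (1, 0) (0, 1) Q = 1 - (Q.1 + Q.2) by rewrite /side; cbn [fst snd]; ring.
case: (hX); rewrite !E => /Z.lt_mul_0 [] h _.
  have [||||||| -> ->] := @square_normal_dir s r _ _ _ (Xing_swapr hX).
  - exact: prim_sym.
  - by move: h; clear; lia.
  - by move: h; clear; lia.
  - by move/Xing_swapl.
  - by move/Xing_swapl.
  - by move/Xing_swapl.
  - by move/Xing_swapl.
  by right.
have [||-> ->] := square_normal_dir hp _ _ hX n1 n2 n3 n4; try (move: h; clear; lia).
by left.
Qed.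

(** A segment that crosses one diagonal and no side must pass through the two remaining corners, and
    a primitive segment through both of them ends there. This is what makes a flip reversible. *)
Lemma square_diagonal p z z' q r s : p.1 + q.1 = z.1 + z'.1 -> p.2 + q.2 = z.2 + z'.2 ->
  side p z z' * side p z z' = 1 -> prim r s -> Xing z z' r s ->
  ~ Xing r s p z -> ~ Xing r s p z' -> ~ Xing r s q z -> ~ Xing r s q z' ->
  r = p /\ s = q \/ r = q /\ s = p.
Proof.
move=> e1 e2; set u := (z.1 - p.1, z.2 - p.2); set v := (z'.1 - p.1, z'.2 - p.2).
have ed : side p z z' = det u v by rewrite /side /det /u /v; cbn [fst snd]; ring.
rewrite ed => dd.
have ep : p = frame p u v (0, 0).
  by rewrite [LHS]surjective_pairing /frame; cbn [fst snd]; congr pair; ring.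
have ez : z = frame p u v (1, 0).
  by rewrite [LHS]surjective_pairing /frame /u; cbn [fst snd]; congr pair; ring.
have ez' : z' = frame p u v (0, 1).
  by rewrite [LHS]surjective_pairing /frame /u /v; cbn [fst snd]; congr pair; ring.
have eq : q = frame p u v (1, 1).
  rewrite [LHS]surjective_pairing /frame /u /v; cbn [fst snd]; congr pair.
    by move: e1; clear; lia.
  by move: e2; clear; lia.
have [r' er] := frame_inv p r dd; have [s' es] := frame_inv p s dd.
have tr A B C D A' B' C' D' : A = frame p u v A' -> B = frame p u v B' ->
    C = frame p u v C' -> D = frame p u v D' -> Xing A B C D <-> Xing A' B' C' D'.
  by move=> -> -> -> ->; apply: Xing_frame.
rewrite (tr _ _ _ _ _ _ _ _ ez ez' er es) (tr _ _ _ _ _ _ _ _ er es ep ez).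
rewrite (tr _ _ _ _ _ _ _ _ er es ep ez') (tr _ _ _ _ _ _ _ _ er es eq ez).
rewrite (tr _ _ _ _ _ _ _ _ er es eq ez') => hp hX n1 n2 n3 n4.
have hp' : prim r' s' by apply/(prim_frame p _ _ dd); rewrite -er -es.
have [[h1 h2]|[h1 h2]] := square_normal hp' hX n1 n2 n3 n4.
  by left; rewrite er es h1 h2 -ep -eq.
by right; rewrite er es h1 h2 -ep -eq.
Qed.

End Square.

(** * Longest spanning edges and Farey parents *)

Section Parallelogram.
Local Open Scope Z_scope.

Definition l1 (p q : Z * Z) : Z := Z.abs (q.1 - p.1) + Z.abs (q.2 - p.2).

Definition spans (a : Z) (p q : Z * Z) : Prop := p.1 < a < q.1 \/ q.1 < a < p.1.

Lemma mul1_sum a b c d : 0 <= a -> 0 <= b -> 0 <= c -> 0 <= d -> a * d + b * c = 1 ->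
  (a = 1 /\ d = 1 /\ (b = 0 \/ c = 0)) \/ (b = 1 /\ c = 1 /\ (a = 0 \/ d = 0)).
Proof.
move=> a0 b0 c0 d0 h.
have [h1|h1] : a * d = 1 \/ b * c = 1 by nia.
  have [-> ->] := Z.eq_mul_1_nonneg a d a0 h1.
  by left; do !split; apply/Z.eq_mul_0; lia.
have [-> ->] := Z.eq_mul_1_nonneg b c b0 h1.
by right; do !split; apply/Z.eq_mul_0; lia.
Qed.

(** If neither vector dominates the other, a positive determinant forces a >= c + 1 and d >= b + 1.
    Then the determinant is at least b + c + 1, which leaves only the standard basis. *)
Lemma det1_comparable a b c d : 0 <= a -> 0 <= b -> 0 <= c -> 0 <= d ->
  a * d - b * c = 1 -> (c <= a /\ d <= b) \/ (a <= c /\ b <= d) \/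
  (a = 1 /\ d = 1 /\ b = 0 /\ c = 0).
Proof.
move=> a0 b0 c0 d0 h.
have [h1|h1] : c <= a \/ a < c by lia.
  have [h2|h2] : d <= b \/ b < d by lia.
    by left.
  have [h3|h3] : a <= c \/ c < a by lia.
    by right; left; lia.
  right; right.
  have k := Z.mul_le_mono_nonneg (c + 1) a (b + 1) d ltac:(lia) ltac:(lia) ltac:(lia) ltac:(lia).
  have b00 : b = 0 by lia.
  have c00 : c = 0 by lia.
  by have [|-> ->] := Z.eq_mul_1_nonneg a d a0; lia.
have [h2|h2] : b <= d \/ d < b by lia.
  by right; left; lia.
have k := Z.mul_le_mono_nonneg (a + 1) c (d + 1) b ltac:(lia) ltac:(lia) ltac:(lia) ltac:(lia).
by exfalso; lia.
Qed.

Lemma sign_decomp x : exists a, 0 <= a /\ (x = a \/ x = - a).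
Proof. by exists (Z.abs x); lia. Qed.

(** Up to signs, one side of a unimodular triangle is the sum of the two others taken in a common
    quadrant; the three cases tell which. For [u] and [v] in opposite quadrants ([opp]) the shorter
    vector can be added to the longer one without leaving its quadrant. If the signs disagree in one
    coordinate only ([mixed]), the determinant is up to sign a sum of two nonnegative products, one
    of which vanishes. *)
Lemma unimodular_quadrant u1 u2 v1 v2 : u1 * v2 - u2 * v1 = 1 \/ u1 * v2 - u2 * v1 = -1 ->
  (0 <= u1 * v1 /\ 0 <= u2 * v2) \/
  (u1 * (u1 + v1) <= 0 /\ u2 * (u2 + v2) <= 0) \/
  (v1 * (u1 + v1) <= 0 /\ v2 * (u2 + v2) <= 0).
Proof.
have [a [a0 ea]] := sign_decomp u1; have [b [b0 eb]] := sign_decomp u2.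
have [c [c0 ec]] := sign_decomp v1; have [d [d0 ed]] := sign_decomp v2.
move=> hd.
have ac := Z.mul_nonneg_nonneg _ _ a0 c0; have bd := Z.mul_nonneg_nonneg _ _ b0 d0.
have ad := Z.mul_nonneg_nonneg _ _ a0 d0; have bc := Z.mul_nonneg_nonneg _ _ b0 c0.
have mixed (P : Prop) : a * d + b * c = 1 ->
    ((a = 1 /\ d = 1 /\ (b = 0 \/ c = 0)) -> P) ->
    ((b = 1 /\ c = 1 /\ (a = 0 \/ d = 0)) -> P) -> P.
  by move=> h; case: (mul1_sum a0 b0 c0 d0 h) => h' k1 k2; [apply: k1 | apply: k2].
have opp (P : Prop) : a * d - b * c = 1 \/ b * c - a * d = 1 ->
    (c <= a -> d <= b -> 0 <= (a - c) * c -> 0 <= (b - d) * d -> P) ->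
    (a <= c -> b <= d -> 0 <= (c - a) * a -> 0 <= (d - b) * b -> P) ->
    (a = 1 -> d = 1 -> b = 0 -> c = 0 -> P) ->
    (b = 1 -> c = 1 -> a = 0 -> d = 0 -> P) -> P.
  move=> h k1 k2 k3 k4.
  have p1 x y : 0 <= y -> y <= x -> 0 <= (x - y) * y by nia.
  case: h => h.
    case: (det1_comparable a0 b0 c0 d0 h) => [[*]|[[*]|[? [? [? ?]]]]].
    - by apply: k1 => //; apply: p1.
    - by apply: k2 => //; apply: p1.
    - exact: k3.
  have := det1_comparable b0 a0 d0 c0 ltac:(lia).
  case=> [[*]|[[*]|[? [? [? ?]]]]].
  - by apply: k1 => //; apply: p1.
  - by apply: k2 => //; apply: p1.
  - exact: k4.
case: ea => ?; case: eb => ?; case: ec => ?; case: ed => ?; subst u1 u2 v1 v2;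
  first [by left; lia
       | by apply: mixed; [lia | case=> -> [-> [] ->]; lia | case=> -> [-> [] ->]; lia]
       | by apply: opp; first lia; move=> *; subst; lia].
Qed.
End Parallelogram.

Section LongestEdge.
Local Open Scope Z_scope.

Variables (B : Z * Z -> Prop) (G : Z * Z -> Z * Z -> Prop) (a : Z).
Hypothesis T : triang B G.

(* If another side of the triangle were its longest side, that side would span
   the column too. *)
Lemma longest_apex_quadrant p q z : G p z -> G z q -> spans a p q ->
  (forall r s, G r s -> spans a r s -> l1 r s <= l1 p q) ->
  side p q z = 1 \/ side p q z = -1 ->
  0 <= (z.1 - p.1) * (q.1 - z.1) /\ 0 <= (z.2 - p.2) * (q.2 - z.2).
Proof.
move=> hpz hzq hs hmax hd.
have := @unimodular_quadrant (z.1 - p.1) (z.2 - p.2) (q.1 - z.1) (q.2 - z.2).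
have e1 : z.1 - p.1 + (q.1 - z.1) = q.1 - p.1 by ring.
have e2 : z.2 - p.2 + (q.2 - z.2) = q.2 - p.2 by ring.
rewrite e1 e2; case=> //.
  by move: hd; rewrite /side; clear; lia.
have signs x y : x * (x + y) <= 0 -> Z.abs y = Z.abs (x + y) + Z.abs x by nia.
case=> [[h1 h2]|[h1 h2]]; exfalso.
  have hzs : spans a z q by move: hs h1; rewrite /spans; clear; nia.
  have := hmax _ _ hzq hzs; rewrite /l1.
  have := signs (z.1 - p.1) (q.1 - z.1); have := signs (z.2 - p.2) (q.2 - z.2).
  rewrite e1 e2 => /(_ h2) -> /(_ h1) -> h.
  have z1 : z.1 - p.1 = 0 by move: h; clear; lia.
  have z2 : z.2 - p.2 = 0 by move: h; clear; lia.
  by move: hd; rewrite /side z1 z2; clear; lia.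
have hzs : spans a p z by move: hs h1; rewrite /spans; clear; nia.
have := hmax _ _ hpz hzs; rewrite /l1.
have := signs (q.1 - z.1) (z.1 - p.1); have := signs (q.2 - z.2) (z.2 - p.2).
rewrite (Z.add_comm (q.1 - z.1)) (Z.add_comm (q.2 - z.2)).
rewrite e1 e2 => /(_ h2) -> /(_ h1) -> h.
have z1 : z.1 = q.1 by move: h; clear; lia.
have z2 : z.2 = q.2 by move: h; clear; lia.
by move: hd; rewrite /side z1 z2; clear; lia.
Qed.

(* The decomposition of a primitive vector into a unimodular pair of vectors of
   its own quadrant (its Farey parents) is unique. *)
Lemma parents_uniq d1 d2 u1 u2 v1 v2 x y : x * d1 + y * d2 = 1 ->
  d1 * u2 - d2 * u1 = 1 -> d1 * v2 - d2 * v1 = 1 ->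
  0 <= u1 * (d1 - u1) -> 0 <= u2 * (d2 - u2) ->
  0 <= v1 * (d1 - v1) -> 0 <= v2 * (d2 - v2) -> u1 = v1 /\ u2 = v2.
Proof.
move=> hxy hu hv ux uy vx vy.
(* Two solutions of the same determinant equation differ by a multiple [m] of the primitive vector.
   The box conditions force [m = 0], as otherwise one solution would be the zero vector. *)
pose m := x * (u1 - v1) + y * (u2 - v2).
have m1 : u1 - v1 = m * d1.
  have e : d1 * (u2 - v2) = d2 * (u1 - v1) by lia.
  transitivity ((x * d1 + y * d2) * (u1 - v1)); first by rewrite hxy; ring.
  transitivity (x * d1 * (u1 - v1) + y * (d2 * (u1 - v1))); first by ring.
  by rewrite -e /m; ring.
have m2 : u2 - v2 = m * d2.
  have e : d1 * (u2 - v2) = d2 * (u1 - v1) by lia.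
  transitivity ((x * d1 + y * d2) * (u2 - v2)); first by rewrite hxy; ring.
  transitivity (x * (d1 * (u2 - v2)) + y * d2 * (u2 - v2)); first by ring.
  by rewrite e /m; ring.
clearbody m; clear hxy.
have box c w : 0 <= w * (c - w) -> 0 <= c * w /\ Z.abs w <= Z.abs c by nia.
have [bu1 bu2] := box _ _ ux; have [bu3 bu4] := box _ _ uy.
have [bv1 bv2] := box _ _ vx; have [bv3 bv4] := box _ _ vy.
have nz : d1 <> 0 \/ d2 <> 0 by lia.
have [m0|[mp|mn]] : m = 0 \/ 0 < m \/ m < 0 by lia.
- by subst m; move: m1 m2; clear; lia.
- have w1 : v1 = 0 by move: m1 bu2 bv1 bu1 mp; clear; nia.
  have w2 : v2 = 0 by move: m2 bu4 bv3 bu3 mp; clear; nia.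
  by move: hv; rewrite w1 w2; lia.
have w1 : u1 = 0 by move: m1 bv2 bv1 bu1 mn; clear; nia.
have w2 : u2 = 0 by move: m2 bv4 bv3 bu3 mn; clear; nia.
by move: hu; rewrite w1 w2; lia.
Qed.

(** The apexes on both sides split [q - p] into Farey parents, so by uniqueness [z - p] equals
    [q - z'] and the two triangles form a parallelogram. The last clause names the longer side
    [p z], as [flip_gain] expects. *)
Lemma longest_parallelogram p q P P' : G p q -> spans a p q ->
  (forall r s, G r s -> spans a r s -> l1 r s <= l1 p q) ->
  B P -> 0 < side p q P -> B P' -> side p q P' < 0 ->
  exists z z', (G p z /\ G z q /\ G p z' /\ G z' q) /\
    (p.1 + q.1 = z.1 + z'.1 /\ p.2 + q.2 = z.2 + z'.2) /\
    side p z z' * side p z z' = 1 /\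
    (0 <= (z.1 - p.1) * (z'.1 - p.1) /\ 0 <= (z.2 - p.2) * (z'.2 - p.2)) /\
    l1 p z' <= l1 p z.
Proof.
move=> hpq hs hmax hP sP hP' sP'.
have [z [sz [hpz hzq]]] := triang_apex T hpq hP sP.
have [|z' [sz' [hqz' hzp']]] := triang_apex T (triang_sym T hpq) hP'.
  by rewrite sideC; move: sP'; clear; lia.
have hpz' := triang_sym T hzp'; have hz'q := triang_sym T hqz'.
rewrite sideC in sz'.
have [q1 q2] := longest_apex_quadrant hpz hzq hs hmax (or_introl sz).
have [|q3 q4] := longest_apex_quadrant hpz' hz'q hs hmax; first by right; lia.
have [x [y hxy]] := triang_prim T hpq.
have [||||||e1 e2] := @parents_uniq (q.1 - p.1) (q.2 - p.2) (z.1 - p.1) (z.2 - p.2)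
  (q.1 - z'.1) (q.2 - z'.2) x y hxy.
- by move: sz; rewrite /side; clear; lia.
- by move: sz'; rewrite /side; clear; lia.
- by move: q1; have -> : q.1 - p.1 - (z.1 - p.1) = q.1 - z.1 by ring.
- by move: q2; have -> : q.2 - p.2 - (z.2 - p.2) = q.2 - z.2 by ring.
- by move: q3; rewrite Z.mul_comm; have -> : q.1 - p.1 - (q.1 - z'.1) = z'.1 - p.1 by ring.
- by move: q4; rewrite Z.mul_comm; have -> : q.2 - p.2 - (q.2 - z'.2) = z'.2 - p.2 by ring.
have f1 : q.1 = z.1 + z'.1 - p.1 by lia.
have f2 : q.2 = z.2 + z'.2 - p.2 by lia.
have det1 : side p z z' = -1.
  by move: sz; rewrite /side f1 f2; clear; lia.
rewrite f1 in q1; rewrite f2 in q2.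
have g1 : 0 <= (z.1 - p.1) * (z'.1 - p.1) by move: q1; clear; lia.
have g2 : 0 <= (z.2 - p.2) * (z'.2 - p.2) by move: q2; clear; lia.
case: (Z_le_gt_dec (l1 p z') (l1 p z)) => hl.
  exists z, z'; split=> //; split; first by rewrite f1 f2; clear; lia.
  by rewrite det1; split.
exists z', z; split=> //; split; first by rewrite f1 f2; clear; lia.
have -> : side p z' z = - side p z z' by rewrite /side; ring.
rewrite det1; split=> //; split; last by move: hl; clear; lia.
by rewrite Z.mul_comm (Z.mul_comm (z'.2 - p.2)).
Qed.

End LongestEdge.

(** * Triangulations and flips *)

(** The raw indices serve as coordinates: the centring by [n./2] in [X] is a translation, accounted
    for in [on_openE]. *)
Definition zp {n k : nat} (p : pt n k) : Z * Z := (Z.of_nat p.1, Z.of_nat p.2).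

Lemma zp_inj n k : injective (@zp n k).
Proof.
by case=> [i j] [i' j'] [] /Nat2Z.inj /ord_inj -> /Nat2Z.inj /ord_inj ->.
Qed.

Definition inbox (n k : nat) (P : Z * Z) : Prop :=
  (0 <= P.1 <= Z.of_nat (n./2).*2)%Z /\ (0 <= P.2 <= Z.of_nat k)%Z.

Lemma zp_inbox n k (p : pt n k) : inbox n k (zp p).
Proof.
case: p => [i j]; rewrite /inbox /=.
by have := ltn_ord i; have := ltn_ord j; lia.
Qed.

Lemma inbox_zp n k P : inbox n k P -> exists p : pt n k, zp p = P.
Proof.
case: P => [x y] [/= hx hy].
have hx' : Z.to_nat x < (n./2).*2.+1 by lia.
have hy' : Z.to_nat y < k.+1 by lia.
by exists (Ordinal hx', Ordinal hy'); rewrite /zp /= !Z2Nat.id //; lia.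
Qed.

(** * Real segments and integer orientation tests *)

Section Bridge.
Variables (n k : nat).
Implicit Types (p q : pt n k) (e f : edge n k).

Local Notation zx p := (IZR (zp p).1).
Local Notation zy p := (IZR (zp p).2).

Lemma XE p : X p = (zx p - INR n./2)%R.
Proof. by rewrite /X /= INR_IZR_INZ. Qed.

Lemma YE p : Y p = zy p.
Proof. by rewrite /Y /= INR_IZR_INZ. Qed.

Lemma on_openE e (P : R * R) : on_open e P <-> exists t : R, (0 < t < 1)%R /\
  (P.1 + INR n./2 = zx e.1 + t * (zx e.2 - zx e.1))%R /\
  (P.2 = zy e.1 + t * (zy e.2 - zy e.1))%R.
Proof.
rewrite /on_open; split=> -[t [ht [h1 h2]]]; exists t; split=> //; split.
- by rewrite h1 !XE; ring.
- by rewrite h2 !YE.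
- transitivity (zx e.1 + t * (zx e.2 - zx e.1) - INR n./2)%R; first by rewrite -h1; ring.
  by rewrite !XE; ring.
- by rewrite h2 !YE.
Qed.

Lemma Xing_common e f : Xing (zp e.1) (zp e.2) (zp f.1) (zp f.2) ->
  exists P, on_open e P /\ on_open f P.
Proof.
case/Xing_weights=> [a [b [c [d [/IZR_lt a0 [/IZR_lt b0 [/IZR_lt c0 [/IZR_lt d0]]]]]]]].
case=> /(f_equal IZR) e0 [/(f_equal IZR) e1 /(f_equal IZR) e2].
move: e0 e1 e2; rewrite !plus_IZR !mult_IZR.
move: (IZR a) (IZR b) (IZR c) (IZR d) a0 b0 c0 d0 => {a b c d} a b c d a0 b0 c0 d0 e0 e1 e2.
have cd : d = (a + b - c)%R by lra.
exists ((a * zx e.1 + b * zx e.2) / (a + b) - INR n./2, (a * zy e.1 + b * zy e.2) / (a + b))%R.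
split; apply/on_openE.
  exists (b / (a + b))%R; split.
    split; first by apply: Rdiv_lt_0_compat; lra.
    by apply: (Rmult_lt_reg_r (a + b)); [lra | rewrite /Rdiv Rmult_assoc Rinv_l; lra].
  by split; cbn [fst snd]; field; lra.
exists (d / (a + b))%R; split.
  split; first by apply: Rdiv_lt_0_compat; lra.
  by apply: (Rmult_lt_reg_r (a + b)); [lra | rewrite /Rdiv Rmult_assoc Rinv_l; lra].
by split; cbn [fst snd]; rewrite ?e1 ?e2 cd; field; lra.
Qed.

Lemma prim_colinear (d1 d2 w1 w2 x y : Z) : (x * d1 + y * d2 = 1)%Z ->
  (d1 * w2 - d2 * w1 = 0)%Z -> exists m, (w1 = m * d1 /\ w2 = m * d2)%Z.
Proof.
move=> h c; exists (x * w1 + y * w2)%Z.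
have e : (d1 * w2 = d2 * w1)%Z by lia.
split.
  transitivity ((x * d1 + y * d2) * w1)%Z; first by rewrite h; ring.
  transitivity (x * d1 * w1 + y * (d2 * w1))%Z; first by ring.
  by rewrite -e; ring.
transitivity ((x * d1 + y * d2) * w2)%Z; first by rewrite h; ring.
transitivity (x * (d1 * w2) + y * d2 * w2)%Z; first by ring.
by rewrite e; ring.
Qed.

Lemma IZR_mul_inj (m : Z) (t : R) (d1 d2 x y : Z) : (x * d1 + y * d2 = 1)%Z ->
  (IZR m * IZR d1 = t * IZR d1)%R -> (IZR m * IZR d2 = t * IZR d2)%R -> IZR m = t.
Proof.
move=> /(f_equal IZR); rewrite plus_IZR !mult_IZR => h h1 h2.
transitivity (IZR m * 1)%R; first by ring.
rewrite -h; transitivity (IZR x * (IZR m * IZR d1) + IZR y * (IZR m * IZR d2))%R; first by ring.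
rewrite h1 h2; transitivity (t * (IZR x * IZR d1 + IZR y * IZR d2))%R; first by ring.
by rewrite h; ring.
Qed.

(** Emptiness is tested on points of the box only, but if the gcd [g] of the direction exceeds 1,
    the point at parameter 1/g lies between the ends and hence in the box. Conversely, Bezout makes
    the parameter of any lattice point on the line an integer, and no integer lies in (0,1). *)
Lemma good_edgeP e : good_edge e <-> prim (zp e.1) (zp e.2).
Proof.
split; last first.
  case=> [x [y h]]; split.
    by move=> e12; move: h; rewrite e12; lia.
  move=> p /on_openE [t [ht [h1 h2]]].
  move: h1 h2; cbn [fst snd]; rewrite XE YE => h1 h2.
  have w1 : (IZR ((zp p).1 - (zp e.1).1) = t * IZR ((zp e.2).1 - (zp e.1).1))%R.
    by rewrite !minus_IZR; lra.
  have w2 : (IZR ((zp p).2 - (zp e.1).2) = t * IZR ((zp e.2).2 - (zp e.1).2))%R.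
    by rewrite !minus_IZR; lra.
  have [m [m1 m2]] : exists m, ((zp p).1 - (zp e.1).1 = m * ((zp e.2).1 - (zp e.1).1) /\
      (zp p).2 - (zp e.1).2 = m * ((zp e.2).2 - (zp e.1).2))%Z.
    apply: (prim_colinear h); apply: eq_IZR.
    by rewrite minus_IZR !mult_IZR w1 w2; ring.
  have mt : IZR m = t.
    by apply: (IZR_mul_inj h); rewrite -?w1 -?w2 -mult_IZR -?m1 -?m2.
  rewrite -mt in ht; case: ht => /lt_IZR h3 /lt_IZR h4.
  by move: h3 h4; clear; lia.
move=> [ne hg].
set d1 := ((zp e.2).1 - (zp e.1).1)%Z; set d2 := ((zp e.2).2 - (zp e.1).2)%Z.
pose g := Z.gcd d1 d2.
have g0 : (0 < g)%Z.
  have := Z.gcd_nonneg d1 d2; rewrite -/g.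
  case: (Z.eq_dec g 0) => [/Z.gcd_eq_0 [z1 z2] _|]; last by lia.
  case: ne; apply: zp_inj; rewrite [LHS]surjective_pairing [RHS]surjective_pairing.
  by congr pair; move: z1 z2; rewrite /d1 /d2; lia.
have [x [y hxy]] := Z.gcd_bezout d1 d2 g erefl.
have [g1|g1] : (g = 1 \/ 1 < g)%Z by lia.
  by exists x, y; rewrite -/d1 -/d2 hxy.
have [c1 hc1] := Z.gcd_divide_l d1 d2; have [c2 hc2] := Z.gcd_divide_r d1 d2.
rewrite -/g in hc1 hc2.
have bd u v c : (v - u = c * g -> (Z.min u v <= u + c <= Z.max u v))%Z.
  by move=> h; have : (0 <= c \/ c <= 0)%Z; nia.
have [p hp] : exists p : pt n k, zp p = ((zp e.1).1 + c1, (zp e.1).2 + c2)%Z.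
  apply: inbox_zp; split; cbn [fst snd].
    have := zp_inbox e.1; have := zp_inbox e.2.
    by move: (bd _ _ _ hc1); rewrite /inbox; clear; lia.
  have := zp_inbox e.1; have := zp_inbox e.2.
  by move: (bd _ _ _ hc2); rewrite /inbox; clear; lia.
case: (hg p); apply/on_openE; exists (/ IZR g)%R; rewrite XE YE hp; cbn [fst snd].
have /IZR_lt gr := g1.
split; first split; first by apply: Rinv_0_lt_compat; lra.
  by rewrite -Rinv_1; apply: Rinv_lt_contravar; lra.
have e1 : (zx e.2 - zx e.1 = IZR c1 * IZR g)%R by rewrite -minus_IZR -mult_IZR -hc1.
have e2 : (zy e.2 - zy e.1 = IZR c2 * IZR g)%R by rewrite -minus_IZR -mult_IZR -hc2.
by rewrite e1 e2 !plus_IZR; split; field; lra.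
Qed.

(** Non-parallel edges with a common point cross properly. Parallel primitive edges have equal or
    opposite directions, and the offset of their first ends is an integer multiple [j] of the
    direction, with [j] in (-1,1) or in (0,2) respectively; so [j] is 0 or 1 and the edges
    coincide. *)
Lemma common_Xing e f P : good_edge e -> good_edge f -> on_open e P -> on_open f P ->
  Xing (zp e.1) (zp e.2) (zp f.1) (zp f.2) \/ e = f \/ e = (f.2, f.1).
Proof.
move=> /good_edgeP [x [y hxy]] /good_edgeP [x' [y' hxy']].
move=> /on_openE [t [ht [h1 h2]]] /on_openE [t' [ht' [h1' h2']]].
set d1 := ((zp e.2).1 - (zp e.1).1)%Z in hxy; set d2 := ((zp e.2).2 - (zp e.1).2)%Z in hxy.
set c1 := ((zp f.2).1 - (zp f.1).1)%Z in hxy'; set c2 := ((zp f.2).2 - (zp f.1).2)%Z in hxy'.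
have E1 : (zx e.1 - zx f.1 = t' * IZR c1 - t * IZR d1)%R by rewrite /c1 /d1 !minus_IZR; lra.
have E2 : (zy e.1 - zy f.1 = t' * IZR c2 - t * IZR d2)%R by rewrite /c2 /d2 !minus_IZR; lra.
pose D := (d1 * c2 - d2 * c1)%Z.
have DE : IZR D = (IZR d1 * IZR c2 - IZR d2 * IZR c1)%R by rewrite minus_IZR !mult_IZR.
have ee1 : zx e.2 = (zx e.1 + IZR d1)%R by rewrite /d1 minus_IZR; ring.
have ee2 : zy e.2 = (zy e.1 + IZR d2)%R by rewrite /d2 minus_IZR; ring.
have ff1 : zx f.2 = (zx f.1 + IZR c1)%R by rewrite /c1 minus_IZR; ring.
have ff2 : zy f.2 = (zy f.1 + IZR c2)%R by rewrite /c2 minus_IZR; ring.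
have ge1 : zx e.1 = (zx f.1 + t' * IZR c1 - t * IZR d1)%R by lra.
have ge2 : zy e.1 = (zy f.1 + t' * IZR c2 - t * IZR d2)%R by lra.
have de1 : ((zp e.2).1 = (zp e.1).1 + d1)%Z by rewrite /d1; ring.
have de2 : ((zp e.2).2 = (zp e.1).2 + d2)%Z by rewrite /d2; ring.
have df1 : ((zp f.2).1 = (zp f.1).1 + c1)%Z by rewrite /c1; ring.
have df2 : ((zp f.2).2 = (zp f.1).2 + c2)%Z by rewrite /c2; ring.
clearbody d1 d2 c1 c2.
case: (Z.eq_dec D 0) => hD; last first.
  left; have D0 : (IZR D <> 0)%R by move=> /eq_IZR_R0.
  have D2 : (0 < IZR D * IZR D)%R by nra.
  split; apply: lt_IZR; rewrite mult_IZR /side !minus_IZR !mult_IZR !minus_IZR.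
    have -> : ((zx e.2 - zx e.1) * (zy f.1 - zy e.1) - (zy e.2 - zy e.1) * (zx f.1 - zx e.1)
       = - (t' * IZR D))%R by rewrite ee1 ee2 ge1 ge2 DE; ring.
    have -> : ((zx e.2 - zx e.1) * (zy f.2 - zy e.1) - (zy e.2 - zy e.1) * (zx f.2 - zx e.1)
       = (1 - t') * IZR D)%R by rewrite ee1 ee2 ff1 ff2 ge1 ge2 DE; ring.
    have : (0 < t' * (1 - t') * (IZR D * IZR D))%R by apply: Rmult_lt_0_compat; nra.
    by lra.
  have -> : ((zx f.2 - zx f.1) * (zy e.1 - zy f.1) - (zy f.2 - zy f.1) * (zx e.1 - zx f.1)
     = t * IZR D)%R by rewrite ff1 ff2 ge1 ge2 DE; ring.
  have -> : ((zx f.2 - zx f.1) * (zy e.2 - zy f.1) - (zy f.2 - zy f.1) * (zx e.2 - zx f.1)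
     = - ((1 - t) * IZR D))%R by rewrite ee1 ee2 ff1 ff2 ge1 ge2 DE; ring.
  have : (0 < t * (1 - t) * (IZR D * IZR D))%R by apply: Rmult_lt_0_compat; nra.
  by lra.
right.
have [m [m1 m2]] := prim_colinear hxy hD.
have [m' [m1' m2']] : exists m', (d1 = m' * c1 /\ d2 = m' * c2)%Z.
  by apply: (prim_colinear hxy'); move: hD; rewrite /D; clear; lia.
have mm : (m * m' = 1)%Z.
  transitivity (m * m' * (x * d1 + y * d2))%Z; first by rewrite hxy; ring.
  transitivity (x * (m' * (m * d1)) + y * (m' * (m * d2)))%Z; first by ring.
  by rewrite -m1 -m2 -m1' -m2'.
have m1_ : (m = 1 \/ m = -1)%Z by case: (Z.eq_mul_1 m m' mm); lia.
have [j [j1 j2]] : exists j, ((zp f.1).1 - (zp e.1).1 = j * d1 /\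
     (zp f.1).2 - (zp e.1).2 = j * d2)%Z.
  apply: (prim_colinear hxy); apply: eq_IZR.
  rewrite minus_IZR !mult_IZR !minus_IZR ge1 ge2 m1 m2 !mult_IZR; ring.
have jt : IZR j = (t - t' * IZR m)%R.
  apply: (IZR_mul_inj hxy); rewrite -mult_IZR -?j1 -?j2 minus_IZR ?ge1 ?ge2 ?m1 ?m2 ?mult_IZR; ring.
case: m1_ => em; subst m.
  have j0 : (j = 0)%Z.
    have : (IZR (-1) < IZR j < IZR 1)%R by lra.
    by case=> /lt_IZR ? /lt_IZR ?; lia.
  left; rewrite [LHS]surjective_pairing [RHS]surjective_pairing.
  by congr pair; apply: zp_inj; rewrite [LHS]surjective_pairing [RHS]surjective_pairing;
    congr pair; move: j1 j2 m1 m2; rewrite ?de1 ?de2 ?df1 ?df2 j0; clear; lia.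
have j0 : (j = 1)%Z.
  have : (IZR 0 < IZR j < IZR 2)%R by lra.
  by case=> /lt_IZR ? /lt_IZR ?; lia.
right; rewrite [LHS]surjective_pairing.
by congr pair; apply: zp_inj; rewrite [LHS]surjective_pairing [RHS]surjective_pairing;
  congr pair; move: j1 j2 m1 m2; rewrite ?de1 ?de2 ?df1 ?df2 j0; clear; lia.
Qed.
End Bridge.

Section Triangulations.
Variables (n k : nat).
Implicit Types (p q : pt n k) (e f : edge n k) (s : {set edge n k}).

Lemma Xing_irrefl P Q : ~ Xing P Q P Q.
Proof. by case; rewrite /side; lia. Qed.

Lemma edge_set_okP s : edge_set_ok s <->
  (forall e, e \in s -> good_edge e /\ (e.2, e.1) \notin s) /\
  (forall e f, e \in s -> f \in s -> ~ Xing (zp e.1) (zp e.2) (zp f.1) (zp f.2)).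
Proof.
split=> -[h1 h2]; split=> // e f he hf.
  case: (eqVneq e f) => [<-|/eqP ef]; first exact: Xing_irrefl.
  by case/Xing_common=> P; apply: h2.
move=> ef P [oe of_].
case: (common_Xing (proj1 (h1 _ he)) (proj1 (h1 _ hf)) oe of_) => [|[//|ee]].
  exact: h2.
by have [_ /negP] := h1 _ hf; rewrite -ee.
Qed.

Definition Gs s (P Q : Z * Z) : Prop :=
  exists p q, [/\ P = zp p, Q = zp q & has_edge s p q].

Lemma has_edgeC s p q : has_edge s p q -> has_edge s q p.
Proof. by case; [right | left]. Qed.

Lemma GsP s p q : Gs s (zp p) (zp q) <-> has_edge s p q.
Proof.
split=> [[p' [q' [/zp_inj -> /zp_inj ->]]] //|h].
by exists p, q.
Qed.

Lemma has_edge_nX s p q p' q' : edge_set_ok s -> has_edge s p q -> has_edge s p' q' ->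
  ~ Xing (zp p) (zp q) (zp p') (zp q').
Proof.
move=> /edge_set_okP [_ nX].
case=> h1; case=> h2 hX; apply: (nX _ _ h1 h2) => //=.
- exact: Xing_swapr.
- exact: Xing_swapl.
- exact: Xing_swapl (Xing_swapr hX).
Qed.

Lemma triang_Gs s : triangulation s -> triang (inbox n k) (Gs s).
Proof.
move=> [ok mx]; have [h1 h2] := (proj1 (edge_set_okP s) ok); split.
- by move=> P Q [p [q [-> -> /has_edgeC h]]]; exists q, p.
- by move=> P Q [p [q [-> _ _]]]; apply: zp_inbox.
- move=> P Q [p [q [-> -> [h|h]]]]; first exact: (proj1 (good_edgeP _) (proj1 (h1 _ h))).
  exact/prim_sym/(proj1 (good_edgeP _) (proj1 (h1 _ h))).
- move=> _ _ _ _ [p [q [-> -> h]]] [p' [q' [-> -> h']]]; exact: has_edge_nX ok h h'.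
- move=> P Q /inbox_zp [p <-] /inbox_zp [q <-] hpq nX; apply/GsP.
  apply: NNPP => /not_or_and [/negP hn /negP hn'].
  suff ok' : edge_set_ok ((p, q) |: s).
    by move/negP: hn; apply; rewrite -(mx _ ok' (subsetUr _ _)) setU11.
  have nX' f : f \in s -> ~ Xing (zp p) (zp q) (zp f.1) (zp f.2).
    by move=> hf; apply: nX; apply/GsP; left; rewrite -surjective_pairing.
  have pq : p != q by apply/eqP=> pq; case: hpq => x [y]; rewrite pq; lia.
  apply/edge_set_okP; split=> [e|e f].
    case/setU1P=> [->|he] /=.
      split; first exact/good_edgeP.
      by rewrite in_setU1 negb_or hn' andbT xpair_eqE negb_and eq_sym pq.
    have [he1 he2] := h1 _ he; split=> //; rewrite in_setU1 negb_or he2 andbT.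
    apply/eqP=> -[e2 e1]; move/negP: hn'; apply.
    by rewrite -e1 -e2 -surjective_pairing.
  case/setU1P=> [->|he]; case/setU1P=> [->|hf]; [exact: Xing_irrefl | exact: nX' | | exact: h2].
  by move/Xing_symlr; apply: nX'.
- move=> a b c p q r t ha hb hc h0 [hp1 hp2] [hq1 hq2] [hr1 hr2] e1 e2.
  have aux (w x y z m : Z) : (0 <= x <= m -> 0 <= y <= m -> 0 <= z <= m ->
      (a + b + c) * w = a * x + b * y + c * z -> 0 <= w <= m)%Z.
    by move: ha hb hc h0; clear; nia.
  by split; [apply: (aux _ _ _ _ _ hp1 hq1 hr1 e1) | apply: (aux _ _ _ _ _ hp2 hq2 hr2 e2)].
- exists (Z.of_nat (n./2).*2 + Z.of_nat k)%Z => p []; clear; lia.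
Qed.

(** Maximality transfers by swapping back: a valid [S] containing the flipped set becomes, once the
    diagonals are exchanged again, a valid set containing [s], hence [s] itself. Both exchanges are
    valid because, by [square_diagonal], only one diagonal can cross the other. *)
Lemma flip_triangulation s e z z' : triangulation s -> e \in s ->
  has_edge s e.1 z -> has_edge s z e.2 -> has_edge s e.1 z' -> has_edge s z' e.2 ->
  ((zp e.1).1 + (zp e.2).1 = (zp z).1 + (zp z').1)%Z ->
  ((zp e.1).2 + (zp e.2).2 = (zp z).2 + (zp z').2)%Z ->
  (side (zp e.1) (zp z) (zp z') * side (zp e.1) (zp z) (zp z') = 1)%Z ->
  triangulation ((z, z') |: s :\ e) /\ (z, z') \notin s.
Proof.
move=> [ok mx] he hpz hzq hpz' hz'q m1 m2 dd.
have [h1 h2] := (proj1 (edge_set_okP s) ok).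
set p := zp e.1 in m1 m2 dd *; set q := zp e.2 in m1 m2 dd *.
have dd2 : (side (zp z) p q * side (zp z) p q = 1)%Z.
  rewrite -dd; have -> : side (zp z) p q = (side p (zp z) (zp z') * (-1))%Z; last by ring.
  rewrite /side; have -> : (q.1 = (zp z).1 + (zp z').1 - p.1)%Z by move: m1; rewrite /p /q; clear; lia.
  by have -> : (q.2 = (zp z).2 + (zp z').2 - p.2)%Z; [move: m2; rewrite /p /q; clear; lia | ring].
have side_zz P : (side (zp z) (zp z') P = side p (zp z') P - side p (zp z) P
   + side p (zp z) (zp z'))%Z by rewrite /side; ring.
have hX : Xing (zp z) (zp z') p q.
  set D := side p (zp z) (zp z') in dd.
  split.
    have -> : side (zp z) (zp z') p = D by rewrite /D /side; ring.
    have -> : side (zp z) (zp z') q = (- D)%Z.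
      rewrite /D /side; have -> : (q.1 = (zp z).1 + (zp z').1 - p.1)%Z by move: m1; rewrite /p /q; clear; lia.
      by have -> : (q.2 = (zp z).2 + (zp z').2 - p.2)%Z; [move: m2; rewrite /p /q; clear; lia | ring].
    by move: dd; clear; nia.
  have q1 : (q.1 = (zp z).1 + (zp z').1 - p.1)%Z by move: m1; rewrite /p /q; clear; lia.
  have q2 : (q.2 = (zp z).2 + (zp z').2 - p.2)%Z by move: m2; rewrite /p /q; clear; lia.
  have -> : side p q (zp z) = (- D)%Z by rewrite /D /side q1 q2; ring.
  have -> : side p q (zp z') = D by rewrite /D /side q1 q2; ring.
  by move: dd; clear; nia.
have hzz : prim (zp z) (zp z').
  exists (side p (zp z) (zp z') * (p.2 - (zp z).2))%Z,
    (side p (zp z) (zp z') * ((zp z).1 - p.1))%Z.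
  by rewrite -dd /side -/p; ring.
have nzz : ~ has_edge s z z'.
  move=> h; apply: (has_edge_nX ok h _ hX); left; by rewrite -surjective_pairing.
have nin : (z, z') \notin s by apply/negP=> h; apply: nzz; left.
have nin' : (z', z) \notin s by apply/negP=> h; apply: nzz; right.
have hpq : has_edge s e.1 e.2 by left; rewrite -surjective_pairing.
have ne4 : [/\ z != e.1, z != e.2, z' != e.1 & z' != e.2].
  case: (hX) => hb _; rewrite /p /q /side in hb.
  by split; apply/eqP=> ee; move: hb; rewrite ee; clear; lia.
have off a b : has_edge s a b -> ~ ((a = e.1 /\ b = e.2) \/ (b = e.1 /\ a = e.2)) ->
    has_edge (s :\ e) a b.
  by case=> h nh; [left|right]; rewrite in_setD1 h andbT; apply/eqP=> ee;
    apply: nh; rewrite -ee; [left|right].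
have sides a : a = z \/ a = z' -> has_edge (s :\ e) e.1 a /\ has_edge (s :\ e) e.2 a.
  case: ne4 => /eqP n1 /eqP n2 /eqP n3 /eqP n4.
  by case=> ->; split; apply: off; try (by case=> -[]); try exact: has_edgeC.
have only (S : {set edge n k}) f : edge_set_ok S -> s :\ e \subset S -> f \in S ->
    Xing (zp z) (zp z') (zp f.1) (zp f.2) -> f = e \/ f = (e.2, e.1).
  move=> okS sub hf hXf.
  have nXS a b : has_edge (s :\ e) a b -> ~ Xing (zp f.1) (zp f.2) (zp a) (zp b).
    move=> hab; apply: (has_edge_nX okS); first by left; rewrite -surjective_pairing.
    by case: hab => hab; [left|right]; apply: (subsetP sub).
  have [k1 k2] := sides z (or_introl erefl); have [k3 k4] := sides z' (or_intror erefl).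
  have gf : prim (zp f.1) (zp f.2).
    exact: (proj1 (good_edgeP _) (proj1 (proj1 (proj1 (edge_set_okP S) okS) _ hf))).
  case: (square_diagonal m1 m2 dd gf hXf (nXS _ _ k1) (nXS _ _ k3) (nXS _ _ k2) (nXS _ _ k4)).
    by case=> /zp_inj e1 /zp_inj e2; left; rewrite [LHS]surjective_pairing e1 e2 -surjective_pairing.
  by case=> /zp_inj e1 /zp_inj e2; right; rewrite [LHS]surjective_pairing e1 e2.
have only' (S : {set edge n k}) f : edge_set_ok S -> s :\ e \subset S -> f \in S ->
    Xing p q (zp f.1) (zp f.2) -> f = (z, z') \/ f = (z', z).
  move=> okS sub hf hXf.
  have nXS a b : has_edge (s :\ e) a b -> ~ Xing (zp f.1) (zp f.2) (zp b) (zp a).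
    move=> hab; apply: (has_edge_nX okS); first by left; rewrite -surjective_pairing.
    by case: hab => hab; [right|left]; apply: (subsetP sub).
  have [k1 k2] := sides z (or_introl erefl); have [k3 k4] := sides z' (or_intror erefl).
  have gf : prim (zp f.1) (zp f.2).
    exact: (proj1 (good_edgeP _) (proj1 (proj1 (proj1 (edge_set_okP S) okS) _ hf))).
  case: (square_diagonal (esym m1) (esym m2) dd2 gf hXf (nXS _ _ k1) (nXS _ _ k2) (nXS _ _ k3) (nXS _ _ k4)).
    by case=> /zp_inj e1 /zp_inj e2; left; rewrite [LHS]surjective_pairing e1 e2.
  by case=> /zp_inj e1 /zp_inj e2; right; rewrite [LHS]surjective_pairing e1 e2.
have zz' : z != z' by apply/eqP=> zz'; move: dd; rewrite zz' /side; clear; lia.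
have reve : (e.2, e.1) \notin s by have [] := h1 _ he.
have ok1 : edge_set_ok ((z, z') |: s :\ e).
  have nX1 f : f \in s :\ e -> ~ Xing (zp z) (zp z') (zp f.1) (zp f.2).
    rewrite in_setD1 => /andP [fe hf] hXf.
    case: (only s f ok (subsetDl _ _) hf hXf) => fe'; first by rewrite fe' eqxx in fe.
    by rewrite fe' (negbTE reve) in hf.
  apply/edge_set_okP; split=> [f|f g].
    case/setU1P=> [->|] /=.
      split; first exact/good_edgeP.
      by rewrite in_setU1 in_setD1 (negbTE nin') andbF orbF xpair_eqE negb_and eq_sym zz'.
    rewrite in_setD1 => /andP [fe hf]; have [hf1 hf2] := h1 _ hf; split=> //.
    rewrite in_setU1 in_setD1 (negbTE hf2) andbF orbF; apply/eqP=> -[f2 f1].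
    by move: hf; rewrite [f]surjective_pairing f1 f2 (negbTE nin').
  case/setU1P=> [->|hf]; case/setU1P=> [->|hg]; first exact: Xing_irrefl.
  - exact: nX1.
  - by move/Xing_symlr; apply: nX1.
  - by apply: h2; [move: hf | move: hg]; rewrite in_setD1 => /andP [].
split=> //; split=> // S okS sub1.
have subS : s :\ e \subset S by apply: subset_trans sub1; apply: subsetUr.
have zzS : (z, z') \in S by apply: (subsetP sub1); rewrite setU11.
have [g1 g2] := (proj1 (edge_set_okP S) okS).
have eS : e \notin S by apply/negP=> eS; exact: (g2 _ _ zzS eS hX).
have reS : (e.2, e.1) \notin S.
  by apply/negP=> reS; apply: (g2 _ _ zzS reS); apply: Xing_swapr.
suff S2s : e |: S :\ (z, z') = s.
  apply/eqP; rewrite eqEsubset sub1 andbT; apply/subsetP=> g gS.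
  rewrite in_setU1; case: eqP => //= /eqP gzz; rewrite in_setD1.
  rewrite -S2s in_setU1 in_setD1 gzz gS orbT andbT.
  by apply/eqP=> ge; rewrite -ge gS in eS.
apply: mx; last first.
  apply/subsetP=> f hf; rewrite in_setU1 in_setD1; case: eqP => //= /eqP fe.
  rewrite (subsetP subS) ?in_setD1 ?fe // andbT.
  by apply/eqP=> fz; rewrite -fz hf in nin.
have nX2 f : f \in S :\ (z, z') -> ~ Xing p q (zp f.1) (zp f.2).
  rewrite in_setD1 => /andP [fz fS] hXf.
  case: (only' S f okS subS fS hXf) => fe; first by rewrite fe eqxx in fz.
  by have [_ /negP] := g1 _ zzS; apply; rewrite -fe.
have ee' : (e.2, e.1) != e by apply/eqP=> ee; rewrite ee he in reve.
apply/edge_set_okP; split=> [f|f g].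
  case/setU1P=> [->|] /=.
    split; first by have [] := h1 _ he.
    by rewrite in_setU1 in_setD1 (negbTE reS) andbF orbF.
  rewrite in_setD1 => /andP [fz fS]; have [hf1 hf2] := g1 _ fS; split=> //.
  rewrite in_setU1 in_setD1 (negbTE hf2) andbF orbF; apply/eqP=> fe.
  by move/negP: reS; apply; rewrite -fe /= -surjective_pairing.
case/setU1P=> [->|hf]; case/setU1P=> [->|hg]; first exact: Xing_irrefl.
- exact: nX2.
- by move/Xing_symlr; apply: nX2.
- by apply: g2; [move: hf | move: hg]; rewrite in_setD1 => /andP [].
Qed.
End Triangulations.

(** * Gain of a flip and descent to a crossing *)

Section FlipGain.
Local Open Scope Z_scope.

(** In absolute values the flip replaces sums by differences, so [g] is twice the smaller width plus
    twice the smaller height. Total width at least 2 makes both widths positive. If both heights are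
    positive too, the determinant bounds the larger width by a height times the smaller width, plus
    1. *)
Lemma flip_gain u1 u2 v1 v2 k : u1 * v2 - u2 * v1 = 1 \/ u1 * v2 - u2 * v1 = -1 ->
  0 <= u1 * v1 -> 0 <= u2 * v2 -> Z.abs v1 + Z.abs v2 <= Z.abs u1 + Z.abs u2 ->
  2 <= Z.abs (u1 + v1) -> Z.abs (u2 + v2) <= k ->
  let g := Z.abs (u1 + v1) + Z.abs (u2 + v2) - Z.abs (u1 - v1) - Z.abs (u2 - v2) in
  2 <= g /\
  (Z.abs (u2 + v2) = 1 -> v2 = 0 /\ Z.abs (u1 - v1) + 2 = Z.abs (u1 + v1)) /\
  (Z.abs (u2 + v2) <> 1 -> Z.abs (u1 + v1) <= k * g).
Proof.
move=> hd h1 h2 hl hw hk.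
have hd' : Z.abs u1 * Z.abs v2 - Z.abs u2 * Z.abs v1 = 1 \/
    Z.abs u2 * Z.abs v1 - Z.abs u1 * Z.abs v2 = 1.
  rewrite -!Z.abs_mul.
  have : 0 <= (u1 * v2) * (u2 * v1).
    by have -> : (u1 * v2) * (u2 * v1) = (u1 * v1) * (u2 * v2) by [ring]; apply: Z.mul_nonneg_nonneg.
  move: hd; move: (u1 * v2) (u2 * v1) => x y; clear => hd hxy.
  have : (0 <= x /\ 0 <= y) \/ (x <= 0 /\ y <= 0) by nia.
  lia.
have [s1 t1] : Z.abs (u1 + v1) = Z.abs u1 + Z.abs v1 /\
    Z.abs (u1 - v1) = Z.abs (Z.abs u1 - Z.abs v1).
  have : (0 <= u1 /\ 0 <= v1) \/ (u1 <= 0 /\ v1 <= 0) by move: h1; clear; nia.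
  by clear; lia.
have [s2 t2] : Z.abs (u2 + v2) = Z.abs u2 + Z.abs v2 /\
    Z.abs (u2 - v2) = Z.abs (Z.abs u2 - Z.abs v2).
  have : (0 <= u2 /\ 0 <= v2) \/ (u2 <= 0 /\ v2 <= 0) by move: h2; clear; nia.
  by clear; lia.
suff H : 2 <= Z.abs u1 + Z.abs v1 + (Z.abs u2 + Z.abs v2) - Z.abs (Z.abs u1 - Z.abs v1)
      - Z.abs (Z.abs u2 - Z.abs v2) /\
   (Z.abs u2 + Z.abs v2 = 1 -> Z.abs v2 = 0 /\
      Z.abs (Z.abs u1 - Z.abs v1) + 2 = Z.abs u1 + Z.abs v1) /\
   (Z.abs u2 + Z.abs v2 <> 1 -> Z.abs u1 + Z.abs v1 <=
      k * (Z.abs u1 + Z.abs v1 + (Z.abs u2 + Z.abs v2) - Z.abs (Z.abs u1 - Z.abs v1)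
      - Z.abs (Z.abs u2 - Z.abs v2))).
  rewrite s1 s2 t1 t2 /=; case: H => a [b c]; split=> //; split=> //.
  by move=> /b []; clear; lia.
rewrite s1 in hw; rewrite s2 in hk.
move: (Z.abs_nonneg u1) (Z.abs_nonneg u2) (Z.abs_nonneg v1) (Z.abs_nonneg v2).
move: hd' hw hk hl; clear.
move: (Z.abs u1) (Z.abs u2) (Z.abs v1) (Z.abs v2) => a b c d hd hw hk hl a0 b0 c0 d0.
have a1 : 1 <= a.
  apply: Znot_gt_le => a2; have az : a = 0 by lia.
  subst a; have bc : b * c = 1 by lia.
  by case: (Z.eq_mul_1_nonneg _ _ b0 bc) => ? ?; lia.
have c1 : 1 <= c.
  apply: Znot_gt_le => a2; have az : c = 0 by lia.
  subst c; have ad : a * d = 1 by lia.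
  by case: (Z.eq_mul_1_nonneg _ _ a0 ad) => ? ?; lia.
split; first by lia.
split=> hbd.
  have [[? ?]|[? ?]] : (b = 1 /\ d = 0) \/ (b = 0 /\ d = 1) by lia.
    by subst; lia.
  by subst; lia.
have b1 : 1 <= b.
  apply: Znot_gt_le => b2; have bz : b = 0 by lia.
  subst b; have ad : a * d = 1 by lia.
  by case: (Z.eq_mul_1_nonneg _ _ a0 ad) => ? ?; lia.
have d1 : 1 <= d.
  apply: Znot_gt_le => b2; have bz : d = 0 by lia.
  subst d; have bc : b * c = 1 by lia.
  by case: (Z.eq_mul_1_nonneg _ _ b0 bc) => ? ?; lia.
set g := (X in _ <= k * X).
(* [x] and [y] are the smaller and the larger width, and [z] is the height that multiplies [x] in
   the determinant. *)
have fin x y z w : 0 <= x -> 0 <= z -> y <= z * x + 1 -> z + 1 <= k -> 2 * x + 2 <= g ->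
    w = x + y -> w <= k * g.
  move=> x0 z0 h hz hg ->.
  have i1 : k * (2 * x + 2) <= k * g by apply: Z.mul_le_mono_nonneg_l; lia.
  have i2 : (z + 1) * x <= k * x by apply: Z.mul_le_mono_nonneg_r.
  by move: i1 i2 h x0 hz z0; clear; lia.
have [ac|ca] : a <= c \/ c <= a by lia.
  refine (fin a c d _ a0 d0 _ _ _ erefl); [|lia|rewrite /g; lia].
  by move: hd b1 a1 c1; clear; nia.
refine (fin c a b _ c0 b0 _ _ _ _); [|lia|rewrite /g; lia|lia].
by move: hd d1 a1 c1; clear; nia.
Qed.

(** A spanning edge has width at least 2, so a primitive one is not horizontal and cannot run along
    the bottom or the top of the box. Hence it has a triangle on each side and can always be flipped
    when it is longest. *)
Lemma spans_box_sides (W k a : Z) (p q : Z * Z) : prim p q -> spans a p q ->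
  0 <= p.2 <= k -> 0 <= q.2 <= k ->
  (side p q (a, 0) < 0 /\ 0 < side p q (a, k)) \/ (side p q (a, k) < 0 /\ 0 < side p q (a, 0)).
Proof.
move=> [x [y hxy]] hs hp hq.
have e0 : side p q (a, 0) = - (p.2 * (q.1 - a) + q.2 * (a - p.1)).
  by rewrite /side; cbn [fst snd]; ring.
have ek : side p q (a, k) = (k - p.2) * (q.1 - a) + (k - q.2) * (a - p.1).
  by rewrite /side; cbn [fst snd]; ring.
have flat : p.2 <> q.2.
  move=> e; rewrite e Z.sub_diag Z.mul_0_r Z.add_0_r in hxy.
  by case: (Z.eq_mul_1 _ _ (eq_trans (Z.mul_comm _ _) hxy)) hs => h; rewrite /spans; move: h; clear; lia.
rewrite e0 ek; case: hs => hs; [left | right]; move: hs hp hq flat; clear.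
  move: (p.1) (p.2) (q.1) (q.2) => p1 p2 q1 q2 [h1 h2] hp hq fl.
  have i1 : 0 < q1 - a by lia. have i2 : 0 < a - p1 by lia.
  move: i1 i2; move: (q1 - a) (a - p1) => X Y i1 i2; clear -fl i1 i2 hp hq.
  by split; [have [?|?] : 0 < p2 \/ 0 < q2 by lia | have [?|?] : 0 < k - p2 \/ 0 < k - q2 by lia]; nia.
move: (p.1) (p.2) (q.1) (q.2) => p1 p2 q1 q2 [h1 h2] hp hq fl.
have i1 : q1 - a < 0 by lia. have i2 : a - p1 < 0 by lia.
move: i1 i2; move: (q1 - a) (a - p1) => X Y i1 i2; clear -fl i1 i2 hp hq.
by split; [have [?|?] : 0 < k - p2 \/ 0 < k - q2 by lia | have [?|?] : 0 < p2 \/ 0 < q2 by lia]; nia.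
Qed.
End FlipGain.

Section Descent.
Variables (n k : nat).
Variable a : 'I_(n./2).*2.+1.
Implicit Types (p q : pt n k) (e f : edge n k) (s : {set edge n k}).

Definition spansE e : bool := (e.1.1 < a < e.2.1) || (e.2.1 < a < e.1.1).

Definition width e : nat := natdist e.1.1 e.2.1.
Definition height e : nat := natdist e.1.2 e.2.2.

Definition depth e : nat := minn (natdist e.1.1 a) (natdist e.2.1 a).

(* A lower bound for the total decrease in length of the edge [e] when it is
   flipped until it does not span the column [a] any more. *)
Definition gain e : nat :=
  if height e == 1 then 2 * depth e else maxn 2 ((width e + k.-1) %/ k).

Definition same_mid e f : Prop :=
  e.1.1 + e.2.1 = f.1.1 + f.2.1 :> nat /\ e.1.2 + e.2.2 = f.1.2 + f.2.2 :> nat.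

Lemma spansP e : reflect (spans (Z.of_nat a) (zp e.1) (zp e.2)) (spansE e).
Proof. by apply: (iffP idP); rewrite /spansE /spans /=; lia. Qed.

Lemma same_mid_eq s e f : edge_set_ok s -> e \in s -> f \in s -> same_mid e f -> e = f.
Proof.
move=> [h1 h2] he hf [m1 m2]; apply: NNPP => ef.
pose P := ((X e.1 + X e.2) / 2, (Y e.1 + Y e.2) / 2)%R.
apply: (h2 _ _ he hf ef P); split; exists (/ 2)%R; rewrite /P /=; (split; [split; lra|split]).
- by field.
- by field.
- move/(f_equal INR): m1; rewrite !plus_INR /X; lra.
- move/(f_equal INR): m2; rewrite !plus_INR /Y; lra.
Qed.

Lemma no_span_crossing s : triangulation s -> (forall e, e \in s -> ~~ spansE e) ->
  crossing s a.
Proof.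
move=> hs nsp j; apply/GsP; have T := triang_Gs hs.
have hj := ltn_ord j.
have z1 : zp (a, inord j : 'I_k.+1) = (Z.of_nat a, Z.of_nat j).
  by rewrite /zp /= inordK //; lia.
have z2 : zp (a, inord j.+1 : 'I_k.+1) = (Z.of_nat a, Z.of_nat j.+1).
  by rewrite /zp /= inordK //; lia.
apply: (triang_max T); try exact: zp_inbox.
  by exists 0%Z, 1%Z; rewrite z1 z2; cbn [fst snd]; lia.
move=> _ _ [p [q [-> -> h]]] hX.
have sp : spans (Z.of_nat a) (zp p) (zp q).
  have sE P : side (Z.of_nat a, Z.of_nat j) (Z.of_nat a, Z.of_nat j.+1) P = (Z.of_nat a - P.1)%Z.
    by rewrite /side; cbn [fst snd]; rewrite Nat2Z.inj_succ; ring.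
  case: hX; rewrite z1 z2 !sE => /Z.lt_mul_0 + _.
  by rewrite /spans; clear; lia.
case: h => h; have /negP := nsp _ h; apply; apply/spansP=> //=.
by move: sp; rewrite /spans; clear; lia.
Qed.

(** The edge meets the column at height N/w, which is not an integer since a primitive edge has no
    interior lattice point. It therefore crosses the unit vertical that starts at the integer part
    of N/w. *)
Lemma crossing_no_span s e : edge_set_ok s -> crossing s a -> e \in s -> ~~ spansE e.
Proof.
move=> ok hc he; apply/negP=> /spansP hs.
have [h1 _] := proj1 (edge_set_okP s) ok.
have /good_edgeP pr := proj1 (h1 _ he).
have oriented (p q : pt n k) : has_edge s p q -> ((zp p).1 < Z.of_nat a < (zp q).1)%Z -> False.
  move=> hpq hpa.
  have pr' : prim (zp p) (zp q).
    by case: hpq => /h1 [/good_edgeP]; [|move=> /prim_sym].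
  set A := Z.of_nat a in hpa.
  have := zp_inbox p; have := zp_inbox q => -[_ q2] [_ p2].
  set w := ((zp q).1 - (zp p).1)%Z.
  set N := ((zp p).2 * ((zp q).1 - A) + (zp q).2 * (A - (zp p).1))%Z.
  have w0 : (0 < w)%Z by rewrite /w; lia.
  have bnd : (0 <= N <= Z.of_nat k * w)%Z.
    rewrite /N /w; move: hpa p2 q2; clear.
    by move: ((zp p).1) ((zp q).1) ((zp p).2) ((zp q).2); intros; nia.
  pose j := (N / w)%Z; pose r := (N mod w)%Z.
  have Nj : (N = w * j + r)%Z by apply: Z.div_mod; lia.
  have rb : (0 <= r < w)%Z by apply: Z.mod_pos_bound.
  have sideV y : side (zp p) (zp q) (A, y) = (w * y - N)%Z.
    by rewrite /side /w /N; cbn [fst snd]; ring.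
  have r0 : r <> 0%Z.
    move=> r0; rewrite r0 in Nj.
    have [x [y hxy]] := pr'.
    have [|m [m1 m2]] := @prim_colinear _ _ (A - (zp p).1)%Z (j - (zp p).2)%Z x y hxy.
      by have := sideV j; rewrite Nj /side; cbn [fst snd]; clear; lia.
    have [mm|mm] : (m <= 0 \/ 1 <= m)%Z by clear; lia.
      by move: m1 hpa mm; clear; nia.
    by move: m1 hpa mm; clear; nia.
  have jb : (0 <= j < Z.of_nat k)%Z by move: bnd Nj rb r0 w0; clear; nia.
  have hj : Z.to_nat j < k by lia.
  have := hc (Ordinal hj).
  move=> hv; apply: (has_edge_nX ok hpq hv).
  have -> : zp (a, inord (Ordinal hj) : 'I_k.+1) = (A, j).
    by rewrite /zp /= inordK; [rewrite Z2Nat.id //; lia | lia].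
  have -> : zp (a, inord (Ordinal hj).+1 : 'I_k.+1) = (A, j + 1)%Z.
    by rewrite /zp /= inordK; [congr pair; lia | lia].
  split.
    by rewrite !sideV Nj; move: rb r0; clear; nia.
  rewrite /side; cbn [fst snd].
  by rewrite Z.sub_diag; move: hpa; clear; nia.
case: hs => hs; [apply: (oriented e.1 e.2) | apply: (oriented e.2 e.1)] => //.
  by left; rewrite -surjective_pairing.
by right; rewrite -surjective_pairing.
Qed.

Hypothesis k1 : 0 < k.

Lemma gain_le e g : height e != 1 -> 2 <= g -> width e <= k * g -> gain e <= g.
Proof.
move=> he g2 hw; rewrite /gain (negbTE he) geq_max g2 /=.
by rewrite -ltnS ltn_divLR //; nia.
Qed.

Lemma longest_flip s e0 : triangulation s -> e0 \in s -> spansE e0 ->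
  exists e e', [/\ e \in s, spansE e, e' \notin s & triangulation (e' |: s :\ e)] /\
    [/\ same_mid e' e, elen e' + 2 <= elen e,
      height e = 1 -> [/\ e'.1.2 = e.1.2, e'.2.2 = e.2.2 & width e' + 2 = width e] &
      height e <> 1 -> width e <= k * (elen e - elen e')].
Proof.
move=> hs he0 se0; have T := triang_Gs hs.
have [e [he se mx]] : exists e, [/\ e \in s, spansE e &
    forall f, f \in s -> spansE f -> elen f <= elen e].
  case: (@arg_maxnP _ e0 (fun e => (e \in s) && spansE e) (@elen n k)); first by rewrite he0.
  by move=> e /andP [he se] h; exists e; split=> // f hf sf; apply: h; rewrite hf.
have hpq : has_edge s e.1 e.2 by left; rewrite -surjective_pairing.
have elenE (p q : pt n k) : Z.of_nat (elen (p, q)) = l1 (zp p) (zp q).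
  by rewrite /elen /l1 /natdist /zp /=; lia.
have mx' r t : Gs s r t -> spans (Z.of_nat a) r t -> (l1 r t <= l1 (zp e.1) (zp e.2))%Z.
  move=> [p [q [-> -> h]]] sp; rewrite -!elenE -surjective_pairing.
  case: h => h.
    by have := mx _ h; case: spansP => // + /(_ isT); lia.
  have := mx _ h; case: spansP => [_ /(_ isT)|[]]; last by move: sp; rewrite /spans /=; lia.
  by move: (elenE p q) (elenE q p); rewrite /l1; lia.
have hsp : spans (Z.of_nat a) (zp e.1) (zp e.2) by apply/spansP.
have G := proj2 (GsP s _ _) hpq.
have pr := triang_prim T G.
have [ha0 hak] : inbox n k (Z.of_nat a, 0%Z) /\ inbox n k (Z.of_nat a, Z.of_nat k).
  by have := ltn_ord a; rewrite /inbox /=; lia.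
have [P [P' [hP sP hP' sP']]] : exists P P', [/\ inbox n k P, (0 < side (zp e.1) (zp e.2) P)%Z,
    inbox n k P' & (side (zp e.1) (zp e.2) P' < 0)%Z].
  have [_ b1] := zp_inbox e.1; have [_ b2] := zp_inbox e.2.
  have [[h1 h2]|[h1 h2]] := spans_box_sides 0%Z pr hsp b1 b2.
    by exists (Z.of_nat a, Z.of_nat k), (Z.of_nat a, 0%Z).
  by exists (Z.of_nat a, 0%Z), (Z.of_nat a, Z.of_nat k).
have [z [z' [[g1 [g2 [g3 g4]]] [[m1 m2] [dd [[q1 q2] hl]]]]]] :=
  longest_parallelogram T G hsp mx' hP sP hP' sP'.
have [zz ez] := inbox_zp (triang_inr T g1); have [zz' ez'] := inbox_zp (triang_inr T g3).
subst z z'.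
have [||||||| tr nin] := @flip_triangulation n k s e zz' zz hs he; try by [apply/GsP | lia].
  by move: dd; rewrite /side; clear; lia.
(* The orientation matters: if [e] has height 1, the shorter side from [e.1] to [zz'] is horizontal,
   so listing [zz'] first keeps the rows of both ends. *)
exists e, (zz', zz); split=> //.
set u1 := ((zp zz).1 - (zp e.1).1)%Z in q1; set u2 := ((zp zz).2 - (zp e.1).2)%Z in q2.
set v1 := ((zp zz').1 - (zp e.1).1)%Z in q1; set v2 := ((zp zz').2 - (zp e.1).2)%Z in q2.
have w1 : ((zp e.2).1 - (zp e.1).1 = u1 + v1)%Z by rewrite /u1 /v1; lia.
have w2 : ((zp e.2).2 - (zp e.1).2 = u2 + v2)%Z by rewrite /u2 /v2; lia.
have hd : (u1 * v2 - u2 * v1 = 1 \/ u1 * v2 - u2 * v1 = -1)%Z.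
  have -> : (u1 * v2 - u2 * v1 = side (zp e.1) (zp zz) (zp zz'))%Z by rewrite /side /u1 /u2 /v1 /v2; ring.
  by move: dd; move: (side _ _ _); clear => x hx; case: (Z.eq_mul_1 _ _ hx); lia.
have [|||g0 [gh1 gh2]] := @flip_gain u1 u2 v1 v2 (Z.of_nat k) hd q1 q2.
- by move: hl; rewrite /l1 -/u1 -/u2 -/v1 -/v2.
- by rewrite -w1; move: hsp; rewrite /spans; lia.
- by rewrite -w2; have [_ b1] := zp_inbox e.1; have [_ b2] := zp_inbox e.2; lia.
have el : Z.of_nat (elen e) = (Z.abs (u1 + v1) + Z.abs (u2 + v2))%Z.
  by rewrite [e]surjective_pairing elenE /l1 w1 w2.
have el' : Z.of_nat (elen (zz', zz)) = (Z.abs (u1 - v1) + Z.abs (u2 - v2))%Z.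
  by rewrite elenE /l1 /u1 /u2 /v1 /v2; clear; lia.
have wd : Z.of_nat (width e) = Z.abs (u1 + v1) by rewrite -w1 /width /natdist /zp /=; clear; lia.
have hg : Z.of_nat (height e) = Z.abs (u2 + v2) by rewrite -w2 /height /natdist /zp /=; clear; lia.
have wd' : Z.of_nat (width (zz', zz)) = Z.abs (u1 - v1).
  by rewrite /width /natdist /u1 /v1 /zp /=; clear; lia.
split.
- by move: m1 m2; rewrite /same_mid /zp /=; lia.
- by move: g0 el el'; clear; lia.
- move=> h1; have [|v20 hw] := gh1; first by rewrite -hg h1.
  split; last by lia.
    by apply: ord_inj; move: v20; rewrite /v2 /zp /=; lia.
  by apply: ord_inj; move: v20 m2; rewrite /v2 /zp /=; lia.
move=> h1; have {}gh2 := gh2 ltac:(move: h1 hg; clear; lia).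
have gE : (Z.abs (u1 + v1) + Z.abs (u2 + v2) - Z.abs (u1 - v1) - Z.abs (u2 - v2)
    = Z.of_nat (elen e - elen (zz', zz)))%Z by move: g0 el el'; clear; lia.
by rewrite gE -wd in gh2; move: gh2; clear; lia.
Qed.

(** Induction on the total length, with [phi] following each edge through its flips. A flip of an
    edge of height 1 shortens it by 2 and reduces its depth by at most 1, so the gains telescope.
    For any other height the first flip alone already pays for [gain e]. *)
Lemma descent s : triangulation s -> exists s' (phi : edge n k -> edge n k),
  [/\ triangulation s', forall e, e \in s' -> ~~ spansE e, s' = phi @: s &
    {in s &, injective phi}] /\
  forall e, e \in s -> (~~ spansE e -> phi e = e) /\
    (spansE e -> [/\ same_mid (phi e) e, elen (phi e) + gain e <= elen e &
      height e = 1 -> (phi e).1.2 = e.1.2 /\ (phi e).2.2 = e.2.2]).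
Proof.
have [N] := ubnP (\sum_(e in s) elen e); elim: N s => // N IH s hN hs.
case: (boolP [exists e in s, spansE e]) => [/exists_inP [e0 he0 se0]|]; last first.
  rewrite negb_exists_in => /forall_inP h; exists s, (fun e => e); split; first split=> //.
    by rewrite imset_id.
  by move=> e he; split=> // se; move: (h _ he); rewrite se.
have [e [e' [[he se ne' hs1] [mid el h1 h2]]]] := longest_flip hs he0 se0.
have dec : \sum_(f in e' |: s :\ e) elen f < N.
  rewrite big_setU1 ?in_setD1 ?(negbTE ne') ?andbF //=.
  move: hN el; rewrite (big_setD1 e he) /=; move: (\sum_(i in _) _) => S; clear.
  by move: (elen e) (elen e'); lia.
have [s' [phi [[t1 t2 t3 t4] h3]]] := IH _ dec hs1.
have ee' : e != e' by apply/eqP=> ee; rewrite ee (negbTE ne') in he.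
have in1 f : f \in s -> f != e -> f \in e' |: s :\ e.
  by move=> hf fe; rewrite in_setU1 in_setD1 fe hf orbT.
have in1' : e' \in e' |: s :\ e by rewrite setU11.
exists s', (fun f => if f == e then phi e' else phi f); split; first split=> //.
- rewrite t3; apply/setP=> g; apply/imsetP/imsetP => -[f].
    case/setU1P=> [->|]; first by move=> ->; exists e => //; rewrite eqxx.
    by rewrite in_setD1 => /andP [fe hf] ->; exists f => //; rewrite (negbTE fe).
  case: eqP => [_ _ ->|/eqP fe hf ->]; first by exists e'.
  by exists f => //; apply: in1.
- move=> f g hf hg; case: eqP => [->|/eqP fe]; case: eqP => [->|/eqP ge] //.
  + move/t4 => /(_ in1' (in1 _ hg ge)) eg.
    by rewrite -eg (negbTE ne') in hg.
  + move/t4 => /(_ (in1 _ hf fe) in1') eg.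
    by rewrite eg (negbTE ne') in hf.
  + by apply: t4; apply: in1.
move=> f hf; case: eqP => [->|/eqP fe]; last exact: h3 _ (in1 _ hf fe).
split; first by rewrite se.
move=> _; have [k2 k3] := h3 _ in1'.
have key : [/\ same_mid (phi e') e', elen (phi e') + (if spansE e' then gain e' else 0) <= elen e' &
   height e' = 1 -> (phi e').1.2 = e'.1.2 /\ (phi e').2.2 = e'.2.2].
  case: (boolP (spansE e')) => [/k3 //|/k2 ->].
  by split=> //; rewrite addn0.
case: key => mid' el' hh'; split.
- by case: mid mid' => m1 m2 [m3 m4]; split; clear -m1 m2 m3 m4; lia.
- case: (eqVneq (height e) 1) => [he1|he1].
    have [y1 y2 wE] := h1 he1.
    have he1' : height e' = 1 by rewrite /height y1 y2.
    have elE : elen e' + 2 = elen e by rewrite /elen -/(height e) -/(height e') -/(width e) -/(width e'); move: wE he1 he1'; clear; lia.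
    move: el'; rewrite /gain he1 he1' !eqxx.
    have dE : depth e <= (if spansE e' then depth e' else 0) + 1.
      case: mid => mid _; move: mid wE se; rewrite /spansE /depth /width /natdist.
      case: ifP; clear; lia.
    by move: dE elE; case: ifP => _; clear; lia.
  have : gain e <= elen e - elen e'.
    by apply: gain_le => //; [move: el; clear; lia | apply: h2; apply/eqP].
  by move: el el'; case: ifP => _; clear; lia.
move=> he1; have [y1 y2 wE] := h1 he1; rewrite -y1 -y2; apply: hh'.
by rewrite /height y1 y2.
Qed.

End Descent.

(** * Edges that span a column *)

Section Strip.
Local Open Scope Z_scope.

(** The line through [f1] and [f2] meets the segment from [p] to [r] inside the strip between their
    rows, and the segment from [f1] to [f2] covers that strip. *)
Lemma cross_strip p r f1 f2 : r.2 = p.2 + 1 -> f1.2 <= p.2 -> p.2 + 1 <= f2.2 ->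
  side f1 f2 p * side f1 f2 r < 0 -> Xing p r f1 f2.
Proof.
move=> hr h1 h2 hs; split=> //.
set dy := f2.2 - f1.2.
have e1 : dy * side p r f1 = - (side f1 f2 p + (f1.2 - p.2) * (side f1 f2 r - side f1 f2 p)).
  by rewrite /dy /side hr; ring.
have e2 : dy * side p r f2 = - (side f1 f2 p + (f2.2 - p.2) * (side f1 f2 r - side f1 f2 p)).
  by rewrite /dy /side hr; ring.
have dy0 : 0 < dy by rewrite /dy; lia.
move: e1 e2 hs h1 h2 dy0; clear.
move: (side p r f1) (side p r f2) (side f1 f2 p) (side f1 f2 r) dy (f1.2) (f2.2) (p.2).
move=> A B C D dy y1 y2 j e1 e2 /Z.lt_mul_0 hs h1 h2 dy0.
have [[c d]|[c d]] := hs.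
  have : dy * A > 0 by nia.
  have : dy * B < 0 by nia.
  by move=> hB hA; have ? : B < 0; [nia | have ? : 0 < A; nia].
have : dy * A < 0 by nia.
have : dy * B > 0 by nia.
by move=> hB hA; have ? : 0 < B; [nia | have ? : A < 0; nia].
Qed.

(** [side] is affine along row [y], so an edge separating [p] from [(w, y)] would also separate [p]
    from one of the two outer ends, and thus cross an edge of the fan. *)
Lemma fan_up B G p y w1 w w2 : triang B G -> y = p.2 + 1 -> w1 < w < w2 ->
  G p (w1, y) -> G p (w2, y) -> G p (w, y).
Proof.
move=> T hy hw g1 g2; apply: (triang_max T).
- exact: (triang_inl T g1).
- apply: (triang_convex T (a := w2 - w) (b := w - w1) (c := 0) (p := (w1, y)) (q := (w2, y))
    (r := p)); cbn [fst snd]; try (move: hw; clear; lia).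
  + exact: (triang_inr T g1).
  + exact: (triang_inr T g2).
  + exact: (triang_inl T g1).
- by exists 0, 1; cbn [fst snd]; rewrite hy; ring.
suff key f1 f2 : G f1 f2 -> f1.2 <= p.2 -> p.2 + 1 <= f2.2 -> ~ Xing p (w, y) f1 f2.
  move=> r s hrs hX.
  have [a [b [c [d [a0 [b0 [c0 [d0 [e0 [_ e2]]]]]]]]]] := Xing_weights hX.
  move: e2; cbn [fst snd]; rewrite hy => e2.
  case: (Z_le_gt_dec r.2 p.2) => hr; case: (Z_le_gt_dec s.2 p.2) => hs.
  - by move: e0 e2 a0 b0 c0 d0 hr hs; clear; nia.
  - by apply: (key r s) => //; lia.
  - by apply: (key s r (triang_sym T hrs)); [|lia|exact: Xing_swapr].
  - by move: e0 e2 a0 b0 c0 d0 hr hs; clear; nia.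
move=> hf h1 h2 [_ hs].
have aff v v' : side f1 f2 (v, y) = side f1 f2 (v', y) - (f2.2 - f1.2) * (v - v').
  by rewrite /side; cbn [fst snd]; ring.
case/Z.lt_mul_0: hs => hs'.
  apply: (triang_nX T g1 hf); apply: cross_strip => //.
  apply: Z.mul_neg_pos; first by case: hs'.
  by rewrite (aff w1 w); move: hw h1 h2 hs'; clear; nia.
apply: (triang_nX T g2 hf); apply: cross_strip => //.
apply: Z.mul_pos_neg; first by case: hs'.
by rewrite (aff w2 w); move: hw h1 h2 hs'; clear; nia.
Qed.

Lemma fan_interval B G p y w1 w w2 : triang B G -> y = p.2 + 1 \/ y = p.2 - 1 -> w1 < w < w2 ->
  G p (w1, y) -> G p (w2, y) -> G p (w, y).
Proof.
move=> T [hy|hy] hw g1 g2; first exact: (fan_up T hy hw g1 g2).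
have d : det (1, 0) (0, -1) * det (1, 0) (0, -1) = 1 by [].
have fr x z : frame (0, 0) (1, 0) (0, -1) (x, z) = (x, - z).
  by rewrite /frame; cbn [fst snd]; congr pair; ring.
have := @fan_up _ _ (p.1, - p.2) (- y) w1 w w2 (triang_frame (0, 0) d T).
rewrite !fr !Z.opp_involutive -surjective_pairing; apply=> //.
by cbn [fst snd]; lia.
Qed.

(** If [f] stayed in the half plane x >= a, its lower end would lie to the right of the line of [p]
    and [r]. Its midpoint, level with that of the edge and to the left of it, lies on the other
    side; so the two edges would cross. *)
Lemma between_spans_core a p r f1 f2 : p.1 < a < r.1 -> r.2 = p.2 + 1 ->
  f1.2 + f2.2 = p.2 + r.2 -> f1.2 <= p.2 ->
  2 * a < f1.1 + f2.1 < p.1 + r.1 -> ~ Xing p r f1 f2 -> spans a f1 f2.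
Proof.
move=> ha hr hm hj hN nX; apply: NNPP => ns.
have [x1 x2] : a <= f1.1 /\ a <= f2.1 by move: ns hN; rewrite /spans; clear; lia.
apply: nX.
have c1 : side p r f1 < 0.
  by rewrite /side hr; move: ha x1 hj; clear; nia.
have c12 : side p r f1 + side p r f2 = r.1 + p.1 - (f1.1 + f2.1).
  transitivity ((r.1 - p.1) * (f1.2 + f2.2 - 2 * p.2) - (r.2 - p.2) * (f1.1 + f2.1 - 2 * p.1)).
    by rewrite /side; ring.
  by rewrite hm hr; ring.
have c2 : 0 < side p r f2 by move: c1 c12 hN; clear; lia.
have f2y : f2.2 = 2 * p.2 + 1 - f1.2 by lia.
have d1 : 0 < side f1 f2 p.
  have -> : side f1 f2 p = f1.1 * (f2.2 - p.2) + f2.1 * (p.2 - f1.2) - (f2.2 - f1.2) * p.1.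
    by rewrite /side; ring.
  rewrite f2y; move: x1 x2 hj ha; clear.
  move: (f1.1) (f2.1) (f1.2) (p.1) (p.2) (r.1) => u v y p1 j r1 x1 x2 hj [h1 _].
  have -> : u * (2 * j + 1 - y - j) + v * (j - y) - (2 * j + 1 - y - y) * p1 =
    (u - p1) * (j - y + 1) + (v - p1) * (j - y) by ring.
  by nia.
have d12 : side f1 f2 p + side f1 f2 r = - (f2.2 - f1.2) * (side p r f1 + side p r f2).
  by rewrite /side hr f2y; ring.
have d2 : side f1 f2 r < 0.
  have : 0 < (f2.2 - f1.2) * (side p r f1 + side p r f2).
    by apply: Z.mul_pos_pos; move: c12 hN hj f2y; clear; lia.
  by move: d12 d1; clear; lia.
by split; nia.
Qed.

Lemma side_opp (ex ey : Z) p q r : side (ex * p.1, ey * p.2) (ex * q.1, ey * q.2) (ex * r.1, ey * r.2)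
  = ex * ey * side p q r.
Proof. by rewrite /side; cbn [fst snd]; ring. Qed.

Lemma Xing_opp (ex ey : Z) p q r s : ex * ex = 1 -> ey * ey = 1 ->
  Xing (ex * p.1, ey * p.2) (ex * q.1, ey * q.2) (ex * r.1, ey * r.2) (ex * s.1, ey * s.2) ->
  Xing p q r s.
Proof.
move=> hx hy; rewrite /Xing !side_opp.
have e x y : ex * ey * x * (ex * ey * y) = (ex * ex) * (ey * ey) * (x * y) by ring.
by rewrite !e hx hy !Z.mul_1_l.
Qed.

Lemma between_spans a p r f1 f2 : spans a p r -> Z.abs (r.2 - p.2) = 1 ->
  f1.2 + f2.2 = p.2 + r.2 ->
  2 * a < f1.1 + f2.1 < p.1 + r.1 \/ p.1 + r.1 < f1.1 + f2.1 < 2 * a ->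
  ~ Xing p r f1 f2 -> spans a f1 f2.
Proof.
wlog hpr : p r / p.1 < a < r.1.
  move=> H hs hy hm hN nX; case: (hs) => h; first exact: (H p r).
  apply: (H r p h) => //.
  - by left.
  - by move: hy; clear; lia.
  - by rewrite hm; ring.
  - by move: hN; clear; lia.
  - by move/Xing_swapl.
wlog hf : f1 f2 / f1.2 <= f2.2.
  move=> H hs hy hm hN nX; case: (Z_le_gt_dec f1.2 f2.2) => h; first exact: H.
  suff : spans a f2 f1 by rewrite /spans; clear; lia.
  apply: H => //; try (move: h hm hN; clear; lia).
  by move/Xing_swapr.
move=> hs hy hm hN nX.
(* Reflections in the axes and exchanges of ends reduce the four remaining configurations to the
   core one. *)
have flip (ex ey : Z) : (ex = 1 \/ ex = -1) -> (ey = 1 \/ ey = -1) ->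
    let F P := (ex * P.1, ey * P.2) in
    forall p' r' g1 g2, (p' = p /\ r' = r) \/ (p' = r /\ r' = p) ->
    (g1 = f1 /\ g2 = f2) \/ (g1 = f2 /\ g2 = f1) ->
    (F p').1 < ex * a < (F r').1 -> (F r').2 = (F p').2 + 1 -> (F g1).2 <= (F g2).2 ->
    2 * (ex * a) < (F g1).1 + (F g2).1 < (F p').1 + (F r').1 -> spans a f1 f2.
  move=> hex hey F p' r' g1 g2 hp' hg h1 h2 h3 h4.
  have ex2 : ex * ex = 1 by case: hex => ->.
  have ey2 : ey * ey = 1 by case: hey => ->.
  have : spans (ex * a) (F g1) (F g2).
    apply: (between_spans_core h1 h2) => //.
    - have : g1.2 + g2.2 = p'.2 + r'.2.
        by case: hp' => -[-> ->]; case: hg => -[-> ->]; move: hm; clear; lia.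
      by rewrite /F; cbn [fst snd]; move=> e; rewrite -!Z.mul_add_distr_l e.
    - have : g1.2 + g2.2 = p'.2 + r'.2.
        by case: hp' => -[-> ->]; case: hg => -[-> ->]; move: hm; clear; lia.
      by move: h2 h3; rewrite /F; cbn [fst snd]; case: hey => ->; clear; lia.
    - move/Xing_opp => /(_ ex2 ey2) hX; apply: nX.
      by case: hp' hg hX => -[-> ->] [] [-> ->] hX //;
        do ?[exact: hX | exact: Xing_swapl hX | exact: Xing_swapr hX | exact: Xing_swapl (Xing_swapr hX)].
  rewrite /F /spans; cbn [fst snd].
  by case: hg => -[-> ->]; case: hex => ->; clear; lia.
have [dy|dy] : r.2 = p.2 + 1 \/ r.2 = p.2 - 1 by move: hy; clear; lia.
  case: hN => hN.
    apply: (flip 1 1 _ _ p r f1 f2); cbn [fst snd]; try (by left); move: dy hpr hf hN; clear; lia.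
  apply: (flip (-1) (-1) _ _ r p f2 f1); cbn [fst snd]; try (by left); try (by right); move: dy hpr hf hN; clear; lia.
case: hN => hN.
  apply: (flip 1 (-1) _ _ p r f2 f1); cbn [fst snd]; try (by left); try (by right); move: dy hpr hf hN; clear; lia.
apply: (flip (-1) 1 _ _ r p f1 f2); cbn [fst snd]; try (by left); try (by right); move: dy hpr hf hN; clear; lia.
Qed.

End Strip.

Lemma finite_argmax (T : finType) (P : pred T) (f : T -> R) (x0 : T) : P x0 ->
  exists x, P x /\ forall y, P y -> (f y <= f x)%R.
Proof.
move=> Px0.
have H (l : seq T) : exists x, P x /\ forall y, y \in l -> P y -> (f y <= f x)%R.
  elim: l => [|y l [x [Px h]]]; first by exists x0.
  case: (boolP (P y)) => Py; last first.
    by exists x; split=> // z /[!inE] /orP [/eqP -> Pz|]; [rewrite Pz in Py | exact: h].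
  case: (Rle_dec (f x) (f y)) => hxy.
    exists y; split=> // z /[!inE] /orP [/eqP -> _|hz Pz]; first exact: Rle_refl.
    exact: Rle_trans (h _ hz Pz) hxy.
  exists x; split=> // z /[!inE] /orP [/eqP -> _|]; last exact: h.
  exact/Rlt_le/Rnot_le_lt.
have [x [Px h]] := H (enum T).
by exists x; split=> // y; apply: h; rewrite mem_enum.
Qed.

(** * Midpoints of half-integral height *)

Section Cover.
Variables (n k : nat) (s : {set edge n k}).
Hypothesis hs : triangulation s.
Let W := Z.of_nat (n./2).*2.
Local Open Scope Z_scope.

Let T := triang_Gs hs.

(* Twice the position, with respect to the line through [f1] and [f2], of the
   point [(N / 2, j + 1 / 2)]. *)
Let C (N j : Z) (f1 f2 : Z * Z) : Z :=
  (f2.1 - f1.1) * (2 * j + 1 - 2 * f1.2) - (f2.2 - f1.2) * (N - 2 * f1.1).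

Lemma left_boundary j : 0 <= j < Z.of_nat k -> Gs s (0, j) (0, j + 1).
Proof.
move=> hj; apply: (triang_max T).
- by rewrite /inbox; cbn [fst snd]; rewrite /W; lia.
- by rewrite /inbox; cbn [fst snd]; rewrite /W; lia.
- by exists 0, 1; cbn [fst snd]; ring.
move=> r t hrt hX; have [[r0 _] _] := triang_inl T hrt; have [[t0 _] _] := triang_inr T hrt.
have [a [b [c [d [a0 [b0 [c0 [d0 [e0 [e1 _]]]]]]]]]] := Xing_weights hX.
move: e1; cbn [fst snd] => e1.
have r1 : r.1 = 0 by move: e1 c0 d0 r0 t0; clear; nia.
have t1 : t.1 = 0 by move: e1 c0 d0 r0 t0; clear; nia.
case: hX => _; rewrite /side r1 t1; cbn [fst snd]; lia.
Qed.

(** This is the part needed of the fact that all triangulations have the same midpoints: edges of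
    height 1 have midpoints of half-integral height, and so do the edges they force. *)
Lemma triangulation_cover N j : 0 <= N <= 2 * W -> 0 <= j < Z.of_nat k ->
  exists p q, Gs s p q /\ p.1 + q.1 = N /\ p.2 + q.2 = 2 * j + 1.
Proof.
move=> hN hj; have lb := left_boundary hj.
have [N0|N0] : N = 0 \/ 0 < N by lia.
  by exists (0, j), (0, j + 1); split=> //; cbn [fst snd]; lia.
apply: NNPP => nocov.
pose P (e : edge n k) := asbool (has_edge s e.1 e.2 /\
  (zp e.1).2 <= j /\ j + 1 <= (zp e.2).2 /\ C N j (zp e.1) (zp e.2) < 0).
have PP e : P e <-> has_edge s e.1 e.2 /\
  (zp e.1).2 <= j /\ j + 1 <= (zp e.2).2 /\ C N j (zp e.1) (zp e.2) < 0.
  by rewrite /P /asbool; case: excluded_middle_informative.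
have [e0 Pe0] : exists e, P e.
  case: (lb) => p [q [ep eq h]]; exists (p, q); apply/PP; cbn [fst snd].
    by rewrite -ep -eq /C; cbn [fst snd]; split=> //; move: N0; clear; lia.
(* Twice the horizontal offset, at height j + 1/2, from the point to the edge; it is negative for
   edges on the left of the point. *)
pose mu (e : edge n k) := (IZR (C N j (zp e.1) (zp e.2)) / IZR ((zp e.2).2 - (zp e.1).2))%R.
(* [e] is the last edge to the left of the uncovered midpoint; the midpoint would
   have to lie inside the unimodular triangle on the right of [e]. *)
have [e [/PP [he [h1 [h2 h3]]] mx]] := finite_argmax mu Pe0.
have hG := proj2 (GsP s _ _) he.
set f1 := zp e.1 in h1 h2 h3 hG; set f2 := zp e.2 in h1 h2 h3 hG.
have mx' g1 g2 : Gs s g1 g2 -> g1.2 <= j -> j + 1 <= g2.2 -> C N j g1 g2 < 0 ->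
    C N j g1 g2 * (f2.2 - f1.2) <= C N j f1 f2 * (g2.2 - g1.2).
  case=> p [q [-> -> h]] g1j g2j gneg; have := mx (p, q) (proj2 (PP (p, q)) _).
  rewrite /mu; cbn [fst snd]; move=> /(_ (conj h (conj g1j (conj g2j gneg)))) hle.
  apply: le_IZR; rewrite !mult_IZR.
  have d1 : (0 < IZR (f2.2 - f1.2))%R by apply: IZR_lt; lia.
  have d2 : (0 < IZR ((zp q).2 - (zp p).2))%R by apply: IZR_lt; lia.
  have := Rmult_le_compat_r _ _ _ (Rlt_le _ _ (Rmult_lt_0_compat _ _ d1 d2)) hle.
  rewrite -/f1 -/f2.
  set x := IZR (C _ _ _ _); set y := IZR (C _ _ f1 f2).
  set u := IZR (f2.2 - f1.2) in d1 *; set v := IZR (_ - _) in d2 *.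
  have -> : (x / v * (u * v) = x * u)%R by field; lra.
  by have -> : (y / u * (u * v) = y * v)%R by field; lra.
(* A primitive edge through the point is centred there: the doubled offset from [g1] is an integer
   multiple [m] of the direction, and the rows force [m = 1]. *)
have notmid g1 g2 : Gs s g1 g2 -> g1.2 <= j -> j + 1 <= g2.2 -> C N j g1 g2 <> 0.
  move=> hg g1j g2j c0; have [x [y hxy]] := triang_prim T hg.
  have [|m [m1 m2]] := @prim_colinear _ _ (N - 2 * g1.1) (2 * j + 1 - 2 * g1.2) x y hxy.
    by move: c0; rewrite /C; clear; lia.
  have mm : m = 1.
    move: m2 g1j g2j; clear; move: (g1.2) (g2.2) => y1 y2 h a b.
    have [?|[//|?]] : m <= 0 \/ m = 1 \/ 2 <= m by lia.
      by nia.
    by nia.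
  apply: nocov; exists g1, g2; split=> //; rewrite mm in m1 m2.
  by move: m1 m2; clear; lia.
have [P' [hP' sP']] : exists P', inbox n k P' /\ 0 < side f2 f1 P'.
  have e2 : side f2 f1 (W, j) + side f2 f1 (W, j + 1) =
      - C N j f1 f2 + (f2.2 - f1.2) * (2 * W - N).
    by rewrite /side /C; cbn [fst snd]; ring.
  have : 0 <= (f2.2 - f1.2) * (2 * W - N) by apply: Z.mul_nonneg_nonneg; lia.
  case: (Z_lt_le_dec 0 (side f2 f1 (W, j))) => hh hpos.
    by exists (W, j); split=> //; rewrite /inbox -/W; cbn [fst snd]; lia.
  exists (W, j + 1); split; first by rewrite /inbox -/W; cbn [fst snd]; lia.
  by move: e2 h3 hh hpos; clear; lia.
have [z [sz [hz2 hz1]]] := triang_apex T (triang_sym T hG) hP' sP'.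
have sd : side f1 f2 z = -1 by rewrite sideC sz.
have gam : - C N j f1 f2 >= 1 by lia.
case: (Z_le_gt_dec z.2 j) => hz.
  have hg : Gs s z f2 := triang_sym T hz2.
  have e1 : C N j z f2 * (f2.2 - f1.2) - C N j f1 f2 * (f2.2 - z.2)
      = (2 * f2.2 - 2 * j - 1) * - side f1 f2 z by rewrite /C /side; ring.
  rewrite sd in e1.
  case: (Ztrichotomy (C N j z f2) 0) => [hc|[hc|hc]].
  - by have := mx' _ _ hg hz h2 hc; move: e1 h2; clear; lia.
  - exact: (notmid _ _ hg hz h2 hc).
  (* Twice the barycentric coordinates of the point are integers with sum 2. Those of [f1] and [z],
     which lie in rows at most [j], are at least 1, so the point could not be higher than [j]. *)
  have e2 : (2 * j + 1) * - side f1 f2 z = C N j z f2 * f1.2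
      + (2 * - side f1 f2 z + C N j f1 f2 - C N j z f2) * f2.2 + (- C N j f1 f2) * z.2.
    by rewrite /C /side; ring.
  rewrite sd in e2; move: e2 hc gam h1 h2 hz; clear.
  by move: (C N j z f2) (C N j f1 f2) (f1.2) (f2.2) (z.2); intros; nia.
have hg : Gs s f1 z := triang_sym T hz1.
have hz' : j + 1 <= z.2 by lia.
have e1 : C N j f1 z * (f2.2 - f1.2) - C N j f1 f2 * (z.2 - f1.2)
    = (2 * j + 1 - 2 * f1.2) * - side f1 f2 z by rewrite /C /side; ring.
rewrite sd in e1.
case: (Ztrichotomy (C N j f1 z) 0) => [hc|[hc|hc]].
- by have := mx' _ _ hg h1 hz' hc; move: e1 h1; clear; lia.
- exact: (notmid _ _ hg h1 hz' hc).
have e2 : (2 * j + 1) * - side f1 f2 z = C N j f1 z * f2.2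
    + (2 * - side f1 f2 z + C N j f1 f2 - C N j f1 z) * f1.2 + (- C N j f1 f2) * z.2.
  by rewrite /C /side; ring.
rewrite sd in e2; move: e2 hc gam h1 h2 hz'; clear.
by move: (C N j f1 z) (C N j f1 f2) (f1.2) (f2.2) (z.2); intros; nia.
Qed.
End Cover.

Section Counting.
Variables (n k : nat) (a : 'I_(n./2).*2.+1) (s : {set edge n k}).
Hypothesis hs : triangulation s.
Implicit Types e : edge n k.

(** Twice the distance from the midpoint to the column, so that it stays integral. *)
Definition shift e : nat := natdist (e.1.1 + e.2.1) (a + a).

Lemma mid_between_bound (A x y i w : nat) : i < natdist (x + y) (A + A) ->
  x < w.+1 -> y < w.+1 -> A < w.+1 ->
  (0 <= Z.of_nat (if A + A <= x + y then A + A + i.+1 else A + A - i.+1)%N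
   <= 2 * Z.of_nat w)%Z.
Proof. by rewrite /natdist; case: ifP; lia. Qed.

Lemma mid_between (A x y i : nat) (N := if A + A <= x + y then A + A + i.+1 else A + A - i.+1) :
  i < natdist (x + y) (A + A) -> N <> x + y ->
  (2 * Z.of_nat A < Z.of_nat N < Z.of_nat x + Z.of_nat y \/
   Z.of_nat x + Z.of_nat y < Z.of_nat N < 2 * Z.of_nat A)%Z.
Proof. by rewrite /N /natdist; case: ifP; lia. Qed.

Lemma mid_inj (A x y i i' : nat) : i < natdist (x + y) (A + A) -> i' < natdist (x + y) (A + A) ->
  (if A + A <= x + y then A + A + i.+1 else A + A - i.+1) =
  (if A + A <= x + y then A + A + i'.+1 else A + A - i'.+1) -> i = i'.
Proof. by rewrite /natdist; case: ifP; lia. Qed.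

(** At the height of the midpoint of [e] there are [shift e] half-integral positions after the
    column, up to the midpoint itself. Each is the midpoint of an edge by [triangulation_cover], and
    that edge spans the column by [between_spans]. *)
Lemma shift_le_card e : e \in s -> spansE a e -> height e = 1 ->
  shift e <= #|[set f in s | spansE a f]|.
Proof.
move=> he se hh; have T := triang_Gs hs; have ok := proj1 hs.
have hpq : has_edge s e.1 e.2 by left; rewrite -surjective_pairing.
pose Nf (i : nat) : nat := if (a + a <= e.1.1 + e.2.1)%N then a + a + i.+1 else a + a - i.+1.
have key (i : 'I_(shift e)) : exists f, [/\ f \in s, spansE a f & f.1.1 + f.2.1 = Nf i :> nat].
  have hi := ltn_ord i; rewrite /shift in hi.
  have [hii|hii] : Nf i = e.1.1 + e.2.1 :> nat \/ Nf i <> e.1.1 + e.2.1 :> nat by lia.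
    by exists e.
  have l1 := ltn_ord e.1.1; have l2 := ltn_ord e.2.1.
  have l3 := ltn_ord e.1.2; have l4 := ltn_ord e.2.2; have l5 := ltn_ord a.
  set j := Z.min (Z.of_nat e.1.2) (Z.of_nat e.2.2).
  have [||p [q [[pp [qq [-> -> hpq']]] [m1 m2]]]] :=
      @triangulation_cover n k s hs (Z.of_nat (Nf i)) j.
  - by move: hi l1 l2 l5; rewrite /Nf; clear; exact: mid_between_bound.
  - by move: hh l3 l4; rewrite /j /height /natdist; clear; lia.
  have sp : spans (Z.of_nat a) (zp pp) (zp qq).
    refine (@between_spans _ (zp e.1) (zp e.2) _ _ _ _ _ _ _).
    - exact: (elimT (spansP a e) se).
    - by move: hh; rewrite /height /natdist /zp; cbn [fst snd]; clear; lia.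
    - by rewrite m2; move: hh; rewrite /j /height /natdist /zp; cbn [fst snd]; clear; lia.
    - by rewrite m1; move: hi hii; rewrite /Nf; clear; apply: mid_between.
    - exact: has_edge_nX ok hpq hpq'.
  have m1' : pp.1 + qq.1 = Nf i :> nat by move: m1; rewrite /zp; cbn [fst snd]; clear; lia.
  case: hpq' => h.
    by exists (pp, qq); split=> //; apply/spansP.
  exists (qq, pp); split=> //=; last by lia.
  by apply/spansP; move: sp; rewrite /spans /=; clear; lia.
have [h hP] : exists h : 'I_(shift e) -> edge n k, forall i,
    [/\ h i \in s, spansE a (h i) & (h i).1.1 + (h i).2.1 = Nf i :> nat].
  by exists (fun i => proj1_sig (constructive_indefinite_description _ (key i))) => i;
    case: constructive_indefinite_description.
have inj : injective h.
  move=> i i' eh; apply: ord_inj; have [_ _ e1] := hP i; have [_ _ e2] := hP i'.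
  by apply: (mid_inj (ltn_ord i) (ltn_ord i')); rewrite -/(Nf i) -/(Nf i') -e1 -e2 eh.
rewrite -{1}(card_ord (shift e)) -(card_image inj).
apply: subset_leq_card; apply/subsetP=> f /imageP [i _ ->].
by rewrite inE; have [-> -> _] := hP i.
Qed.
End Counting.

(** * Weight of the fibers *)

Fact RplusA : associative Rplus. Proof. by move=> x y z; ring. Qed.
Fact RmultA : associative Rmult. Proof. by move=> x y z; ring. Qed.
HB.instance Definition _ := Monoid.isComLaw.Build R 0%R Rplus RplusA Rplus_comm Rplus_0_l.
HB.instance Definition _ := Monoid.isComLaw.Build R 1%R Rmult RmultA Rmult_comm Rmult_1_l.
HB.instance Definition _ := Monoid.isMulLaw.Build R 0%R Rmult Rmult_0_l Rmult_0_r.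
Fact RmultDl : left_distributive Rmult Rplus. Proof. by move=> x y z; ring. Qed.
Fact RmultDr : right_distributive Rmult Rplus. Proof. by move=> x y z; ring. Qed.
HB.instance Definition _ := Monoid.isAddLaw.Build R Rmult Rplus RmultDl RmultDr.

Section RealSums.
Local Open Scope R_scope.

Lemma Rsum_le (I : finType) (P : pred I) (F G : I -> R) :
  (forall i, P i -> F i <= G i) ->
  \big[Rplus/0]_(i | P i) F i <= \big[Rplus/0]_(i | P i) G i.
Proof.
move=> h; elim/big_ind2: _ => //; first exact: Rle_refl.
by move=> x1 x2 y1 y2; apply: Rplus_le_compat.
Qed.

Lemma Rsum_ge0 (I : finType) (P : pred I) (F : I -> R) :
  (forall i, P i -> 0 <= F i) -> 0 <= \big[Rplus/0]_(i | P i) F i.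
Proof.
move=> h; elim/big_ind: _ => //; first exact: Rle_refl.
by move=> x y; apply: Rplus_le_le_0_compat.
Qed.

Lemma Rsum_sub (I : finType) (P Q : pred I) (F : I -> R) :
  (forall i, P i -> Q i) -> (forall i, Q i -> 0 <= F i) ->
  \big[Rplus/0]_(i | P i) F i <= \big[Rplus/0]_(i | Q i) F i.
Proof.
move=> sub h; rewrite (big_mkcond P) (big_mkcond Q); apply: Rsum_le => i _.
case: (boolP (P i)) => [/sub -> |_]; first exact: Rle_refl.
by case: ifP => [/h|_] //; apply: Rle_refl.
Qed.

Lemma Rsum_scal (I : finType) (P : pred I) (F : I -> R) c :
  \big[Rplus/0]_(i | P i) (c * F i) = c * \big[Rplus/0]_(i | P i) F i.
Proof. by rewrite big_distrr. Qed.

Lemma Rsum_const (I : finType) (P : pred I) c :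
  \big[Rplus/0]_(i | P i) c = INR #|P| * c.
Proof.
rewrite big_const; elim: #|P| => [|m IH]; first by rewrite /=; ring.
by rewrite iterS IH S_INR; ring.
Qed.

Lemma Rsum_inj (I J : finType) (P : pred I) (Q : pred J) (h : I -> J) (F : J -> R) :
  {in P &, injective h} -> (forall i, P i -> Q (h i)) -> (forall j, Q j -> 0 <= F j) ->
  \big[Rplus/0]_(i | P i) F (h i) <= \big[Rplus/0]_(j | Q j) F j.
Proof.
move=> inj hQ F0; rewrite (partition_big h Q) //=; apply: Rsum_le => j Qj.
case: (pickP [pred i | P i && (h i == j)]) => [i0 /= /andP [Pi0 /eqP hi0]|none].
  rewrite (big_pred1 i0) ?hi0; first exact: Rle_refl.
  move=> i /=; apply/andP/eqP => [[Pi /eqP hi]|->]; last by rewrite hi0.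
  by apply: inj => //; rewrite hi.
by rewrite big_pred0 //; apply: F0.
Qed.

Lemma Rsum_ord_recr m (F : nat -> R) :
  \big[Rplus/0]_(i < m.+1) F i = \big[Rplus/0]_(i < m) F i + F m.
Proof. by rewrite big_ord_recr. Qed.

Lemma geom_sum_le rho m : 0 <= rho < 1 ->
  \big[Rplus/0]_(i < m) (rho ^ i) <= / (1 - rho).
Proof.
move=> hr; have -> : \big[Rplus/0]_(i < m) (rho ^ i) = (1 - rho ^ m) / (1 - rho).
  elim: m => [|m IH]; first by rewrite big_ord0 /=; field; lra.
  by rewrite (Rsum_ord_recr m (fun i => rho ^ i)) IH /=; field; lra.
have := pow_le rho m (proj1 hr); have : 0 < / (1 - rho) by apply: Rinv_0_lt_compat; lra.
by rewrite /Rdiv; nra.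
Qed.

Lemma dist_sum_le W (a : 'I_W) (F : nat -> R) : (forall d, 0 <= F d) ->
  \big[Rplus/0]_(i < W) F (natdist i a) <= 2 * \big[Rplus/0]_(d < W) F d.
Proof.
move=> F0.
have hd (i : 'I_W) : (natdist i a < W)%N.
  have hi := ltn_ord i; have ha := ltn_ord a; move: hi ha; rewrite /natdist.
  by move: (nat_of_ord i) (nat_of_ord a); lia.
apply: Rle_trans (_ : \big[Rplus/0]_(j : bool * 'I_W) F j.2 <= _).
  apply: (@Rsum_inj _ _ xpredT xpredT (fun i : 'I_W => ((i < a)%N, Ordinal (hd i)))
    (fun j => F j.2)) => // i i' _ _ [].
  move=> h1 h2; apply: ord_inj; move: h1 h2; rewrite /natdist.
  by move: (nat_of_ord i) (nat_of_ord i') (nat_of_ord a); lia.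
rewrite -(pair_bigA _ (fun _ i => F (nat_of_ord i))) /= big_bool /=; lra.
Qed.

Lemma exp_sum (I : finType) (P : pred I) (F : I -> R) :
  exp (\big[Rplus/0]_(i | P i) F i) = \big[Rmult/1]_(i | P i) exp (F i).
Proof. by apply: (big_morph exp exp_plus exp_0). Qed.

Lemma INR_sum (I : finType) (P : pred I) (F : I -> nat) :
  INR (\sum_(i | P i) F i)%N = \big[Rplus/0]_(i | P i) INR (F i).
Proof. by apply: (big_morph INR plus_INR). Qed.

Lemma Rprod_le (I : finType) (P : pred I) (F G : I -> R) :
  (forall i, P i -> 0 <= F i <= G i) ->
  0 <= \big[Rmult/1]_(i | P i) F i <= \big[Rmult/1]_(i | P i) G i.
Proof.
move=> h; elim/big_ind2: _ => //; first lra.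
move=> x1 x2 y1 y2 [h1 h2] [h3 h4]; split; first exact: Rmult_le_pos.
exact: Rmult_le_compat.
Qed.

(** The sum over subsets is the expanded product of the factors [1 + x i], each of which is at most
    [exp (x i)]. *)
Lemma subset_sum_le (I : finType) (D : {set I}) (x : I -> R) : (forall i, 0 <= x i) ->
  \big[Rplus/0]_(A : {set I} | A \subset D) \big[Rmult/1]_(i in A) x i
    <= exp (\big[Rplus/0]_(i in D) x i).
Proof.
move=> x0; pose y i := if i \in D then x i else 0.
have y0 i : 0 <= y i by rewrite /y; case: ifP => _ //; apply: Rle_refl.
rewrite (big_mkcond (fun i => i \in D)) exp_sum -/y.
apply: Rle_trans (_ : \big[Rmult/1]_i (y i + 1) <= _); last first.
  apply: (proj2 (Rprod_le _)) => i _; have := y0 i; rewrite -/(y i).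
  by have := exp_ineq1_le (y i); lra.
rewrite bigA_distr.
have term (A : {set I}) : \big[Rmult/1]_i (if i \in A then y i else 1) = \big[Rmult/1]_(i in A) y i.
  by rewrite -big_mkcond.
rewrite (eq_bigr _ (fun A _ => term A)).
apply: Rle_trans (_ : \big[Rplus/0]_(A : {set I} | A \subset D) \big[Rmult/1]_(i in A) y i <= _).
  apply: Rsum_le => A sub; right; apply: eq_bigr => i iA.
  by rewrite /y (subsetP sub).
apply: Rsum_sub => // A _; elim/big_ind: _ => //; first lra.
by move=> *; exact: Rmult_le_pos.
Qed.

End RealSums.

Lemma asboolP (P : Prop) : reflect P (asbool P).
Proof. by rewrite /asbool; case: excluded_middle_informative => h; constructor. Qed.

(** The intervals are half-open so that the empty set has a code too; hence the successor of every
    element must stay below [B]. *)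
Lemma interval_code (B : nat) (P : nat -> Prop) : 0 < B -> (forall w, P w -> w.+1 < B) ->
  (forall w1 w w2, P w1 -> P w2 -> w1 < w < w2 -> P w) ->
  exists c : 'I_B * 'I_B, forall w, P w <-> c.1 <= w < c.2.
Proof.
move=> B0 hB cv.
case: (classic (exists w, P w)) => [[w0 Pw0]|none]; last first.
  exists (Ordinal B0, Ordinal B0) => w /=; split; first by move=> Pw; case: none; exists w.
  by lia.
have ex : exists w, asbool (P w) by exists w0; apply/asboolP.
have ub w : asbool (P w) -> w <= B by move/asboolP/hB; lia.
case: (ex_minnP ex) => lo /asboolP Plo mlo; case: (ex_maxnP ex ub) => hi /asboolP Phi mhi.
have hlo : lo < B by have := hB _ Plo; lia.
have hhi : hi.+1 < B := hB _ Phi.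
exists (Ordinal hlo, Ordinal hhi) => w /=; split=> [Pw|].
  have h : asbool (P w) by apply/asboolP.
  by have := mlo _ h; have := mhi _ h; lia.
move=> hw; have [h1|h1] : lo = w \/ lo < w by lia.
  by rewrite -h1.
have [h2|h2] : hi = w \/ w < hi by lia.
  by rewrite -h2.
by apply: cv Plo Phi _; rewrite h1.
Qed.

Section Fiber.
Variables (n k : nat) (a : 'I_(n./2).*2.+1).
Implicit Types (p q : pt n k) (e f : edge n k) (s t : {set edge n k}).

Definition spanning s : {set edge n k} := [set e in s | spansE a e].

Definition total_gain s : nat := \sum_(e in spanning s) gain a e.

(** The conclusion of [descent] as a relation: the fiber bound then holds for every possible
    outcome, and one is picked only in [rho]. *)
Definition descends s s' : Prop := exists phi : edge n k -> edge n k,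
  [/\ triangulation s', forall e, e \in s' -> ~~ spansE a e, s' = phi @: s &
    {in s &, injective phi}] /\
  forall e, e \in s -> (~~ spansE a e -> phi e = e) /\
    (spansE a e -> [/\ same_mid (phi e) e, elen (phi e) + gain a e <= elen e &
      height e = 1 -> (phi e).1.2 = e.1.2 /\ (phi e).2.2 = e.2.2]).

Lemma spanning_width e : spansE a e -> width e = natdist e.1.1 a + natdist e.2.1 a.
Proof.
rewrite /spansE /width /natdist.
by move: (nat_of_ord e.1.1) (nat_of_ord e.2.1) (nat_of_ord a); lia.
Qed.

Lemma spanning_shift e : spansE a e -> width e = shift a e + 2 * depth a e.
Proof.
rewrite /spansE /width /shift /depth /natdist.
by move: (nat_of_ord e.1.1) (nat_of_ord e.2.1) (nat_of_ord a); lia.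
Qed.

Lemma gain_ge2 e : spansE a e -> 2 <= gain a e.
Proof.
rewrite /gain; case: eqP => _; last by rewrite leq_maxl.
rewrite /spansE /depth /natdist.
by move: (nat_of_ord e.1.1) (nat_of_ord e.2.1) (nat_of_ord a); lia.
Qed.

Lemma width_le_gain e : 0 < k -> height e != 1 -> width e <= k * gain a e.
Proof.
move=> k1 he; rewrite /gain (negbTE he).
apply: leq_trans (_ : k * ((width e + k.-1) %/ k) <= _); last by rewrite leq_mul2l leq_maxr orbT.
by have := divn_eq (width e + k.-1) k; have := ltn_pmod (width e + k.-1) k1; lia.
Qed.

Lemma gain_le_total s e : e \in spanning s -> gain a e <= total_gain s.
Proof. by move=> he; rewrite /total_gain (big_setD1 e he) /= leq_addr. Qed.

Lemma card_spanning_le s : 2 * #|spanning s| <= total_gain s.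
Proof.
rewrite mulnC -sum_nat_const; apply: leq_sum => e.
by rewrite inE => /andP [_]; apply: gain_ge2.
Qed.

(** For height 1 the width is [shift + 2 * depth]: the second term is the gain of the edge, and the
    first is at most the number of spanning edges, each of which gains at least 2. *)
Lemma spanning_width_le s e : 0 < k -> triangulation s -> e \in spanning s ->
  width e <= k.+1 * total_gain s.
Proof.
move=> k1 hs he; have := he; rewrite inE => /andP [hes se].
have hg := gain_le_total he; have hc := card_spanning_le s.
case: (eqVneq (height e) 1) => h1; last first.
  have := width_le_gain k1 h1; move: hg; clear.
  by move: (gain a e) (total_gain s) (width e); nia.
have := shift_le_card hs hes se h1; have := spanning_shift se.
move: hg; rewrite /gain h1 eqxx -/(spanning s); move: hc k1; clear.
by move: (total_gain s) (width e) (shift a e) (depth a e) #|spanning s|; nia.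
Qed.

Lemma descends_elen s s' : descends s s' ->
  \sum_(e in s') elen e + total_gain s <= \sum_(e in s) elen e.
Proof.
case=> phi [[_ _ -> inj] h].
rewrite big_imset //= /total_gain (big_setID [set e in s | spansE a e]) /=.
rewrite [X in _ <= X](big_setID [set e in s | spansE a e]) /=.
have -> : s :&: [set e in s | spansE a e] = spanning s.
  by apply/setP=> e; rewrite !inE andbA andbb.
rewrite addnAC -big_split /=; apply: leq_add; apply: leq_sum => e.
  by rewrite inE => /andP [hes se]; have [_ /(_ se) []] := h _ hes.
rewrite !inE => /andP [ns hes]; have [-> //] := h _ hes.
by move: ns; rewrite hes.
Qed.

Lemma card_near_le L : #|[set b : 'I_(n./2).*2.+1 | natdist b a < L]| <= 2 * L.
Proof.
rewrite -[X in _ <= X]card_ord.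
apply: leq_trans (leq_imset_card (fun i : 'I_(2 * L) => inord (a + i - L)) _).
apply: subset_leq_card; apply/subsetP=> b; rewrite inE => hb.
have hi : b + L - a < 2 * L.
  by move: hb; rewrite /natdist; move: (nat_of_ord a) (nat_of_ord b); lia.
apply/imsetP; exists (Ordinal hi) => //=; apply: ord_inj.
have hb' := ltn_ord b.
have e : a + (b + L - a) - L = b.
  by move: hb; rewrite /natdist; move: (nat_of_ord a) (nat_of_ord b); lia.
by rewrite e inordK.
Qed.

(** If [b] is crossed in [s'] but not in [s], some edge of [s] spans [b] and has been moved, so it
    spans [a] as well. Thus [b] is closer to [a] than the width of that edge. *)
Lemma descends_crossings (A : {set 'I_(n./2).*2.+1}) s s' : 0 < k -> triangulation s ->
  descends s s' ->
  #|[set b in A | asbool (crossing s' b)]| <=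
  #|[set b in A | asbool (crossing s b)]| + 2 * (k.+1 * total_gain s).
Proof.
move=> k1 hs [phi [[ts' _ es' _] h]].
set C := [set b in A | asbool (crossing s b)].
apply: leq_trans (_ : #|C :|: [set b : 'I_(n./2).*2.+1 | natdist b a < k.+1 * total_gain s]| <= _).
  apply: subset_leq_card; apply/subsetP=> b; rewrite !inE => /andP [-> /asboolP cb] /=.
  case: asboolP => //= ncb.
  have [f [hf sf]] : exists f, f \in s /\ spansE b f.
    apply: NNPP => no; apply: ncb; apply: no_span_crossing => // e he.
    by apply/negP=> se; apply: no; exists e.
  have saf : spansE a f.
    apply: contraT => nsaf; have [/(_ nsaf) ef _] := h _ hf.
    have hf' : f \in s' by rewrite es' -ef imset_f.
    by have := crossing_no_span (proj1 ts') cb hf'; rewrite sf.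
  have hfE : f \in spanning s by rewrite inE hf saf.
  apply: leq_trans (spanning_width_le k1 hs hfE).
  move: sf saf; rewrite /spansE /width /natdist.
  by move: (nat_of_ord f.1.1) (nat_of_ord f.2.1) (nat_of_ord a) (nat_of_ord b); lia.
apply: leq_trans (leq_card_setU _ _) _; rewrite leq_add2l; exact: card_near_le.
Qed.

(** A non-spanning edge of [s] survives in [s']. It cannot be the image of a spanning edge of [t],
    because that edge belongs to [s] too and would have the same midpoint. *)
Lemma descends_spanning_inj s t s' : triangulation s -> triangulation t ->
  descends s s' -> descends t s' -> spanning s = spanning t -> s = t.
Proof.
wlog suff sub : s t / triangulation s -> triangulation t ->
    descends s s' -> descends t s' -> spanning s = spanning t -> s \subset t.
  move=> hs ht ds dt est; apply/eqP; rewrite eqEsubset !sub //.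
move=> hs ht [phi [[_ _ es inj] h]] [psi [[_ _ et injt] ht']] est.
apply/subsetP=> f hf; case: (boolP (spansE a f)) => sf.
  by have : f \in spanning t; [rewrite -est inE hf sf | rewrite inE => /andP []].
have [/(_ sf) pf _] := h _ hf.
have : f \in s' by rewrite es -pf imset_f.
rewrite et => /imsetP [g hg fg]; have [k1 k2] := ht' _ hg.
case: (boolP (spansE a g)) => sg; last by rewrite fg (k1 sg).
have [mid _ _] := k2 sg.
have hgs : g \in s by have : g \in spanning s; [rewrite est inE hg sg | rewrite inE => /andP []].
rewrite -fg in mid; have e := same_mid_eq (proj1 hs) hf hgs mid.
by rewrite e sg in sf.
Qed.

End Fiber.

(** * Coding the fans near the column *)

Section FanCode.
Variables (n k : nat) (a : 'I_(n./2).*2.+1) (A : nat).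
Implicit Types (p q : pt n k) (e f : edge n k) (s t : {set edge n k}).

Definition near e : bool := (height e == 1) && (depth a e < A).

(* The end [p] sits in column [a + i - A] (the shift by [A] avoids negative offsets)
   and [w] is the width of the edge. *)
Definition fan s (i y : nat) (up : bool) (w : nat) : Prop := exists p q,
  [/\ has_edge s p q, spansE a (p, q), p.1 + A = a + i & p.2 = y :> nat] /\
  (if up then q.2 = p.2 + 1 :> nat else p.2 = q.2 + 1 :> nat) /\ natdist p.1 q.1 = w.

Lemma spansE_sym p q : spansE a (p, q) = spansE a (q, p).
Proof. by rewrite /spansE orbC. Qed.

Lemma shift_sym p q : shift a (p, q) = shift a (q, p).
Proof. by rewrite /shift /= addnC. Qed.

Lemma height_sym p q : height (p, q) = height (q, p).
Proof. by rewrite /height /natdist addnC. Qed.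

Lemma has_edge_shift s p q : triangulation s -> has_edge s p q -> spansE a (p, q) ->
  height (p, q) = 1 -> shift a (p, q) <= #|spanning a s|.
Proof.
move=> hs [h|h] sp hh; first exact: (shift_le_card hs h sp hh).
rewrite shift_sym; rewrite spansE_sym in sp; rewrite height_sym in hh.
exact: (shift_le_card hs h sp hh).
Qed.

Lemma fan_bound s i y up w : triangulation s -> i <= 2 * A -> fan s i y up w ->
  w.+1 < #|spanning a s| + 2 * A + 2.
Proof.
move=> hs hi [p [q [[hpq sp pi py] [hup hw]]]].
have hh : height (p, q) = 1 by move: hup; rewrite /height /natdist /=; case: up; lia.
have := has_edge_shift hs hpq sp hh; have := spanning_shift sp.
move: pi hw; rewrite /width /depth /natdist /=.
move: (nat_of_ord p.1) (nat_of_ord q.1) (nat_of_ord a) (shift a _) #|_| hi; clear; lia.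
Qed.

Lemma fan_convex s i y up w1 w w2 : triangulation s -> fan s i y up w1 -> fan s i y up w2 ->
  w1 < w < w2 -> fan s i y up w.
Proof.
move=> hs [p [q1 [[h1 sp1 pi1 py1] [hup1 hw1]]]] [p2 [q2 [[h2 sp2 pi2 py2] [hup2 hw2]]]] hw.
have T := triang_Gs hs.
have ep : p2 = p.
  rewrite [p2]surjective_pairing [p]surjective_pairing; congr pair; apply: ord_inj.
    by move: pi1 pi2; move: (nat_of_ord p.1) (nat_of_ord p2.1); clear; lia.
  by rewrite py2.
subst p2.
have eq2 : q2.2 = q1.2.
  by apply: ord_inj; move: hup1 hup2; case: up; move: (nat_of_ord q1.2) (nat_of_ord q2.2); clear; lia.
have hx1 := ltn_ord q1.1; have hx2 := ltn_ord q2.1.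
have [x [hx [hxw [hxs bet]]]] : exists x : nat, x < (n./2).*2.+1 /\ natdist p.1 x = w /\
    ((p.1 < a < x) || (x < a < p.1)) /\ (q1.1 < x < q2.1 \/ q2.1 < x < q1.1).
  case: (ltnP p.1 a) => pa; [exists (p.1 + w) | exists (p.1 - w)];
    move: hw hw1 hw2 sp1 sp2 hx1 hx2 pa; rewrite /spansE /natdist /=; clear;
    by move: (nat_of_ord p.1) (nat_of_ord q1.1) (nat_of_ord q2.1) (nat_of_ord a); lia.
exists p, (Ordinal hx, q1.2); split; last by rewrite /= hxw.
split=> //; apply/GsP.
have zq q : zp q = (Z.of_nat q.1, (zp q).2) by [].
have yy : ((zp q1).2 = (zp p).2 + 1 \/ (zp q1).2 = (zp p).2 - 1)%Z.
  by move: (up) hup1 => [] hup1; rewrite /zp; cbn [fst snd]; move: hup1; move: (nat_of_ord q1.2) (nat_of_ord p.2); clear; lia.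
have g1 : Gs s (zp p) (Z.of_nat q1.1, (zp q1).2) by apply/GsP.
have g2 : Gs s (zp p) (Z.of_nat q2.1, (zp q1).2).
  by have := proj2 (GsP s _ _) h2; rewrite [zp q2]zq /zp eq2.
change (Gs s (zp p) (Z.of_nat x, (zp q1).2)).
case: bet => bet.
  by apply: (fan_interval T yy _ g1 g2); move: bet; clear; lia.
by apply: (fan_interval T yy _ g2 g1); move: bet; clear; lia.
Qed.

Definition fan_index : finType := ('I_(2 * A).+1 * 'I_k.+1 * bool)%type.

Definition fan_codes (B : nat) : finType := {ffun fan_index -> 'I_B * 'I_B}.

Lemma fan_code_ex B s : triangulation s -> B = #|spanning a s| + 2 * A + 2 ->
  exists c : fan_codes B, forall (j : fan_index) w,
    fan s j.1.1 j.1.2 j.2 w <-> (c j).1 <= w < (c j).2.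
Proof.
move=> hs eB; have B0 : 0 < B by rewrite eB addnS.
have key (j : fan_index) : exists c : 'I_B * 'I_B,
    forall w, fan s j.1.1 j.1.2 j.2 w <-> c.1 <= w < c.2.
  apply: interval_code => // [w hw|w1 w w2]; last exact: fan_convex.
  by rewrite eB; apply: fan_bound hs _ hw; rewrite -ltnS.
exists [ffun j => proj1_sig (constructive_indefinite_description _ (key j))] => j w.
by rewrite ffunE; case: constructive_indefinite_description.
Qed.

(** One end, the vertical direction and the width determine an edge of height 1, since spanning the
    column fixes its horizontal direction. *)
Lemma fan_transfer s t p q : (forall (j : fan_index) w, fan s j.1.1 j.1.2 j.2 w ->
    fan t j.1.1 j.1.2 j.2 w) ->
  has_edge s p q -> spansE a (p, q) -> height (p, q) = 1 -> natdist p.1 a < A ->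
  has_edge t p q.
Proof.
move=> tr hpq sp hh hd.
have hi : p.1 + A - a < (2 * A).+1.
  by move: hd; rewrite /natdist; move: (nat_of_ord p.1) (nat_of_ord a); clear; lia.
have := tr (Ordinal hi, p.2, p.2 < q.2) (natdist p.1 q.1) _; case.
  exists p, q; split; split=> //=.
    by move: hd; rewrite /natdist; move: (nat_of_ord p.1) (nat_of_ord a); clear; lia.
  move: hh; rewrite /height /natdist /=; move: (nat_of_ord p.2) (nat_of_ord q.2); clear.
  by move=> y y'; case: ifP; lia.
move=> p' [q' [[h' sp' /= pi py] [hup hw]]].
have ep : p' = p.
  rewrite [p']surjective_pairing [p]surjective_pairing; congr pair; apply: ord_inj => //.
  by move: pi hd; rewrite /natdist; move: (nat_of_ord p.1) (nat_of_ord p'.1) (nat_of_ord a); clear; lia.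
subst p'.
suff -> : q = q' by [].
rewrite [q]surjective_pairing [q']surjective_pairing; congr pair; apply: ord_inj.
  move: hw sp sp'; rewrite /spansE /natdist /=.
  by move: (nat_of_ord p.1) (nat_of_ord q.1) (nat_of_ord q'.1) (nat_of_ord a); clear; lia.
move: hup hh; rewrite /height /natdist /=.
by move: (nat_of_ord p.2) (nat_of_ord q.2) (nat_of_ord q'.2); clear=> y1 y2 y3; case: ifP; lia.
Qed.

(* The orientation of a near edge is recovered from [s'], because the descent keeps
   the rows of both ends of an edge of height 1. *)
Lemma near_transfer s t s' e : triangulation t ->
  descends a s s' -> descends a t s' ->
  (forall (j : fan_index) w, fan s j.1.1 j.1.2 j.2 w -> fan t j.1.1 j.1.2 j.2 w) ->
  e \in spanning a s -> near e -> e \in spanning a t.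
Proof.
move=> ht [phi [[ts' _ es _] hphi]] [psi [[_ _ et _] hpsi]] tr.
rewrite !inE => /andP [hes se] /andP [/eqP he hd]; rewrite se andbT.
have hpq : has_edge s e.1 e.2 by left; rewrite -surjective_pairing.
have sp : spansE a (e.1, e.2) by rewrite -surjective_pairing.
have hh : height (e.1, e.2) = 1 by rewrite -surjective_pairing.
have : has_edge t e.1 e.2.
  have [d|d] : natdist e.1.1 a < A \/ natdist e.2.1 a < A.
    by move: hd; rewrite /depth gtn_min => /orP.
    exact: fan_transfer tr hpq sp hh d.
  apply: has_edgeC; apply: (fan_transfer tr (has_edgeC hpq)) => //.
    by rewrite spansE_sym.
  by rewrite height_sym.
case; rewrite -?surjective_pairing // => hr; exfalso.
have [_ /(_ se) [mid _ /(_ he) [y1 y2]]] := hphi _ hes.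
have hhr : height (e.2, e.1) = 1 by rewrite height_sym.
have [_ /(_ _) [|midr _ /(_ hhr) [z1 z2]]] := hpsi _ hr; first by rewrite spansE_sym.
have i1 : phi e \in s' by rewrite es imset_f.
have i2 : psi (e.2, e.1) \in s' by rewrite et imset_f.
have same : same_mid (phi e) (psi (e.2, e.1)).
  case: mid midr => m1 m2 [/= m3 m4]; split.
    by rewrite m1 m3 addnC.
  by rewrite m2 m4 addnC.
have eq := same_mid_eq (proj1 ts') i1 i2 same.
move: he y1; rewrite eq z1 /height /= => he y1.
by move: he; rewrite y1 /natdist; clear; lia.
Qed.

Definition far_part s : {set edge n k} := [set e in spanning a s | ~~ near e].

Lemma spanning_determined s t s' : triangulation s -> triangulation t ->
  descends a s s' -> descends a t s' ->
  (forall (j : fan_index) w, fan s j.1.1 j.1.2 j.2 w <-> fan t j.1.1 j.1.2 j.2 w) ->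
  far_part s = far_part t -> s = t.
Proof.
move=> hs ht ds dt hf far; apply: (descends_spanning_inj hs ht ds dt).
apply/setP=> e; case: (boolP (near e)) => ne.
  apply/idP/idP => h.
    exact: (near_transfer ht ds dt (fun j w => proj1 (hf j w)) h ne).
  exact: (near_transfer hs dt ds (fun j w => proj2 (hf j w)) h ne).
by move/setP/(_ e): far; rewrite !inE ne !andbT.
Qed.

End FanCode.

(** * Sums of weights over possible spanning edges *)

Section FiberSum.
Local Open Scope R_scope.

Lemma exp_pow x m : exp x ^ m = exp (INR m * x).
Proof.
elim: m => [|m IH]; first by rewrite /= Rmult_0_l exp_0.
by rewrite [LHS]/= IH -exp_plus S_INR; congr exp; ring.
Qed.

(** The inequality [y <= exp y] at y = c(T + b)/d, raised to the power d. *)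
Lemma poly_exp_bound (d b : nat) c : 0 < c ->
  exists C, 0 < C /\ forall T : nat, INR (T + b) ^ d <= C * exp (c * INR T).
Proof.
move=> c0; case: d => [|d].
  exists 1; split; first lra; move=> T; rewrite /= Rmult_1_l -exp_0.
  have [h|h] : 0 < c * INR T \/ 0 = c * INR T by have := pos_INR T; nra.
    exact/Rlt_le/exp_increasing.
  by rewrite -h; apply: Rle_refl.
have d0 : 0 < INR d.+1 by apply: lt_0_INR; lia.
exists ((INR d.+1 / c) ^ d.+1 * exp (c * INR b)); split.
  by apply: Rmult_lt_0_compat; [apply/pow_lt/Rdiv_lt_0_compat | exact: exp_pos].
move=> T; set y := c * INR (T + b) / INR d.+1.
have y0 : 0 <= y.
  apply: Rmult_le_pos; last exact/Rlt_le/Rinv_0_lt_compat.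
  by apply: Rmult_le_pos; [lra | exact: pos_INR].
have -> : INR (T + b) = INR d.+1 / c * y by rewrite /y; field; lra.
rewrite Rpow_mult_distr Rmult_assoc; apply: Rmult_le_compat_l.
  by apply/pow_le/Rlt_le/Rdiv_lt_0_compat.
apply: Rle_trans (_ : exp y ^ d.+1 <= _).
  by apply: pow_incr; split=> //; have := exp_ineq1_le y; lra.
rewrite exp_pow -exp_plus; right; congr exp.
by rewrite /y plus_INR; field; lra.
Qed.

Variables (n k : nat) (a : 'I_(n./2).*2.+1).
Implicit Types (p q : pt n k) (e f : edge n k) (s t : {set edge n k}).

Lemma column_sum_le rho : 0 <= rho < 1 ->
  \big[Rplus/0]_(p : pt n k) rho ^ (natdist p.1 a) <= INR k.+1 * (2 / (1 - rho)).
Proof.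
move=> hr; rewrite -(pair_bigA _ (fun (i : 'I_(n./2).*2.+1) (_ : 'I_k.+1) => rho ^ (natdist i a))) /=.
rewrite (eq_bigr (fun i : 'I_(n./2).*2.+1 => INR k.+1 * rho ^ (natdist i a))); last first.
  by move=> i _; rewrite Rsum_const card_ord.
rewrite Rsum_scal; apply: Rmult_le_compat_l; first exact: pos_INR.
apply: Rle_trans (@dist_sum_le _ a (fun d => rho ^ d) _) _.
  by move=> d; apply: pow_le; lra.
by apply: Rmult_le_compat_l; [lra | exact: geom_sum_le].
Qed.

Variables (kap : R).
Hypothesis kap0 : 0 < kap.

Let th := exp (- kap).

Let th1 : 0 < th < 1.
Proof.
by split; [exact: exp_pos | rewrite -exp_0; apply: exp_increasing; lra].
Qed.

(** The gain is at least width/k, and the width is the sum of the distances of both ends from the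
    column; so the sum is dominated by a product of two geometric sums, one for each end. *)
Lemma steep_sum_le : (0 < k)%N ->
  \big[Rplus/0]_(e : edge n k | spansE a e && (height e != 1)%N)
     exp (- kap * INR (gain a e))
  <= (INR k.+1 * (2 / (1 - exp (- (kap / INR k))))) ^ 2.
Proof.
move=> k1; set rho := exp (- (kap / INR k)).
have k0 : 0 < INR k by apply: lt_0_INR; lia.
have hr : 0 <= rho < 1.
  split; first exact/Rlt_le/exp_pos.
  rewrite -exp_0; apply: exp_increasing.
  by have : 0 < kap / INR k by [apply: Rdiv_lt_0_compat]; lra.
pose F (e : edge n k) := rho ^ (natdist e.1.1 a) * rho ^ (natdist e.2.1 a).
apply: Rle_trans (_ : \big[Rplus/0]_(e : edge n k) F e <= _).
  apply: Rle_trans (_ : \big[Rplus/0]_(e : edge n k | spansE a e && (height e != 1)%N) F e <= _).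
    apply: Rsum_le => e /andP [se he].
    rewrite /F -pow_add plusE -(spanning_width se) exp_pow.
    have /leP/le_INR hw := width_le_gain a k1 he; rewrite mult_INR in hw.
    have : INR (width e) * - (kap / INR k) >= - kap * INR (gain a e).
      have -> : - kap * INR (gain a e) = - (kap / INR k) * (INR k * INR (gain a e)) by field; lra.
      have : 0 < kap / INR k by apply: Rdiv_lt_0_compat.
      by move: hw; nra.
    by case=> [/Rgt_lt/exp_increasing/Rlt_le|->] //; apply: Rle_refl.
  apply: Rsum_sub => // e _; apply: Rmult_le_pos; apply: pow_le; lra.
rewrite -(pair_bigA _ (fun p q : pt n k => rho ^ (natdist p.1 a) * rho ^ (natdist q.1 a))) /=.
rewrite -big_distrlr /= Rmult_1_r.
have h := column_sum_le hr.
have h0 : 0 <= \big[Rplus/0]_(p : pt n k) rho ^ (natdist p.1 a).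
  by apply: Rsum_ge0 => p _; apply: pow_le; lra.
exact: Rmult_le_compat.
Qed.

(** The edge is determined by its nearer end, its shift and the row of the other end. The shift
    costs no gain and contributes the factor [T + 1]. Of the gain [2 * depth], one half makes the
    sum over the nearer end converge and the other yields [th ^ A]. *)
Lemma flat_sum_le (A T : nat) :
  \big[Rplus/0]_(e : edge n k | [&& spansE a e, (height e == 1)%N, (A <= depth a e)%N
      & (shift a e <= T)%N]) exp (- kap * INR (gain a e))
  <= INR T.+1 * (2 * (INR k.+1 * INR k.+1) * (th ^ A * (2 / (1 - th)))).
Proof.
pose b e := (natdist e.1.1 a <= natdist e.2.1 a)%N.
pose h e : bool * pt n k * ('I_T.+1 * 'I_k.+1) :=
  (b e, if b e then e.1 else e.2, (inord (shift a e), if b e then e.2.2 else e.1.2)).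
pose F (j : bool * pt n k * ('I_T.+1 * 'I_k.+1)) := th ^ A * th ^ (natdist j.1.2.1 a).
apply: Rle_trans (_ : \big[Rplus/0]_(e : edge n k | [&& spansE a e, (height e == 1)%N,
    (A <= depth a e)%N & (shift a e <= T)%N]) F (h e) <= _).
  apply: Rsum_le => e /and4P [se he hA hT].
  rewrite /gain he /F /= -pow_add plusE exp_pow.
  have -> : natdist (if b e then e.1 else e.2).1 a = depth a e.
    rewrite /depth /b; case: ifP; move: (natdist e.1.1 a) (natdist e.2.1 a); clear; lia.
  have /leP/le_INR hA' : (A + depth a e <= 2 * depth a e)%N by move: hA; clear; lia.
  have : INR (A + depth a e) * - kap >= - kap * INR (2 * depth a e) by nra.
  by case=> [/Rgt_lt/exp_increasing/Rlt_le|->] //; apply: Rle_refl.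
apply: Rle_trans (@Rsum_inj _ _ _ xpredT h F _ _ _) _ => //.
- move=> e f /and4P [se he hA hT] /and4P [sf hf hA' hT'] [eb ep /(f_equal val) /= es ey].
  rewrite !inordK // in es.
  have eq x : b e = x -> e = f.
    move=> bx; have bf : b f = x by rewrite -eb.
    rewrite bx bf in ep ey; case: x bx bf ep ey => bx bf ep ey.
      rewrite [e]surjective_pairing [f]surjective_pairing ep; congr pair.
      rewrite [e.2]surjective_pairing [f.2]surjective_pairing ey; congr pair; apply: ord_inj.
      move: se sf bx bf es; rewrite /spansE /b /shift /natdist ep.
      move: (nat_of_ord e.2.1) (nat_of_ord f.2.1) (nat_of_ord f.1.1) (nat_of_ord a); clear; lia.
    rewrite [e]surjective_pairing [f]surjective_pairing ep; congr pair.
    rewrite [e.1]surjective_pairing [f.1]surjective_pairing ey; congr pair; apply: ord_inj.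
    move: se sf bx bf es; rewrite /spansE /b /shift /natdist ep.
    move: (nat_of_ord e.1.1) (nat_of_ord f.1.1) (nat_of_ord f.2.1) (nat_of_ord a); clear; lia.
  exact: (eq _ erefl).
- by move=> j _; apply: Rmult_le_pos; apply: pow_le; lra.
rewrite -(pair_bigA _ (fun (i : bool * pt n k) (_ : 'I_T.+1 * 'I_k.+1) =>
    th ^ A * th ^ (natdist i.2.1 a))) /=.
rewrite (eq_bigr (fun i : bool * pt n k => INR (T.+1 * k.+1) *
    (th ^ A * th ^ (natdist i.2.1 a)))); last first.
  by move=> i _; rewrite Rsum_const card_prod !card_ord.
rewrite Rsum_scal mult_INR.
rewrite -(pair_bigA _ (fun (_ : bool) (p : pt n k) => th ^ A * th ^ (natdist p.1 a))) /=.
rewrite big_bool /= Rsum_scal.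
have := column_sum_le (conj (Rlt_le _ _ (proj1 th1)) (proj2 th1)).
set S := \big[Rplus/0]_(_ : _) _ => hS.
have t0 : 0 <= th ^ A by apply: pow_le; lra.
have -> : INR T.+1 * INR k.+1 * (th ^ A * S + th ^ A * S) =
  (2 * INR T.+1 * INR k.+1 * th ^ A) * S by ring.
have -> : INR T.+1 * (2 * (INR k.+1 * INR k.+1) * (th ^ A * (2 / (1 - th)))) =
  (2 * INR T.+1 * INR k.+1 * th ^ A) * (INR k.+1 * (2 / (1 - th))) by ring.
apply: Rmult_le_compat_l => //.
by repeat (apply: Rmult_le_pos); try exact: pos_INR; lra.
Qed.

End FiberSum.

Section FiberBound.
Local Open Scope R_scope.

Lemma weights_prod n k (a : 'I_(n./2).*2.+1) kap (A : {set edge n k}) :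
  exp (- kap * INR (\sum_(e in A) gain a e)) =
  \big[Rmult/1]_(e in A) exp (- kap * INR (gain a e)).
Proof. by rewrite -exp_sum INR_sum Rsum_scal. Qed.

Lemma exp_le x y : x <= y -> exp x <= exp y.
Proof. by case=> [/exp_increasing/Rlt_le//|->]; apply: Rle_refl. Qed.

(* [s] is determined by its fan codes, polynomially many in [T], and its far part,
   for which the sum over all subsets is a convergent product. *)
Lemma fiber_card_bound (k A : nat) kap : (0 < k)%N -> 0 < kap ->
  forall n (a : 'I_(n./2).*2.+1) (s' : {set edge n k}) (T : nat),
  \big[Rplus/0]_(s : {set edge n k} | asbool (triangulation s /\ descends a s s') &&
      (#|spanning a s| == T)) exp (- kap * INR (total_gain a s))
  <= INR (T + (2 * A).+2) ^ (2 * #|fan_index k A|) *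
     exp (INR T.+1 * (2 * (INR k.+1 * INR k.+1) * (exp (- kap) ^ A * (2 / (1 - exp (- kap)))))
          + (INR k.+1 * (2 / (1 - exp (- (kap / INR k))))) ^ 2).
Proof.
move=> k1 kap0 n a s' T.
set B := (T + (2 * A).+2)%N.
have B0 : (0 < B)%N by rewrite /B addnS.
pose D := [set e : edge n k | spansE a e &&
  ((height e == 1) ==> ((A <= depth a e) && (shift a e <= T)))%N].
pose coded (s : {set edge n k}) (c : fan_codes k A B) := forall (j : fan_index k A) w,
  fan a A s j.1.1 j.1.2 j.2 w <-> ((c j).1 <= w < (c j).2)%N.
pose code s := epsilon (inhabits ([ffun=> (Ordinal B0, Ordinal B0)] : fan_codes k A B)) (coded s).
have codeP s : triangulation s -> #|spanning a s| = T -> coded s (code s).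
  move=> hs hT; apply: epsilon_spec; apply: (fan_code_ex hs).
  by rewrite hT /B; clear; lia.
pose h s := (code s, far_part a A s).
pose F (j : fan_codes k A B * {set edge n k}) :=
  \big[Rmult/1]_(e in j.2) exp (- kap * INR (gain a e)).
have F0 j : 0 <= F j.
  by rewrite /F; elim/big_ind: _ => [|x y ? ?|e _]; [lra | exact: Rmult_le_pos | exact/Rlt_le/exp_pos].
apply: Rle_trans (_ : \big[Rplus/0]_(s : {set edge n k} |
   asbool (triangulation s /\ descends a s s') && (#|spanning a s| == T)) F (h s) <= _).
  apply: Rsum_le => s _; rewrite /F -weights_prod; apply: exp_le.
  have /leP/le_INR hg : (\sum_(e in far_part a A s) gain a e <= total_gain a s)%N.
    rewrite /total_gain [X in (_ <= X)%N](big_setID (far_part a A s)) /=.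
    rewrite (setIidPr _) ?leq_addr //.
    by apply/subsetP=> e; rewrite inE => /andP [].
  change (h s).2 with (far_part a A s); clear -hg kap0; nra.
refine (Rle_trans _ _ _ (@Rsum_inj _ _ _
  (fun j : fan_codes k A B * {set edge n k} => j.2 \subset D) h F _ _ _) _) => //.
- move=> s t /andP [/asboolP [hs ds] /eqP hsT] /andP [/asboolP [ht dt] /eqP htT] [ec ef].
  apply: (spanning_determined hs ht ds dt _ ef) => j w.
  by rewrite (codeP _ hs hsT j w) ec -(codeP _ ht htT j w).
- move=> s /andP [/asboolP [hs ds] /eqP hsT]; apply/subsetP=> e.
  rewrite !inE => /andP [/andP [hes se]]; rewrite se /near negb_and -leqNgt /=.
  case: eqP => //= he ->; rewrite /= -hsT; exact: (shift_le_card hs hes se he).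
rewrite -(pair_big xpredT (fun A2 : {set edge n k} => A2 \subset D)
   (fun (_ : fan_codes k A B) A2 => \big[Rmult/1]_(e in A2) exp (- kap * INR (gain a e)))) /=.
rewrite Rsum_const.
have -> : INR #|xpredT : pred (fan_codes k A B)| = INR B ^ (2 * #|fan_index k A|).
  have -> : #|xpredT : pred (fan_codes k A B)| = expn B (2 * #|fan_index k A|).
    by rewrite card_ffun card_prod !card_ord expnM expnS expn1.
  elim: (2 * _)%N => [|m IH]; first by rewrite expn0.
  by rewrite expnS mult_INR IH.
apply: Rmult_le_compat_l; first by apply: pow_le; exact: pos_INR.
apply: Rle_trans (subset_sum_le D _) _; first by move=> e; exact/Rlt_le/exp_pos.
apply: exp_le.
rewrite (bigID (fun e : edge n k => height e == 1)%N) /=.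
apply: Rplus_le_compat.
  apply: Rle_trans (@flat_sum_le n k a kap kap0 A T); right; apply: eq_bigl => e.
  by rewrite inE; case: (height e == 1)%N; rewrite /= ?andbF ?andbT.
apply: Rle_trans (@steep_sum_le n k a kap kap0 k1); right; apply: eq_bigl => e.
by rewrite inE; case: (height e == 1)%N; rewrite /= ?andbF ?andbT.
Qed.

(** With [kap = tau / 2], half of the exponent pays for the sum over configurations with [T]
    spanning edges, and the other half gives [exp (- 2 kap T)], the gain being at least [2 * T]. The
    fan codes consume [exp (kap T)] and the far edges of height 1 consume [exp (kap T / 2)], which
    leaves a convergent geometric series in [T]. *)
Lemma fiber_bound (k : nat) tau : (0 < k)%N -> 0 < tau -> exists K, 0 < K /\
  forall n (a : 'I_(n./2).*2.+1) (s' : {set edge n k}),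
  \big[Rplus/0]_(s : {set edge n k} | asbool (triangulation s /\ descends a s s'))
     exp (- tau * INR (total_gain a s)) <= K.
Proof.
move=> k1 tau0; pose kap := tau / 2.
have kap0 : 0 < kap by rewrite /kap; lra.
set c1 := 2 * (INR k.+1 * INR k.+1) * (2 / (1 - exp (- kap))).
have th1 : 0 < exp (- kap) < 1.
  by split; [exact: exp_pos | rewrite -exp_0; apply: exp_increasing; lra].
have c10 : 0 < c1.
  have kk : 0 < INR k.+1 by apply: lt_0_INR; lia.
  by rewrite /c1; apply: Rmult_lt_0_compat; [nra | apply: Rdiv_lt_0_compat; lra].
(* The cut-off depends on [k] and [tau] only; it has to precede the choice of [C], since the degree
   of the polynomial grows with [A]. *)
have [A hA] : exists A : nat, c1 * exp (- kap) ^ A <= kap / 2.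
  have [||N hN] := pow_lt_1_zero (exp (- kap)) _ (kap / 2 / c1) _.
  - by rewrite Rabs_right; lra.
  - by apply: Rdiv_lt_0_compat; lra.
  exists N; have := hN N (le_n _); rewrite Rabs_right; last by apply/Rle_ge/pow_le; lra.
  move=> h; have := Rmult_lt_compat_l _ _ _ c10 h.
  have -> : c1 * (kap / 2 / c1) = kap / 2 by field; lra.
  by move/Rlt_le.
set C3 := (INR k.+1 * (2 / (1 - exp (- (kap / INR k))))) ^ 2.
have [C [C0 hC]] := poly_exp_bound (2 * #|fan_index k A|) (2 * A).+2 kap0.
pose K := C * exp (kap / 2 + C3) * / (1 - exp (- (kap / 2))).
have r1 : 0 < exp (- (kap / 2)) < 1.
  by split; [exact: exp_pos | rewrite -exp_0; apply: exp_increasing; lra].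
exists K; split.
  by apply: Rmult_lt_0_compat; [apply: Rmult_lt_0_compat => //; exact: exp_pos | apply: Rinv_0_lt_compat; lra].
move=> n a s'.
set M := #|{: edge n k}|.
rewrite (partition_big (fun s => inord #|spanning a s| : 'I_M.+1) xpredT) //=.
apply: Rle_trans (_ : \big[Rplus/0]_(T < M.+1) (C * exp (kap / 2 + C3) * exp (- (kap / 2)) ^ T) <= _).
  apply: Rsum_le => T _.
  rewrite (eq_bigl (fun s : {set edge n k} => asbool (triangulation s /\ descends a s s')
       && (#|spanning a s| == T)%N)); last first.
    move=> s; congr (_ && _); apply/eqP/eqP => [<-|hT]; last by apply: val_inj; rewrite /= hT inordK.
    by rewrite inordK // ltnS max_card.
  apply: Rle_trans (_ : exp (- (2 * kap) * INR T) *
    \big[Rplus/0]_(s : {set edge n k} | asbool (triangulation s /\ descends a s s') &&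
      (#|spanning a s| == T)%N) exp (- kap * INR (total_gain a s)) <= _).
    rewrite -Rsum_scal; apply: Rsum_le => s /andP [_ /eqP hT].
    rewrite -exp_plus; apply: exp_le.
    have /leP/le_INR := card_spanning_le a s; rewrite hT mult_INR /= => hg.
    have -> : tau = 2 * kap by rewrite /kap; field.
    by nra.
  have hf := fiber_card_bound A k1 kap0 a s' T; rewrite -/C3 in hf.
  apply: Rle_trans (Rmult_le_compat_l _ _ _ (Rlt_le _ _ (exp_pos _)) hf) _.
  have hCT := hC T; have e0 := exp_pos (- (2 * kap) * INR T).
  set X := INR T.+1 * _ + C3.
  have hX : X <= kap / 2 * INR T + (kap / 2 + C3).
    have -> : X = INR T.+1 * (c1 * exp (- kap) ^ A) + C3 by rewrite /X /c1; ring.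
    have : INR T.+1 * (c1 * exp (- kap) ^ A) <= INR T.+1 * (kap / 2).
      by apply: Rmult_le_compat_l; [exact: pos_INR | exact: hA].
    by rewrite S_INR; lra.
  apply: Rle_trans (_ : exp (- (2 * kap) * INR T) * (C * exp (kap * INR T) *
      exp (kap / 2 * INR T + (kap / 2 + C3))) <= _).
    apply: Rmult_le_compat_l; first lra.
    apply: Rmult_le_compat => //; [apply: pow_le; exact: pos_INR | exact/Rlt_le/exp_pos | exact: exp_le].
  right; rewrite exp_pow.
  transitivity (C * (exp (- (2 * kap) * INR T) * exp (kap * INR T) *
      exp (kap / 2 * INR T + (kap / 2 + C3)))); first by ring.
  rewrite -!exp_plus Rmult_assoc -exp_plus; congr (C * exp _); field.
rewrite (Rsum_scal _ (fun T : 'I_M.+1 => exp (- (kap / 2)) ^ T)).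
apply: Rmult_le_compat_l; last by apply: geom_sum_le; lra.
by apply: Rmult_le_pos; [lra | exact/Rlt_le/exp_pos].
Qed.

End FiberBound.

(** * Density of crossings *)

Section Window.
Variables (n k m : nat) (x0 : R).
Implicit Types (s : {set edge n k}).

Definition window : {set 'I_(n./2).*2.+1} :=
  [set i : 'I_(n./2).*2.+1 | asbool (in_rect k x0 m ((INR i - INR n./2)%R, 0%R))].

Lemma C_RE s : C_R s x0 m = #|[set b in window | asbool (crossing s b)]|.
Proof.
congr #|pred_of_set _|; apply/setP=> i; rewrite !inE.
by apply/asboolP/andP => [[h1 h2]|[/asboolP h1 /asboolP h2]] //; split=> //; apply/asboolP.
Qed.

Lemma C_R_le s : C_R s x0 m <= #|window|.
Proof. by rewrite C_RE; apply: subset_leq_card; apply/subsetP=> i; rewrite inE => /andP []. Qed.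

(** Neither [x0] nor n/2 has to be an integer. The first index beyond the left side is at most 1
    away from it, and replacing n/2 by [n./2] loses at most 1/2 at each end, so [m] consecutive
    columns still fit. *)
Lemma card_window : (- (INR n / 2) <= x0)%R -> (x0 + INR m <= INR n / 2)%R -> m <= #|window|.
Proof.
move=> h1 h2.
have hn : (INR n <= 2 * INR n./2 + 1)%R.
  have /leP/le_INR : n <= n./2 + n./2 + 1 by lia.
  by rewrite !plus_INR /=; lra.
set y := (x0 + INR n./2)%R; have [u1 u2] := archimed y.
have u0 : (0 <= up y)%Z.
  have : (-1 < up y)%Z by apply: lt_IZR; rewrite /y in u1 *; lra.
  by lia.
have uE : IZR (up y) = INR (Z.to_nat (up y)) by rewrite INR_IZR_INZ Z2Nat.id.
have hb (j : 'I_m) : Z.to_nat (up y) + j < (n./2).*2.+1.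
  have /leP/le_INR hj : j.+1 <= m by [].
  rewrite S_INR in hj.
  have : (INR (Z.to_nat (up y) + j) < INR (n./2 + n./2 + 1))%R.
    by rewrite !plus_INR -uE /=; rewrite /y in u2 *; lra.
  by move/INR_lt; lia.
rewrite -{1}(card_ord m) -(card_image (f := fun j : 'I_m => Ordinal (hb j))); last first.
  by move=> i j [/addnI/ord_inj].
apply: subset_leq_card; apply/subsetP=> i /imageP [j _ ->]; rewrite inE; apply/asboolP.
have /leP/le_INR hj : j.+1 <= m by [].
rewrite S_INR in hj; have := pos_INR j; have := pos_INR k.
rewrite /in_rect; cbn [fst snd nat_of_ord]; rewrite plus_INR -uE /y in u1 u2 *; lra.
Qed.

(** An edge that spans a column has width at least 2, so it is no unit segment, and it meets that
    column within the rectangle. Hence no edge of the boundary condition spans a column of the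
    window. *)
Lemma spans_meets_rect (a : 'I_(n./2).*2.+1) (e : edge n k) : a \in window -> spansE a e ->
  ~ unit_boundary e /\ meets_rect e x0 m.
Proof.
rewrite inE => /asboolP [ha _] se; cbn [fst snd] in ha; split.
  case=> + _; move: se; rewrite /elen /spansE /natdist.
  by move: (nat_of_ord e.1.1) (nat_of_ord e.2.1) (nat_of_ord a); lia.
pose t := ((INR a - INR e.1.1) / (INR e.2.1 - INR e.1.1))%R.
have [d ht] : (INR e.2.1 - INR e.1.1 <> 0 /\ 0 < t < 1)%R.
  case/orP: se => /andP [/ltP/lt_INR i1 /ltP/lt_INR i2].
    split; first lra; rewrite /t; split; first by apply: Rdiv_lt_0_compat; lra.
    by apply: (Rmult_lt_reg_r (INR e.2.1 - INR e.1.1)); [lra | rewrite /Rdiv Rmult_assoc Rinv_l; lra].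
  split; first lra; have -> : t = ((INR e.1.1 - INR a) / (INR e.1.1 - INR e.2.1))%R by rewrite /t; field; lra.
  split; first by apply: Rdiv_lt_0_compat; lra.
  by apply: (Rmult_lt_reg_r (INR e.1.1 - INR e.2.1)); [lra | rewrite /Rdiv Rmult_assoc Rinv_l; lra].
exists (INR a - INR n./2, Y e.1 + t * (Y e.2 - Y e.1))%R; split.
  by exists t; split=> //; split=> //=; rewrite /X /t; field.
split=> //; cbn [fst snd].
have y1 := pos_INR e.1.2; have y2 := pos_INR e.2.2.
have /leP/le_INR y3 : e.1.2 <= k by rewrite -ltnS.
have /leP/le_INR y4 : e.2.2 <= k by rewrite -ltnS.
by rewrite /Y; nra.
Qed.

End Window.

(** * The tilted sum and the lower tail *)

Section Main.
Local Open Scope R_scope.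
Variables (n k m : nat) (x0 lam K : R) (xi : {set edge n k}).
Hypothesis k1 : (0 < k)%N.
Hypothesis lam01 : 0 < lam < 1.
Hypothesis hxi : forall e, e \in xi -> ~ unit_boundary e -> ~ meets_rect e x0 m.

Let tau := - ln lam.
Let zeta := tau / INR (4 * k.+1).

Hypothesis K0 : 0 < K.
Hypothesis hK : forall n (a : 'I_(n./2).*2.+1) (s' : {set edge n k}),
  \big[Rplus/0]_(s : {set edge n k} | asbool (triangulation s /\ descends a s s'))
     exp (- (tau / 2) * INR (total_gain a s)) <= K.

Let tau0 : 0 < tau.
Proof. by rewrite /tau; have := ln_increasing _ _ (proj1 lam01) (proj2 lam01); rewrite ln_1; lra. Qed.

Let zeta0 : 0 < zeta.
Proof. by apply: Rdiv_lt_0_compat => //; apply: lt_0_INR; lia. Qed.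

Let w (s : {set edge n k}) := weight lam s.
Let c (s : {set edge n k}) := INR (C_R s x0 m).
Let Z := \big[Rplus/0]_(s | Omega xi s) w s.
Let F := \big[Rplus/0]_(s | Omega xi s) (w s * exp (- zeta * c s)).

Lemma weightE (s : {set edge n k}) : w s = exp (- tau * INR (\sum_(e in s) elen e)).
Proof.
rewrite /w /weight -{1}(exp_ln lam) ?exp_pow; last lra.
by congr exp; rewrite /tau; ring.
Qed.

Lemma weight_gt0 s : 0 < w s.
Proof. by rewrite weightE; apply: exp_pos. Qed.

Let rho (a : 'I_(n./2).*2.+1) (s : {set edge n k}) : {set edge n k} :=
  epsilon (inhabits s) (descends a s).

Lemma rho_descends a s : triangulation s -> descends a s (rho a s).
Proof. by move=> hs; apply: epsilon_spec; exact: (descent a k1 hs). Qed.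

Lemma rho_Omega a s : a \in window n k m x0 -> Omega xi s ->
  Omega xi (rho a s) && asbool (crossing (rho a s) a).
Proof.
move=> ha /asboolP [hs sub]; have ds := rho_descends a hs.
case: (ds) => phi [[ts' nsp es' _] h].
apply/andP; split; apply/asboolP; last exact: no_span_crossing.
split=> //; apply/subsetP=> e he; have hes := subsetP sub _ he.
have nse : ~~ spansE a e.
  by apply/negP=> se; have [nb mr] := spans_meets_rect ha se; exact: hxi he nb mr.
by have [/(_ nse) pe _] := h _ hes; rewrite es' -pe imset_f.
Qed.

Lemma tilted_weight_le a s : triangulation s ->
  w s * exp (- zeta * c s) <=
  w (rho a s) * exp (- zeta * c (rho a s)) * exp (- (tau / 2) * INR (total_gain a s)).
Proof.
move=> hs; have ds := rho_descends a hs.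
rewrite !weightE -!exp_plus; apply: exp_le.
have /leP/le_INR := descends_elen ds; rewrite plus_INR => h1.
have /leP/le_INR := descends_crossings (window n k m x0) k1 hs ds.
rewrite -!C_RE plus_INR -/(c s) -/(c (rho a s)) mult_INR mult_INR => h2.
have k0 : 0 < INR k.+1 by apply: lt_0_INR; lia.
have zE : zeta * (INR 2 * INR k.+1) = tau / 2.
  have -> : INR 2 = 2 by rewrite /=; ring.
  have -> : zeta = tau / (4 * INR k.+1) by rewrite /zeta mult_INR; congr (_ / (_ * _)); rewrite /=; ring.
  by field; lra.
have h3 : zeta * c (rho a s) <= zeta * c s + tau / 2 * INR (total_gain a s).
  by rewrite -zE; nra.
by nra.
Qed.

Lemma column_bound a : a \in window n k m x0 ->
  F <= K * \big[Rplus/0]_(s | Omega xi s && asbool (crossing s a)) (w s * exp (- zeta * c s)).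
Proof.
move=> ha; rewrite /F (partition_big (rho a) (fun s => Omega xi s && asbool (crossing s a))) /=;
  last by move=> s; exact: rho_Omega.
rewrite -Rsum_scal; apply: Rsum_le => s' _.
set x := w s' * _.
have xp : 0 <= x by apply: Rmult_le_pos; [exact/Rlt_le/weight_gt0 | exact/Rlt_le/exp_pos].
apply: Rle_trans (_ : \big[Rplus/0]_(s : {set edge n k} | asbool (triangulation s /\ descends a s s'))
   (x * exp (- (tau / 2) * INR (total_gain a s))) <= _).
  apply: Rle_trans (_ : \big[Rplus/0]_(s | Omega xi s && (rho a s == s'))
     (x * exp (- (tau / 2) * INR (total_gain a s))) <= _).
    by apply: Rsum_le => s /andP [/asboolP [hs _] /eqP es']; rewrite /x -es'; apply: tilted_weight_le.
  apply: Rsum_sub => s.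
    move=> /andP [/asboolP [hs _] /eqP <-]; apply/asboolP; split=> //; exact: rho_descends.
  by move=> _; apply: Rmult_le_pos => //; exact/Rlt_le/exp_pos.
rewrite Rsum_scal Rmult_comm; apply: Rmult_le_compat_r => //; exact: hK.
Qed.

Lemma window_bound : INR #|window n k m x0| * F <=
  K * \big[Rplus/0]_(s | Omega xi s) (c s * (w s * exp (- zeta * c s))).
Proof.
rewrite -Rsum_const.
apply: Rle_trans (Rsum_le (fun a (ha : a \in window n k m x0) => column_bound ha)) _.
rewrite Rsum_scal; apply: Rmult_le_compat_l; first exact: Rlt_le.
right; rewrite (exchange_big_dep (Omega xi)) /=; last by move=> a s _ /andP [].
apply: eq_bigr => s os; rewrite Rsum_const; congr (INR _ * _).
rewrite C_RE; apply: eq_card => b.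
by rewrite unfold_in os andTb [RHS]inE.
Qed.

(** The sum in [window_bound] is split at [J = 2 * delta * m], twice the threshold of the tail. This
    bounds [F] by a multiple of [exp (- zeta * J)], whereas the exponential Markov inequality at
    [delta * m] gives back only half of that exponent. *)
Lemma tail_bound delta : 0 < delta -> (0 < m)%N -> (m <= #|window n k m x0|)%N ->
  K * (2 * delta) <= / 2 ->
  \big[Rplus/0]_(s | Omega xi s && asbool (c s <= delta * INR m)) w s
  <= 2 * K * exp (- (zeta * delta) * INR m) * Z.
Proof.
move=> d0 m0 hm hd; set M := INR #|window n k m x0|.
have /leP/le_INR hM := hm; rewrite -/M in hM.
have m1 : 0 < INR m by apply: lt_0_INR; lia.
have Zp : 0 <= Z by apply: Rsum_ge0 => s _; exact/Rlt_le/weight_gt0.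
have Fp : 0 <= F.
  by apply: Rsum_ge0 => s _; apply: Rmult_le_pos; [exact/Rlt_le/weight_gt0 | exact/Rlt_le/exp_pos].
set J := 2 * delta * INR m.
have split_le : \big[Rplus/0]_(s | Omega xi s) (c s * (w s * exp (- zeta * c s))) <=
    J * F + M * exp (- zeta * J) * Z.
  rewrite /F /Z -!Rsum_scal -big_split /=; apply: Rsum_le => s _.
  have wp := weight_gt0 s; have ep := exp_pos (- zeta * c s); have eJ := exp_pos (- zeta * J).
  have cp : 0 <= c s := pos_INR _.
  have wep : 0 <= w s * exp (- zeta * c s) by apply: Rmult_le_pos; lra.
  case: (Rle_lt_dec (c s) J) => h.
    have : c s * (w s * exp (- zeta * c s)) <= J * (w s * exp (- zeta * c s)).
      exact: Rmult_le_compat_r.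
    have : 0 <= M * exp (- zeta * J) * w s.
      by apply: Rmult_le_pos; [apply: Rmult_le_pos; [exact: pos_INR | lra] | lra].
    by lra.
  have /leP/le_INR cM := C_R_le m x0 s; rewrite -/(c s) -/M in cM.
  have e1 : exp (- zeta * c s) <= exp (- zeta * J) by apply: exp_le; nra.
  have : c s * (w s * exp (- zeta * c s)) <= M * (w s * exp (- zeta * J)).
    by apply: Rmult_le_compat => //; apply: Rmult_le_compat_l; lra.
  have : 0 <= J * (w s * exp (- zeta * c s)).
    by apply: Rmult_le_pos => //; rewrite /J; nra.
  by lra.
have hF : F <= 2 * K * exp (- zeta * J) * Z.
  have h1 : M * F <= K * (J * F + M * exp (- zeta * J) * Z).
    apply: Rle_trans window_bound _; apply: Rmult_le_compat_l split_le; lra.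
  have h2 : K * J * F <= M / 2 * F.
    apply: Rmult_le_compat_r => //; rewrite /J.
    have : K * (2 * delta) * INR m <= / 2 * INR m by apply: Rmult_le_compat_r; lra.
    by lra.
  have M0 : 0 < M by lra.
  apply: (Rmult_le_reg_l (M / 2)); first lra.
  by lra.
set W := \big[Rplus/0]_(_ | _) _.
have hW : exp (- zeta * (delta * INR m)) * W <= F.
  rewrite /W -Rsum_scal.
  apply: Rle_trans (_ : \big[Rplus/0]_(s | Omega xi s && asbool (c s <= delta * INR m))
     (w s * exp (- zeta * c s)) <= _).
    apply: Rsum_le => s /andP [_ /asboolP hc]; rewrite Rmult_comm.
    apply: Rmult_le_compat_l; first exact/Rlt_le/weight_gt0.
    by apply: exp_le; nra.
  apply: Rsum_sub => s; first by case/andP.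
  by move=> _; apply: Rmult_le_pos; [exact/Rlt_le/weight_gt0 | exact/Rlt_le/exp_pos].
apply: (Rmult_le_reg_l (exp (- zeta * (delta * INR m)))); first exact: exp_pos.
apply: Rle_trans hW _; apply: Rle_trans hF _; right.
have -> : - zeta * J = - zeta * (delta * INR m) + - (zeta * delta) * INR m by rewrite /J; ring.
by rewrite exp_plus; ring.
Qed.

End Main.

Theorem mainTheorem18 :
  forall (k : nat) (lam : R), (1 <= k)%N -> (0 < lam < 1)%R ->
  exists (c delta : R), (0 < c)%R /\ (0 < delta < 1)%R /\
  exists M0 : nat, forall m : nat, (M0 <= m)%N ->
  forall (n : nat) (x0 : R), (1 <= n)%N ->
    (- (INR n / 2) <= x0)%R -> (x0 + INR m <= INR n / 2)%R ->
  forall xi : {set edge n k},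
    boundary_condition xi ->
    (forall e, e \in xi -> ~ unit_boundary e -> ~ meets_rect e x0 m) ->
    (prob lam xi (fun s => (INR (C_R s x0 m) <= delta * INR m)%R)
       <= exp (- (c * INR m)))%R.
Proof.
move=> k lam k1 lam01; pose tau := (- ln lam)%R.
have tau0 : (0 < tau)%R by rewrite /tau; have := ln_increasing _ _ (proj1 lam01) (proj2 lam01); rewrite ln_1; lra.
have [K [K0 hK]] := @fiber_bound k (tau / 2) k1 ltac:(lra).
pose zeta := (tau / INR (4 * k.+1))%R.
have zeta0 : (0 < zeta)%R by apply: Rdiv_lt_0_compat => //; apply: lt_0_INR; lia.
(* This makes [K * (2 * delta)] at most 1/2 and keeps [delta] below 1 for every positive [K]. *)
pose delta := (/ (4 * K + 2))%R.
have delta0 : (0 < delta)%R by apply: Rinv_0_lt_compat; lra.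
have deltaE : (delta * (4 * K + 2) = 1)%R by rewrite /delta; field; lra.
(* Half of the rate [zeta * delta] is given up to absorb the factor [2 * K] for large [m]. *)
exists (zeta * delta / 2)%R, delta; split; first by have := Rmult_lt_0_compat _ _ zeta0 delta0; lra.
split; first by nra.
have zd : (0 < zeta * delta / 2)%R by have := Rmult_lt_0_compat _ _ zeta0 delta0; lra.
have [N hN] := INR_unbounded (2 * K / (zeta * delta / 2)).
exists N.+1 => m hm n x0 n1 h1 h2 xi _ hxi.
have hw := card_window k h1 h2.
have tb := tail_bound k1 lam01 hxi K0 hK delta0 (leq_trans (ltn0Sn N) hm) hw _.
rewrite /prob; set Z := (X in (_ / X)%R); set W := (X in (X / _)%R).
have W0 : (0 <= W)%R by apply: Rsum_ge0 => s _; exact/Rlt_le/(weight_gt0 lam01).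
have WZ : (W <= Z)%R.
  by apply: Rsum_sub => s; [case/andP | move=> _; exact/Rlt_le/(weight_gt0 lam01)].
(* No triangulation containing [xi] needs to be exhibited: if the normalising sum vanishes, so does
   the numerator, and the quotient is 0. *)
have [Z0|Zp] : (Z = 0 \/ 0 < Z)%R by lra.
  have -> : W = 0%R by lra.
  by rewrite /Rdiv Rmult_0_l; exact/Rlt_le/exp_pos.
apply: (Rmult_le_reg_r Z) => //; rewrite /Rdiv Rmult_assoc Rinv_l ?Rmult_1_r; last lra.
have {}tb := tb ltac:(nra); apply: Rle_trans tb _; rewrite -/zeta -/Z.
apply: Rmult_le_compat_r; first lra.
have /leP/le_INR hmN := hm; rewrite S_INR in hmN.
have big : (2 * K <= exp (zeta * delta / 2 * INR m))%R.
  have := exp_ineq1_le (zeta * delta / 2 * INR m).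
  have : (2 * K / (zeta * delta / 2) * (zeta * delta / 2) <= INR m * (zeta * delta / 2))%R.
    by apply: Rmult_le_compat_r; lra.
  have -> : (2 * K / (zeta * delta / 2) * (zeta * delta / 2) = 2 * K)%R by field; lra.
  by lra.
apply: Rle_trans (_ : (exp (zeta * delta / 2 * INR m) * exp (- (zeta * delta) * INR m) <= _)%R).
  by apply: Rmult_le_compat_r => //; exact/Rlt_le/exp_pos.
by rewrite -exp_plus; right; congr exp; field.
Qed.
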